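(* Let $\mathcal{R}=\mathcal{F}\{x_1,\dots,x_n\}$ be a differential polynomial ring over a differential field $\mathcal{F}$ of characteristic $0$ with a finite set $\Delta$ of mutually commuting derivations. Let $\Delta_1,\Delta_2,\Delta_3\subset\Delta$ be pairwise disjoint. Let $P_1,P_2\in\mathcal{R}$, let $z\in\mathcal{R}\setminus\mathcal{F}$, and let $\prec$ be an admissible order on the derivatives such that $\upsilon_{P_i}=\theta_i\upsilon_z$ with $1\neq\theta_i\in\Theta_{\Delta_i}$ for $i=1,2$. Assume moreover that $P_i=(\theta_i-L_i)z$ for $i=1,2$, where $L_1L_2=L_2L_1$ and $L_i\in\mathbf{K}_{\Delta_j}[\Delta_i\cup\Delta_3]$ for $\{i,j\}=\{1,2\}$. Then: (i) For every order on the monomials of $\mathcal{R}$ compatible with $\prec$, the S-polynomial $$\mathrm{S\text{-}Pol}(P_1,P_2)=\theta_2P_1-\theta_1P_2$$ is reduced to $0$ by $\{P_1,P_2\}$ in the sense of differential standard bases. (ii) It is reduced to $0$ by $\{P_1,P_2\}$ in the sense of characteristic sets (pseudo-reduction). (iii) If $z$ is linear, then $\{P_1,P_2\}$ is a differential standard basis of the prime differential ideal $[P_1,P_2]$. (iv) The set $\{P_1,P_2\}$ is a characteristic set of the prime differential ideal $[P_1,P_2]:S_z^{\infty}=[A_1,A_2]:S_A^{\infty}$, where $A_i$ denotes the irreducible factor of $P_i$ whose leading derivative is $\theta_i\upsilon_z$ and $S_A=S_{A_1}S_{A_2}$.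
   Context: Setting: $\mathcal{F}$ is a differential field of characteristic $0$ with a finite set $\Delta=\{\delta_1,\dots,\delta_m\}$ of mutually commuting derivations, and $\mathcal{R}=\mathcal{F}\{X\}$, $X=\{x_1,\dots,x_n\}$, is the ring of differential polynomials. $\Theta$ is the commutative monoid (of derivation operators) generated by $\Delta$; $\Upsilon=\Theta X$ is the set of derivatives. For $D\subset\Delta$, $\Theta_D$ is the commutative monoid generated by $D$, and $\mathbf{K}_D\subset\mathcal{F}$ is the field of elements of $\mathcal{F}$ annihilated by all derivations in $D$. $\mathbf{K}_D[D']$ denotes the ring of linear differential operators that are polynomial expressions in the derivations of $D'$ with coefficients in $\mathbf{K}_D$, the product being composition of operators. An admissible order (ranking) $\prec$ on $\Upsilon$ is a total order with $\upsilon\prec\delta\upsilon$ and ($\upsilon\prec\upsilon'\Rightarrow\delta\upsilon\prec\delta\upsilon'$) for all $\delta\in\Delta$. For $P\in\mathcal{R}\setminus\mathcal{F}$, $\upsilon_P$ is the leading derivative (largest derivative appearing in $P$), the initial $I_P$ is the leading coefficient of $P$ viewed as a polynomial in $\upsilon_P$, and the separant is $S_P=\partial P/\partial\upsilon_P$. $[\Sigma]$ is the differential ideal generated by $\Sigma$ in $\mathcal{R}$; for an ideal $J$ and $H\in\mathcal{R}$, $J:H^\infty=\{f:\exists r\in\mathbf{N},\ H^rf\in J\}$. Pseudo-reduction (characteristic set sense): $P$ is reduced with respect to $A$ if it contains no proper derivative of $\upsilon_A$ and $\deg_{\upsilon_A}P<\deg_{\upsilon_A}A$. Ritt's pseudo-division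 of $P$ by a finite set $\mathcal{A}$ produces $R$, reduced with respect to all elements of $\mathcal{A}$, with $HP-R\in[\mathcal{A}]$ for some product $H$ of powers of initials and separants of elements of $\mathcal{A}$; $P$ is (pseudo-)reduced to $0$ by $\mathcal{A}$ if $R=0$. A set is autoreduced if each element is reduced with respect to the others. A characteristic set of a differential ideal $\mathcal{I}$ is an autoreduced subset of $\mathcal{I}$ by which every element of $\mathcal{I}$ is pseudo-reduced to $0$. Reduction in the sense of differential standard bases: fix an admissible total order on the monomials of $\mathcal{R}$ (compatible with multiplication and with the derivations); it is compatible with $\prec$ if it extends $\prec$ on derivatives. An elementary reduction of $P$ by a set $G$ replaces $P$ by $P-cM\,\theta g$ where $g\in G$, $\theta\in\Theta$, $M$ is a monomial and $c\in\mathcal{F}$ is chosen so as to cancel a monomial of $P$ equal to $M$ times the leading monomial of $\theta g$ (no multiplication of $P$ by initials or separants is allowed). $P$ is reduced to $0$ if finitely many elementary reductions lead to $0$. A differential standard basis of a differential ideal $\mathcal{I}$ is a subset $G\subset\mathcal{I}$ such that every element of $\mathcal{I}$ is reduced to $0$ by $G$ in this sense. ''$z$ is linear'' means that $z$ is a differential polynomial of degree $1$ in the derivatives.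
   Formalization: In (iv), {P1,P2} need not be autoreduced (z = δ1x+δ2x, δ2x≺δ1x, L_i=0, θ_i=δ_i), so ''characteristic set'' is asserted only when it is; in general it is proved with autoreducedness weakened to leader, initial and separant of each P_i being reduced w.r.t. the other. *)

(* Defs.v *)
From HB Require Import structures.
From mathcomp Require Import all_boot all_order all_algebra finmap.
From mathcomp Require Export monalg.
From Stdlib Require Export Relation_Operators.

Set Implicit Arguments.
Unset Strict Implicit.
Unset Printing Implicit Defensive.

Import GRing.Theory.

Local Open Scope fset_scope.
Local Open Scope ring_scope.

(* Theta: the derivation operator \prod_i d_i ^ th i is represented by its    *)
(* exponent vector th, so that composition is addition and the identity is 0. *)
Notation dmon m := {ffun 'I_m -> nat}.

(* Upsilon = Theta X: the pair (th, j) is the derivative th x_j.              *)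
Notation dvar m n := (dmon m * 'I_n)%type.

(* F{x_1, .., x_n} is the polynomial ring over F in the variables dvar m n.   *)
Notation dmonom m n := {cmonom (dvar m n)}.
Notation dpoly F m n := {malg F[dmonom m n]}.

(* Linear operators \sum_th L@_th th, with coefficients on the left. *)
Notation dop F m := {malg F[dmon m]}.

(* The exponent vector of the i-th derivation. *)
Definition dgen m (i : 'I_m) : dmon m := [ffun j => (j == i) : nat].

Section DifferentialField.
Variables (F : fieldType) (m : nat) (d : 'I_m -> F -> F).

Definition derivation (D : F -> F) :=
  (forall a b, D (a + b) = D a + D b) /\
  (forall a b, D (a * b) = D a * b + a * D b).

Definition diff_field0 :=
  [/\ [pchar F] =i pred0,
      forall i, derivation (d i)
    & forall i j a, d i (d j a) = d j (d i a)].

(* K_D *)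
Definition const_field (D : {set 'I_m}) (a : F) :=
  forall i, i \in D -> d i a = 0.

(* Theta_D *)
Definition dmon_on (D : {set 'I_m}) (th : dmon m) :=
  forall i, th i != 0%N -> i \in D.

(* K_D[D'] *)
Definition dop_over (D D' : {set 'I_m}) (L : dop F m) :=
  forall th, th \in msupp L -> const_field D L@_th /\ dmon_on D' th.

End DifferentialField.

Section DifferentialPolynomials.
Variables (F : fieldType) (m n : nat).
Implicit Types (P Q A : dpoly F m n) (u v w : dvar m n) (th : dmon m).

Definition dact th v : dvar m n := (th + v.1, v.2).

Definition dX v : dpoly F m n := << ucm v >>.

Definition in_base P := exists c : F, P = c%:MP.

Definition dvars P : {fset dvar m n} :=
  \bigcup_(M <- msupp P) finsupp (cmonom_val M).

Definition degv v P : nat := \max_(M <- msupp P) M v.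

(* The coefficient of v ^ k in P, a polynomial free of v. *)
Definition coefv v k P : dpoly F m n :=
  \sum_(M <- msupp P | M v == k) << P@_M *g divcm M (expcmn (ucm v) k) >>.

Definition pderiv v P : dpoly F m n :=
  \sum_(M <- msupp P) << P@_M *+ M v *g divcm M (ucm v) >>.

Section Derivations.
Variable d : 'I_m -> F -> F.

(* The derivation of F{x_1, .., x_n} extending d i and mapping each           *)
(* derivative v to dact (dgen i) v.                                           *)
Definition dder i P : dpoly F m n :=
  \sum_(M <- msupp P) << d i P@_M *g M >>
  + \sum_(v <- dvars P) pderiv v P * dX (dact (dgen i) v).

Definition dder_mon th P : dpoly F m n :=
  foldr (fun i Q => iter (th i) (dder i) Q) P (enum 'I_m).

Definition dop_act (L : dop F m) P : dpoly F m n :=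
  \sum_(th <- msupp L) L@_th *: dder_mon th P.

Definition ideal (J : dpoly F m n -> Prop) :=
  [/\ J 0, forall P Q, J P -> J Q -> J (P + Q)
    & forall P Q, J Q -> J (P * Q)].

Definition diff_ideal (J : dpoly F m n -> Prop) :=
  ideal J /\ forall i P, J P -> J (dder i P).

Definition prime_diff_ideal (J : dpoly F m n -> Prop) :=
  [/\ diff_ideal J, ~ J 1 & forall P Q, J (P * Q) -> J P \/ J Q].

(* [S] *)
Definition diff_gen (S : seq (dpoly F m n)) : dpoly F m n -> Prop :=
  fun P => forall J, diff_ideal J -> (forall Q, Q \in S -> J Q) -> J P.

(* J : H^oo *)
Definition saturation (J : dpoly F m n -> Prop) H : dpoly F m n -> Prop :=
  fun P => exists r : nat, J (H ^+ r * P).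

End Derivations.

Definition runit P := exists Q, P * Q = 1.

Definition irreducible P :=
  [/\ P != 0, ~ runit P & forall A B, P = A * B -> runit A \/ runit B].

Definition divides A P := exists B, P = A * B.

Definition strict_total_order (T : eqType) (lt : rel T) :=
  [/\ irreflexive lt, transitive lt
    & forall x y, x != y -> lt x y || lt y x].

Definition ranking (lt : rel (dvar m n)) :=
  [/\ strict_total_order lt,
      forall i v, lt v (dact (dgen i) v)
    & forall i v w, lt v w -> lt (dact (dgen i) v) (dact (dgen i) w)].

Section CharacteristicSets.
Variable lt : rel (dvar m n).

(* v is the leading derivative of P; impossible when P is in F. *)
Definition is_leader P v :=
  v \in dvars P /\ forall w, w \in dvars P -> w = v \/ lt w v.

(* The argument v is meant to be the leading derivative of P. *)
Definition separant v P := pderiv v P.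
Definition initial v P := coefv v (degv v P) P.

Definition reduced_wrt P A :=
  exists u, [/\ is_leader A u,
                forall th, th != 0 -> dact th u \notin dvars P
              & (degv u P < degv u A)%N].

Definition autoreduced (S : seq (dpoly F m n)) :=
  forall P Q, P \in S -> Q \in S -> P <> Q -> reduced_wrt P Q.

Variable d : 'I_m -> F -> F.

(* v is an obstruction to P being reduced with respect to S. *)
Definition reducible_at (S : seq (dpoly F m n)) P v :=
  v \in dvars P /\
  exists A u, [/\ A \in S, is_leader A u
    & (exists2 th, th != 0 & v = dact th u)
      \/ (v = u /\ (degv u A <= degv u P)%N)].

Definition top_reducible_at S P v :=
  reducible_at S P v /\ forall w, reducible_at S P w -> w = v \/ lt w v.

(* One step of Ritt's pseudo-division: the highest power of the highest       *)
(* offending derivative v of P is eliminated.  In the first case, th A has    *)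
(* degree 1 in v = th u, with leading coefficient the separant of A.          *)
Inductive pseudo_step (S : seq (dpoly F m n)) P : dpoly F m n -> Prop :=
| PseudoStepSep A u th v of A \in S & is_leader A u & th != 0
    & v = dact th u & top_reducible_at S P v :
    pseudo_step S P
      (separant u A * P
       - coefv v (degv v P) P * dX v ^+ (degv v P).-1 * dder_mon d th A)
| PseudoStepIni A u of A \in S & is_leader A u
    & (degv u A <= degv u P)%N & top_reducible_at S P u :
    pseudo_step S P
      (initial u A * P
       - coefv u (degv u P) P * dX u ^+ (degv u P - degv u A) * A).

Definition pseudo_remainder (S : seq (dpoly F m n)) P R :=
  clos_refl_trans_1n _ (pseudo_step S) P R /\
  forall A, A \in S -> reduced_wrt R A.

Definition pseudo_reduces_to0 S P := pseudo_remainder S P 0.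

Definition pseudo_reducing_subset S (I : dpoly F m n -> Prop) :=
  (forall A, A \in S -> I A) /\ (forall P, I P -> pseudo_reduces_to0 S P).

Definition characteristic_set S (I : dpoly F m n -> Prop) :=
  autoreduced S /\ pseudo_reducing_subset S I.

(* The weakening of autoreducedness in which only the leading derivative, the *)
(* initial and the separant of each element have to be reduced with respect   *)
(* to the others.                                                             *)
Definition d_triangular (S : seq (dpoly F m n)) :=
  forall P Q u, P \in S -> Q \in S -> P <> Q -> is_leader P u ->
    [/\ reduced_wrt (dX u) Q, reduced_wrt (initial u P) Q
      & reduced_wrt (separant u P) Q].

(* A pair P1 = th1 z, P2 = th2 z need not be autoreduced: for                 *)
(* z = d1 x + d2 x with d2 x < d1 x, th1 = d1 and th2 = d2, the leading       *)
(* derivative d1 d2 x of P2 occurs in P1.  Hence the following variant.       *)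
Definition triangular_characteristic_set S (I : dpoly F m n -> Prop) :=
  d_triangular S /\ pseudo_reducing_subset S I.

End CharacteristicSets.

Section StandardBases.
Variables (d : 'I_m -> F -> F) (mlt : rel (dmonom m n)).
Implicit Types M N : dmonom m n.

Definition is_leading_monomial P M :=
  M \in msupp P /\ forall N, N \in msupp P -> N = M \/ mlt N M.

Definition admissible_monomial_order :=
  [/\ strict_total_order mlt,
      forall M, M != mone -> mlt mone M,
      forall M N N', mlt N N' -> mlt (mmul M N) (mmul M N'),
      forall i M M', M != mone ->
        is_leading_monomial (dder d i << M >>) M' -> mlt M M'
    & forall i M N M' N', mlt M N ->
        is_leading_monomial (dder d i << M >>) M' ->
        is_leading_monomial (dder d i << N >>) N' -> mlt M' N'].

Definition compatible_with (lt : rel (dvar m n)) :=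
  forall v w, lt v w -> mlt (ucm v) (ucm w).

Definition elementary_reduction (G : seq (dpoly F m n)) P Q :=
  exists g th M N (c : F),
    [/\ g \in G, is_leading_monomial (dder_mon d th g) N,
        mmul M N \in msupp P,
        Q = P - c *: (<< M >> * dder_mon d th g)
      & mmul M N \notin msupp Q].

Definition reduces_to0 G P :=
  clos_refl_trans_1n _ (elementary_reduction G) P 0.

Definition diff_standard_basis G (I : dpoly F m n -> Prop) :=
  (forall g, g \in G -> I g) /\ (forall P, I P -> reduces_to0 G P).

End StandardBases.

(* Total degree 1; msize is one more than the total degree. *)
Definition linear_dpoly P := msize P = 2%N.

End DifferentialPolynomials.

(* Main.v *)
Require Import Defs.
From HB Require Import structures.
From mathcomp Require Import all_boot all_order all_algebra finmap.
From mathcomp Require Import ring.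
From Stdlib Require Import Classical IndefiniteDescription.

Set Implicit Arguments.
Unset Strict Implicit.
Unset Printing Implicit Defensive.

Import GRing.Theory.
Local Open Scope ring_scope.

(** Commutation gives SPol = L_2 P_1 - L_1 P_2, a combination of derivatives
    of the P_i whose leaders lie below theta_1 theta_2 v_z. These derivatives
    have pairwise distinct leaders: theta theta_1 = theta' theta_2 would make
    theta, which occurs in L_2, a multiple of theta_2. So no cancellation of
    leading terms takes place and eliminating the leaders one after another
    leads to 0; this is (i) and (ii).

    The same identity is a coherence property: two derivatives of P_1 and P_2
    with the same leader w are proportional modulo derivatives with leaders
    below w. Together with Rosenfeld's descent on the highest leader involved,
    it shows that no nonzero polynomial free of derivatives of the two
    leaders lies in [P_1, P_2] : S_z^oo. Each P_i is linear in its
    leader with initial a scalar multiple of S_z, so every polynomial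
    has, up to a power of S_z, a remainder free of such derivatives. A product
    of two nonzero remainders is again nonzero and free of such derivatives, so
    the ideal is prime, and P_1, P_2 reduce all its elements to 0. If z is
    linear, S_z is a scalar. Termination of all the reductions is Dickson's lemma. *)

(** * Polynomials and the derivatives they involve *)

(** Three points shape the proof. First, [L_i] may contain [theta_i] itself, so the top coefficient
    of [theta_i - L_i] need not be 1; that it is nonzero follows from the prescribed leader of
    [P_i]. Solving the identity for the S-polynomial thus brings in the ratio of the two top
    coefficients. These are not constants in general, and differentiating a relation between the
    [P_i] produces extra terms, harmless because their leaders are lower. Second, a monomial order
    that agrees with the ranking on derivatives says little about products of derivatives: when z is
    not linear, the leading monomial of [P_i] may come from [L_i z]. What survives is that the
    leading monomial of [theta z] determines theta, because a derivation raises the total order, in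
    that derivation, of every monomial by exactly one; so the terms of an operator applied to z
    cannot cancel at the top. Third, a factorisation [P_i = A_i B_i] with the leader in [A_i] splits
    the separant of [P_i] as [S_{A_i} B_i], both factors being free of derivatives of the leaders;
    primality then compares the two saturations. *)

Section Support.
Variables (F : fieldType) (m n : nat).
Implicit Types (P Q A : dpoly F m n) (u v w : dvar m n) (M N : dmonom m n).

Lemma malgMUU c1 c2 M N :
  << c1 *g M >> * << c2 *g N >> = << c1 * c2 *g mmul M N >> :> dpoly F m n.
Proof. by rewrite malgM_def fgmulUU. Qed.

Lemma malgU_eq c M N : M =1 N -> << c *g M >> = << c *g N >> :> dpoly F m n.
Proof. by move=> h; have -> : M = N by apply/eqP/cmP. Qed.

Lemma malg_ind_add (K : dpoly F m n -> Prop) :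
  K 0 -> (forall P Q, K P -> K Q -> K (P + Q)) ->
  (forall c M, K << c *g M >>) -> forall P, K P.
Proof. by move=> K0 KD KU P; rewrite [P]monalgE; apply: big_ind. Qed.

Lemma expcmnE M k v : expcmn M k v = (M v * k)%N.
Proof.
case: k => [|k]; first by rewrite muln0 onecmE.
elim: k => [|k IH]; first by rewrite muln1.
by rewrite -[expcmn _ _]/(mulcm M (expcmn M k.+1)) mulcmE IH -mulnS.
Qed.

Lemma mmulE M N v : mmul M N v = (M v + N v)%N.
Proof. exact: mulcmE. Qed.

Lemma moneE v : (mone : dmonom m n) v = 0%N.
Proof. exact: onecmE. Qed.

Lemma dX_expE v k : dX F v ^+ k = << expcmn (ucm v) k >>.
Proof.
elim: k => [|k IH]; first by rewrite expr0 -mpolyC1E.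
rewrite exprSr IH /dX.
rewrite malgMUU.
rewrite mulr1.
apply: malgU_eq => w.
by rewrite mmulE !expcmnE mulnS addnC.
Qed.

Lemma dvarsP P v :
  reflect (exists2 M, M \in msupp P & M v != 0%N) (v \in dvars P).
Proof.
apply: (iffP (bigfcupP _ _ _ _)) => [[M /andP[MP _] vM]|[M MP Mv]].
  by exists M => //; rewrite cmE_neq0.
by exists M; rewrite ?MP //; rewrite -cmE_neq0.
Qed.

Lemma notin_dvars P v M : v \notin dvars P -> M \in msupp P -> M v = 0%N.
Proof. by move=> vP MP; apply: contraNeq vP => Mv; apply/dvarsP; exists M. Qed.

Definition vall (p : dvar m n -> Prop) P := forall v, v \in dvars P -> p v.

Lemma vallP p P :
  vall p P <-> forall M v, M \in msupp P -> M v != 0%N -> p v.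
Proof.
split=> [h M v MP Mv|h v /dvarsP[M MP Mv]]; last exact: h MP Mv.
by apply: h; apply/dvarsP; exists M.
Qed.

Lemma vallU (p : dvar m n -> Prop) c M :
  (forall v, M v != 0%N -> p v) -> vall p << c *g M >>.
Proof.
move=> h; apply/vallP => N v /(fsubsetP msuppU_le).
by rewrite in_fset1 => /eqP ->; apply: h.
Qed.

Lemma vallC p c : vall p c%:MP.
Proof. by apply: vallU => v; rewrite moneE. Qed.

Lemma vall0 p : vall p 0.
Proof. by rewrite -malgC0E; apply: vallC. Qed.

Lemma vallX (p : dvar m n -> Prop) v : p v -> vall p (dX F v).
Proof.
by move=> pv; apply: vallU => w; rewrite ucmE; case: (v =P w) => [<-|].
Qed.

Lemma dvarsX v : dvars (dX F v) = [fset v]%fset.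
Proof.
apply/fsetP => w; rewrite in_fset1; apply/idP/eqP.
  by move=> h; apply: (vallX (p := fun x => x = v) (erefl v) h).
move=> ->; apply/dvarsP; exists (ucm v); last by rewrite ucmE eqxx.
by rewrite msuppU oner_eq0 in_fset1.
Qed.

Lemma vallD p P Q : vall p P -> vall p Q -> vall p (P + Q).
Proof.
move=> /vallP hP /vallP hQ; apply/vallP => M v /(fsubsetP (msuppD_le _ _)).
by rewrite in_fsetU => /orP[/hP|/hQ]; apply.
Qed.

Lemma vallN p P : vall p P -> vall p (- P).
Proof. by move=> /vallP hP; apply/vallP => M v; rewrite msuppN; apply: hP. Qed.

Lemma vallB p P Q : vall p P -> vall p Q -> vall p (P - Q).
Proof. by move=> hP hQ; apply: vallD => //; apply: vallN. Qed.

Lemma vallM p P Q : vall p P -> vall p Q -> vall p (P * Q).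
Proof.
move=> /vallP hP /vallP hQ; apply/vallP => M v /msuppM_le[M1 [M2 [h1 h2 ->]]].
rewrite mmulE addn_eq0 negb_and => /orP[]; [exact: hP|exact: hQ].
Qed.

Lemma vallZ p c P : vall p P -> vall p (c *: P).
Proof. by move=> h; rewrite -mul_malgC; apply: vallM => //; apply: vallC. Qed.

Lemma vall_sum p (I : eqType) (r : seq I) (E : I -> dpoly F m n) :
  (forall i, i \in r -> vall p (E i)) -> vall p (\sum_(i <- r) E i).
Proof.
move=> h; rewrite big_seq; elim/big_ind: _ => //; first exact: vall0.
by move=> *; apply: vallD.
Qed.

Lemma malgU_prod (M : dmonom m n) c :
  << c *g M >> = c%:MP * \prod_(v <- finsupp (cmonom_val M)) dX F v ^+ M v.
Proof.
under eq_bigr do rewrite dX_expE.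
have -> (r : seq (dvar m n)) : \prod_(v <- r) << expcmn (ucm v) (M v) >> =
   << \big[mmul/mone]_(v <- r) expcmn (ucm v) (M v) >> :> dpoly F m n.
  elim: r => [|v r IH]; first by rewrite !big_nil -mpolyC1E.
  rewrite !big_cons IH malgMUU mulr1; reflexivity.
rewrite malgMUU mulr1 mul1m; apply: malgU_eq => w.
have -> (r : seq (dvar m n)) :
   (\big[mmul/mone]_(v <- r) expcmn (ucm v) (M v) : dmonom m n) w =
   (\sum_(v <- r) (v == w) * M v)%N.
  elim: r => [|v r IH]; first by rewrite !big_nil moneE.
  by rewrite !big_cons mmulE IH expcmnE ucmE.
case: (boolP (w \in finsupp (cmonom_val M))) => wM.
  rewrite (big_fsetD1 w) //= eqxx mul1n big1_fset ?addn0 // => v.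
  by rewrite in_fsetD1 => /andP[/negPf ->].
have -> : M w = 0%N by apply/eqP; rewrite cmE_eq0.
by rewrite big1_fset // => v vM _; case: eqP vM wM => // -> ->.
Qed.

(** Structural induction: a polynomial is built from scalars and the derivatives that occur in it,
    so laws of derivations need checking only there. *)
Lemma vall_ind (p : dvar m n -> Prop) (K : dpoly F m n -> Prop) :
  (forall c, K c%:MP) -> (forall P Q, K P -> K Q -> K (P + Q)) ->
  (forall P Q, K P -> K Q -> K (P * Q)) -> (forall v, p v -> K (dX F v)) ->
  forall P, vall p P -> K P.
Proof.
move=> KC KD KM KX P pP.
have K0 : K 0 by rewrite -malgC0E.
have K1 : K 1 by rewrite -mpolyC1E.
rewrite [P]monalgE big_seq; apply: (big_ind _ K0 KD) => M MP.
rewrite malgU_prod; apply: (KM); first exact: KC.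
rewrite big_seq; apply: (big_ind _ K1 KM) => v vM.
have Kv : K (dX F v).
  by apply/KX/pP/dvarsP; exists M; rewrite ?cmE_neq0.
elim: (M v) => [|k IH]; first by rewrite expr0; exact: K1.
by rewrite exprS; apply: (KM); [exact: Kv|exact: IH].
Qed.

(** The supports of [P], [Q] and [P + Q] differ, also through cancellation; all three sums are first
    extended to the union of the supports of [P] and [Q], where the extra coefficients are 0. *)
Lemma big_msupp_sum (V : zmodType) (h : dmonom m n -> F -> V) :
  (forall M, h M 0 = 0) -> (forall M a b, h M (a + b) = h M a + h M b) ->
  {morph (fun P => \sum_(M <- msupp P) h M P@_M) : P Q / P + Q}.
Proof.
move=> h0 hD P Q.
have ext R (D : {fset dmonom m n}) : (msupp R `<=` D)%fset ->
    \sum_(M <- msupp R) h M R@_M = \sum_(M <- D) h M R@_M.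
  by move=> RD; apply: big_fset_incl => // M _ /mcoeff_outdom ->.
rewrite (ext _ _ (msuppD_le P Q)) (ext P _ (fsubsetUl _ (msupp Q))).
rewrite (ext Q _ (fsubsetUr (msupp P) _)) -big_split /=.
by apply: eq_bigr => M _; rewrite mcoeffD hD.
Qed.

Lemma big_msuppU (V : zmodType) (h : dmonom m n -> F -> V) c M :
  h M 0 = 0 ->
  \sum_(N <- msupp (<< c *g M >> : dpoly F m n)) h N << c *g M >>@_N = h M c.
Proof.
move=> h0; rewrite msuppU; case: eqP => [->|_]; first by rewrite big_nil h0.
by rewrite big_seq_fset1 mcoeffUU.
Qed.

End Support.

(** These additivity identities live in an arbitrary commutative ring; at [dpoly] they are only
    instantiated, to feed the extension lemmas below. *)
Lemma derivation_rule_addl (R : comNzRingType) (D : R -> R) :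
  {morph D : P Q / P + Q} -> forall P1 P2 Q,
  D (P1 + P2) * Q + (P1 + P2) * D Q =
  (D P1 * Q + P1 * D Q) + (D P2 * Q + P2 * D Q).
Proof. by move=> DD P1 P2 Q; rewrite DD; ring. Qed.

Lemma derivation_rule_addr (R : comNzRingType) (D : R -> R) :
  {morph D : P Q / P + Q} -> forall P Q1 Q2,
  D P * (Q1 + Q2) + P * D (Q1 + Q2) =
  (D P * Q1 + P * D Q1) + (D P * Q2 + P * D Q2).
Proof. by move=> DD P Q1 Q2; rewrite DD; ring. Qed.

Lemma convolution_addl (R : comNzRingType) (D : nat -> R -> R) k :
  (forall j, {morph D j : P Q / P + Q}) -> forall P1 P2 Q,
  \sum_(j < k.+1) D j (P1 + P2) * D (k - j)%N Q =
  \sum_(j < k.+1) D j P1 * D (k - j)%N Q +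
  \sum_(j < k.+1) D j P2 * D (k - j)%N Q.
Proof.
move=> DD P1 P2 Q; rewrite -big_split /=.
by apply: eq_bigr => j _; rewrite DD mulrDl.
Qed.

Lemma convolution_addr (R : comNzRingType) (D : nat -> R -> R) k :
  (forall j, {morph D j : P Q / P + Q}) -> forall P Q1 Q2,
  \sum_(j < k.+1) D j P * D (k - j)%N (Q1 + Q2) =
  \sum_(j < k.+1) D j P * D (k - j)%N Q1 +
  \sum_(j < k.+1) D j P * D (k - j)%N Q2.
Proof.
move=> DD P Q1 Q2; rewrite -big_split /=.
by apply: eq_bigr => j _; rewrite DD mulrDr.
Qed.

Lemma power_sum_add (R : comNzRingType) (D : nat -> R -> R) (x : R) k :
  (forall j, {morph D j : P Q / P + Q}) -> forall P Q,
  \sum_(j < k) D j (P + Q) * x ^+ j =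
  \sum_(j < k) D j P * x ^+ j + \sum_(j < k) D j Q * x ^+ j.
Proof.
move=> DD P Q; rewrite -big_split /=.
by apply: eq_bigr => j _; rewrite DD mulrDl.
Qed.

(** The multiplication rule for powers of one derivative: exponents [a] and [b] contribute to the
    coefficient of index [k] only through the split [j = a]. *)
Lemma sum_split_if (V : nmodType) (x : V) (a b k : nat) :
  \sum_(j < k.+1) (if (a == j) && (b == k - j)%N then x else 0) =
  if (a + b == k)%N then x else 0.
Proof.
case: eqP => [abk|abk].
  have ak : (a < k.+1)%N by rewrite ltnS -abk leq_addr.
  rewrite (bigD1 (Ordinal ak)) //= eqxx -{1}abk addKn eqxx big1 ?addr0 // => j.
  by rewrite -val_eqE /= eq_sym => /negPf ->.
apply: big1 => j _; case: ifP => // /andP[/eqP aj /eqP bj]; case: abk.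
by rewrite aj bj subnKC // -ltnS.
Qed.

Lemma sum_pick_if (V : nmodType) (x : V) (a k : nat) :
  (a < k)%N -> \sum_(j < k) (if a == j then x else 0) = x.
Proof.
move=> ak; rewrite (bigD1 (Ordinal ak)) //= eqxx big1 ?addr0 // => j.
by rewrite -val_eqE /= eq_sym => /negPf ->.
Qed.

(** * Coefficients, degree and partial derivative with respect to one derivative *)

Section Coefficients.
Variables (F : fieldType) (m n : nat).
Implicit Types (P Q A : dpoly F m n) (u v w : dvar m n) (M N : dmonom m n).

(** Reduces the product rules for [pderiv], [coefv] and [dercoef] to pairs of monomials, where they
    can be computed. *)
Lemma bilin_ext (f g : dpoly F m n -> dpoly F m n -> dpoly F m n) :
  (forall P1 P2 Q, f (P1 + P2) Q = f P1 Q + f P2 Q) ->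
  (forall P1 P2 Q, g (P1 + P2) Q = g P1 Q + g P2 Q) ->
  (forall P Q1 Q2, f P (Q1 + Q2) = f P Q1 + f P Q2) ->
  (forall P Q1 Q2, g P (Q1 + Q2) = g P Q1 + g P Q2) ->
  (forall c b M N, f << c *g M >> << b *g N >> = g << c *g M >> << b *g N >>) ->
  forall P Q, f P Q = g P Q.
Proof.
move=> fl gl fr gr e P Q.
have f0r A : f A 0 = 0 by apply: (addrI (f A 0)); rewrite -fr !addr0.
have g0r A : g A 0 = 0 by apply: (addrI (g A 0)); rewrite -gr !addr0.
have f0l A : f 0 A = 0 by apply: (addrI (f 0 A)); rewrite -fl !addr0.
have g0l A : g 0 A = 0 by apply: (addrI (g 0 A)); rewrite -gl !addr0.
elim/malg_ind_add: P => [|P1 P2 h1 h2|c M]; first by rewrite f0l g0l.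
  by rewrite fl gl h1 h2.
elim/malg_ind_add: Q => [|P1 P2 h1 h2|b N]; first by rewrite f0r g0r.
  by rewrite fr gr h1 h2.
exact: e.
Qed.

(** Only the monomials of [P] itself are compared, so that a degree bound on [P] is available for
    each of them in [coefv_expand]. *)
Lemma add_ext (V : zmodType) (f g : dpoly F m n -> V) P :
  {morph f : A B / A + B} -> {morph g : A B / A + B} ->
  (forall M, M \in msupp P -> f << P@_M *g M >> = g << P@_M *g M >>) ->
  f P = g P.
Proof.
move=> fD gD e.
have f0 : f 0 = 0 by apply: (addrI (f 0)); rewrite -fD !addr0.
have g0 : g 0 = 0 by apply: (addrI (g 0)); rewrite -gD !addr0.
rewrite [P]monalgE big_seq.
rewrite (big_morph f fD f0) (big_morph g gD g0).
by apply: eq_bigr => M /e.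
Qed.

Lemma pderiv_is_nmod_morphism v : nmod_morphism (@pderiv F m n v).
Proof.
split; first by rewrite /pderiv msupp0 big_nil.
move=> P Q; apply: (big_msupp_sum (h := fun M c =>
  << c *+ M v *g divcm M (ucm v) >>)) => [M|M a b].
  by rewrite mul0rn monalgU0.
by rewrite mulrnDl monalgUD.
Qed.

HB.instance Definition _ v :=
  GRing.isNmodMorphism.Build _ _ (pderiv v) (pderiv_is_nmod_morphism v).

Lemma pderivD v P Q : pderiv v (P + Q) = pderiv v P + pderiv v Q.
Proof. exact: raddfD. Qed.

Lemma pderivU v c M :
  pderiv v << c *g M >> = << c *+ M v *g divcm M (ucm v) >> :> dpoly F m n.
Proof.
rewrite /pderiv (big_msuppU (h := fun M c =>
  << c *+ M v *g divcm M (ucm v) >>)); first by [].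
by rewrite mul0rn monalgU0.
Qed.

Lemma coefv_is_nmod_morphism v k : nmod_morphism (@coefv F m n v k).
Proof.
split; first by rewrite /coefv msupp0 big_nil.
move=> P Q; rewrite /coefv 3!(big_mkcond (fun M => M v == k)).
apply: (big_msupp_sum (h := fun M c =>
  if M v == k then << c *g divcm M (expcmn (ucm v) k) >> else 0)) => [M|M a b].
  by case: (M v == k); [rewrite monalgU0|].
case: (M v == k); last by exact: (esym (addr0 _)).
exact: monalgUD.
Qed.

HB.instance Definition _ v k :=
  GRing.isNmodMorphism.Build _ _ (coefv v k) (coefv_is_nmod_morphism v k).

Lemma coefvD v k P Q : coefv v k (P + Q) = coefv v k P + coefv v k Q.
Proof. exact: raddfD. Qed.

Lemma coefv_sum v k (I : Type) (r : seq I) (E : I -> dpoly F m n) :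
  coefv v k (\sum_(i <- r) E i) = \sum_(i <- r) coefv v k (E i).
Proof. exact: raddf_sum. Qed.

Lemma coefvU v k c M :
  coefv v k << c *g M >> =
    (if M v == k then << c *g divcm M (expcmn (ucm v) k) >> else 0)
    :> dpoly F m n.
Proof.
rewrite /coefv big_mkcond (big_msuppU (h := fun M c =>
  if M v == k then << c *g divcm M (expcmn (ucm v) k) >> else 0)); first by [].
by case: (M v == k); [rewrite monalgU0|].
Qed.

Lemma pderivM v P Q : pderiv v (P * Q) = pderiv v P * Q + P * pderiv v Q.
Proof.
move: P Q; apply: bilin_ext => [P1 P2 Q|P1 P2 Q|P Q1 Q2|P Q1 Q2|c b M N].
- exact: (etrans (congr1 _ (mulrDl _ _ _)) (pderivD _ _ _)).
- exact: (@derivation_rule_addl (dpoly F m n) _ (pderivD v)).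
- exact: (etrans (congr1 _ (mulrDr _ _ _)) (pderivD _ _ _)).
- exact: (@derivation_rule_addr (dpoly F m n) _ (pderivD v)).
have e1 := etrans (congr1 (fun x => x * << b *g N >>) (pderivU v c M))
  (malgMUU _ _ _ _).
have e2 := etrans (congr1 (fun x => << c *g M >> * x) (pderivU v b N))
  (malgMUU _ _ _ _).
apply: etrans (congr1 _ (malgMUU _ _ _ _)) _.
apply: etrans (pderivU _ _ _) _.
apply: etrans (esym (congr2 +%R e1 e2)).
rewrite mmulE mulrnDr monalgUD; apply: congr2.
(* [divcm] subtracts exponents with truncation at 0; the truncated case [M v = 0] is harmless
   because the scalar factor [M v] vanishes. *)
- case: (posnP (M v)) => [->|Mv]; first by rewrite !mulr0n mul0r !monalgU0.
  rewrite mulrnAl; apply: malgU_eq => w; rewrite !(mmulE, divcmE) ucmE.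
  by case: (v =P w) Mv => [<-|_]; [case: (M v) => // k _; rewrite addSn !subn1|rewrite !subn0].
- case: (posnP (N v)) => [->|Nv]; first by rewrite !mulr0n mulr0 !monalgU0.
  rewrite mulrnAr; apply: malgU_eq => w; rewrite !(mmulE, divcmE) ucmE.
  by case: (v =P w) Nv => [<-|_]; [case: (N v) => // k _; rewrite addnS !subn1|rewrite !subn0].
Qed.

Lemma pderivC v c : pderiv v c%:MP = 0 :> dpoly F m n.
Proof. by rewrite pderivU moneE mulr0n monalgU0. Qed.

Lemma pderivX v w : pderiv v (dX F w) = (w == v)%:R.
Proof.
rewrite /dX pderivU ucmE; case: (w =P v) => [->|_]; last by rewrite monalgU0.
rewrite -[RHS]mpolyC1E; apply: malgU_eq => u.
by rewrite divcmE subnn moneE.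
Qed.

Lemma vall_pderiv p v P : vall p P -> vall p (pderiv v P).
Proof.
move=> /vallP h; apply: vall_sum => M MP; apply: vallU => w.
rewrite divcmE => Mw; apply: (h M) => //.
by apply: contraNneq Mw => ->.
Qed.

Lemma degv_leP v k P :
  reflect (forall M, M \in msupp P -> (M v <= k)%N) (degv v P <= k)%N.
Proof.
by apply: (iffP (bigmax_leqP_seq _ _ _ _)) => h M MP; [apply: h|move=> _; apply: h].
Qed.

Lemma degv_eq0 v P : (degv v P == 0%N) = (v \notin dvars P).
Proof.
rewrite -leqn0; apply/degv_leP/idP => [h|h M MP].
  by apply/negP => /dvarsP[M /h]; rewrite leqn0 => /eqP ->.
by rewrite (notin_dvars h MP).
Qed.

Lemma coefvM v k P Q :
  coefv v k (P * Q) = \sum_(j < k.+1) coefv v j P * coefv v (k - j)%N Q.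
Proof.
move: P Q; apply: bilin_ext => [P1 P2 Q|P1 P2 Q|P Q1 Q2|P Q1 Q2|c b M N].
- exact: (etrans (congr1 _ (mulrDl _ _ _)) (coefvD _ _ _ _)).
- exact: (@convolution_addl (dpoly F m n) (coefv v) k (coefvD v) P1 P2 Q).
- exact: (etrans (congr1 _ (mulrDr _ _ _)) (coefvD _ _ _ _)).
- exact: (@convolution_addr (dpoly F m n) (coefv v) k (coefvD v) P Q1 Q2).
apply: etrans (congr1 _ (malgMUU _ _ _ _)) _.
apply: etrans (coefvU _ _ _ _) _.
rewrite mmulE -sum_split_if; apply: eq_bigr => j _.
apply: etrans (esym (congr2 *%R (coefvU v j c M) (coefvU v (k - j)%N b N))).
case: (M v =P j) => [Mj|_]; last by rewrite mul0r.
case: (N v =P _) => [Nj|_]; last by rewrite mulr0.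
apply: etrans (esym (malgMUU _ _ _ _)); apply: malgU_eq => w.
rewrite !(mmulE, divcmE, expcmnE) ucmE; case: (v =P w) => [<-|_].
  have jk : (j <= k)%N by rewrite -ltnS.
  by rewrite !mul1n Mj Nj (subnKC jk) !subnn.
by rewrite !mul0n !subn0.
Qed.

Lemma coefvE v k P N :
  (coefv v k P)@_N =
    if N v == 0%N then P@_(mmul N (expcmn (ucm v) k)) else 0.
Proof.
apply: (@add_ext _ (fun P => (coefv v k P)@_N)
  (fun P => if N v == 0%N then P@_(mmul N (expcmn (ucm v) k)) else 0)).
- move=> A B.
  exact: (etrans (congr1 (mcoeff N) (coefvD v k A B)) (mcoeffD N _ _)).
- by move=> A B; case: (N v == 0%N); [rewrite mcoeffD|rewrite addr0].
move=> M _; move: (P@_M) => c.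
rewrite coefvU; case: (M v =P k) => [Mk|Mk]; last first.
  rewrite mcoeff0; case: (N v =P 0%N) => // N0; rewrite mcoeffU.
  case: (M =P _) => // eM; case: Mk.
  by rewrite eM mmulE expcmnE ucmE eqxx N0 mul1n.
rewrite !mcoeffU; case: (N v =P 0%N) => [N0|N0]; last first.
  case: (_ =P N) => // eN; case: N0.
  by rewrite -eN divcmE expcmnE ucmE eqxx mul1n Mk subnn.
congr (c *+ nat_of_bool _); apply/eqP/eqP => [<-|->]; apply/eqP/cmP => w;
  rewrite !(mmulE, divcmE, expcmnE) ucmE; case: (v =P w) => [<-|_].
- by rewrite !mul1n subnK // Mk.
- by rewrite !mul0n addn0 subn0.
- by rewrite !mul1n addnK.
- by rewrite !mul0n addn0 subn0.
Qed.

Lemma coefv_dvars v k P : v \notin dvars (coefv v k P).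
Proof.
apply/dvarsP => -[N]; rewrite -mcoeff_neq0 coefvE.
by case: (N v == 0%N); rewrite ?eqxx.
Qed.

Lemma vall_coefv p v k P : vall p P -> vall p (coefv v k P).
Proof.
move=> /vallP h; apply/vallP => N w; rewrite -mcoeff_neq0 coefvE.
case: (N v == 0%N); rewrite ?eqxx // mcoeff_neq0 => /h hN Nw.
by apply: hN; rewrite mmulE addn_eq0 negb_and Nw.
Qed.

Lemma coefv_free v P : v \notin dvars P -> coefv v 0 P = P.
Proof.
move=> vP; rewrite {1}[P]monalgE coefv_sum [RHS]monalgE !big_seq.
apply: eq_bigr => M MP; rewrite coefvU (notin_dvars vP MP) eqxx.
by apply: malgU_eq => w; rewrite divcmE expcmnE muln0 subn0.
Qed.

Lemma degvX v : degv v (dX F v) = 1%N.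
Proof. by rewrite /degv /dX msuppU oner_eq0 big_seq_fset1 ucmE eqxx. Qed.

Lemma coefvX v : coefv v 1 (dX F v) = 1.
Proof.
rewrite /dX coefvU ucmE eqxx -[RHS]mpolyC1E.
by apply: malgU_eq => w; rewrite divcmE expcmnE muln1 subnn moneE.
Qed.

Lemma coefv_gt v k P : (degv v P < k)%N -> coefv v k P = 0.
Proof.
move=> h; rewrite /coefv big_seq_cond; apply: big1 => M /andP[MP /eqP Mk].
by have /degv_leP/(_ M MP) := leqnn (degv v P); rewrite Mk leqNgt h.
Qed.

(** A monomial [M] of exponent above [k] would survive in the coefficient of index [M v], at [M]
    stripped of [v]. *)
Lemma degv_le_coefv v k P :
  (forall j, (k < j)%N -> coefv v j P = 0) -> (degv v P <= k)%N.
Proof.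
move=> h; apply/degv_leP => M MP; rewrite leqNgt; apply/negP => kM.
have := coefvE v (M v) P (divcm M (expcmn (ucm v) (M v))).
rewrite h // mcoeff0 divcmE expcmnE ucmE eqxx mul1n subnn eqxx.
have -> : mmul (divcm M (expcmn (ucm v) (M v))) (expcmn (ucm v) (M v)) = M.
  apply/eqP/cmP => w; rewrite !(mmulE, divcmE, expcmnE) ucmE.
  by case: (v =P w) => [<-|_]; rewrite ?mul1n ?mul0n ?subn0 ?addn0 // subnK.
by move/esym/eqP; rewrite mcoeff_eq0 MP.
Qed.

Lemma coefv_expand v K P :
  (degv v P <= K)%N -> P = \sum_(k < K.+1) coefv v k P * dX F v ^+ k.
Proof.
move=> /degv_leP hK.
apply: (@add_ext _ id (fun P => \sum_(k < K.+1) coefv v k P * dX F v ^+ k)).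
- by [].
- exact: (@power_sum_add (dpoly F m n) (coefv v) _ _ (coefvD v)).
move=> M MP; rewrite -[LHS](@sum_pick_if _ _ (M v) K.+1) ?ltnS ?hK //.
apply: eq_bigr => k _; rewrite coefvU; case: (M v =P k) => [Mk|_]; last first.
  by rewrite mul0r.
rewrite dX_expE malgMUU mulr1; apply: malgU_eq => w.
rewrite !(mmulE, divcmE, expcmnE) ucmE; case: (v =P w) => [<-|_].
  by rewrite !mul1n Mk subnn.
by rewrite !mul0n addn0 subn0.
Qed.

Lemma const_dvars P : dvars P = fset0 -> P = (P@_mone)%:MP.
Proof.
move=> dP; apply/malgP => M; rewrite mcoeffC; case: (M =P mone) => [->//|Mn].
apply/eqP; rewrite mcoeff_eq0; apply/negP => MA; apply: Mn.
apply/eqP/cmP => v; rewrite moneE; apply: (notin_dvars (P := P)) => //.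
by rewrite dP.
Qed.

End Coefficients.

(* The ring F{X} seen through the operations and laws needed below. Most of the
   development is done over this interface because testing two products of
   elements of the monoid algebra [dpoly] for convertibility is intractable.
   [coef v k P] is the coefficient of [v ^+ k] in [P], [pd] the partial
   derivative, and [dcf i] applies [d i] to the coefficients only. *)
Record diffpoly (F : fieldType) (m n : nat) (d : 'I_m -> F -> F) := DiffPoly {
  dp_ring :> comNzRingType;
  dpC : {rmorphism F -> dp_ring};
  dpX : dvar m n -> dp_ring;
  vars : dp_ring -> {fset dvar m n};
  deg : dvar m n -> dp_ring -> nat;
  coef : dvar m n -> nat -> dp_ring -> dp_ring;
  pd : dvar m n -> dp_ring -> dp_ring;
  dcf : 'I_m -> dp_ring -> dp_ring;
  der : 'I_m -> dp_ring -> dp_ring;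
  varsC c : vars (dpC c) = fset0;
  varsX v : vars (dpX v) = [fset v]%fset;
  varsD P Q : (vars (P + Q) `<=` vars P `|` vars Q)%fset;
  varsM_le P Q : (vars (P * Q) `<=` vars P `|` vars Q)%fset;
  vars_ind (p : dvar m n -> Prop) (K : dp_ring -> Prop) :
    (forall c, K (dpC c)) -> (forall P Q, K P -> K Q -> K (P + Q)) ->
    (forall P Q, K P -> K Q -> K (P * Q)) -> (forall v, p v -> K (dpX v)) ->
    forall P, (forall v, v \in vars P -> p v) -> K P;
  vars0_const P : vars P = fset0 -> exists c, P = dpC c;
  coefD v k P Q : coef v k (P + Q) = coef v k P + coef v k Q;
  coefM v k P Q :
    coef v k (P * Q) = \sum_(j < k.+1) coef v j P * coef v (k - j)%N Q;
  coef_free v P : v \notin vars P -> coef v 0 P = P;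
  coef_X v : coef v 1 (dpX v) = 1;
  coef_expand v K P :
    (deg v P <= K)%N -> P = \sum_(k < K.+1) coef v k P * dpX v ^+ k;
  coef_gt v k P : (deg v P < k)%N -> coef v k P = 0;
  deg_le_coef v k P :
    (forall j, (k < j)%N -> coef v j P = 0) -> (deg v P <= k)%N;
  deg_eq0 v P : (deg v P == 0%N) = (v \notin vars P);
  deg_X v : deg v (dpX v) = 1%N;
  coef_vars v k P : v \notin vars (coef v k P);
  vars_coef v k P : (vars (coef v k P) `<=` vars P)%fset;
  pdD v P Q : pd v (P + Q) = pd v P + pd v Q;
  pdM v P Q : pd v (P * Q) = pd v P * Q + P * pd v Q;
  pdC v c : pd v (dpC c) = 0;
  pdX v w : pd v (dpX w) = (w == v)%:R;
  vars_pd v P : (vars (pd v P) `<=` vars P)%fset;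
  dcfD i P Q : dcf i (P + Q) = dcf i P + dcf i Q;
  dcfM i P Q : dcf i (P * Q) = dcf i P * Q + P * dcf i Q;
  dcfC i c : dcf i (dpC c) = dpC (d i c);
  dcfX i v : dcf i (dpX v) = 0;
  vars_dcf i P : (vars (dcf i P) `<=` vars P)%fset;
  derE i P :
    der i P = dcf i P + \sum_(v <- vars P) pd v P * dpX (dact (dgen i) v)
}.

(** * The monoid algebra as a ring of differential polynomials *)

Section Instance.
Variables (F : fieldType) (m n : nat) (d : 'I_m -> F -> F).
Hypothesis hd : forall i, derivation (d i).
Implicit Types (P Q A : dpoly F m n) (u v w : dvar m n) (M N : dmonom m n).

Lemma derivD i a b : d i (a + b) = d i a + d i b.
Proof. by have [] := hd i. Qed.

Lemma derivM i a b : d i (a * b) = d i a * b + a * d i b.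
Proof. by have [] := hd i. Qed.

Lemma deriv0 i : d i 0 = 0.
Proof. by apply: (addrI (d i 0)); rewrite -derivD !addr0. Qed.

Lemma deriv1 i : d i 1 = 0.
Proof.
have := derivM i 1 1; rewrite !mulr1 mul1r => e.
by apply: (addrI (d i 1)); rewrite -e addr0.
Qed.

Definition dercoef i P : dpoly F m n :=
  \sum_(M <- msupp P) << d i P@_M *g M >>.

Lemma dercoefD i P Q : dercoef i (P + Q) = dercoef i P + dercoef i Q.
Proof.
apply: (big_msupp_sum (h := fun M c => << d i c *g M >>)) => [M|M a b].
  by rewrite deriv0 monalgU0.
by rewrite derivD monalgUD.
Qed.

Lemma dercoefU i c M : dercoef i << c *g M >> = << d i c *g M >>.
Proof.
apply: (big_msuppU (h := fun M c => << d i c *g M >>)).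
by rewrite deriv0 monalgU0.
Qed.

Lemma dercoefM i P Q : dercoef i (P * Q) = dercoef i P * Q + P * dercoef i Q.
Proof.
move: P Q; apply: bilin_ext => [P1 P2 Q|P1 P2 Q|P Q1 Q2|P Q1 Q2|c b M N].
- exact: (etrans (congr1 _ (mulrDl _ _ _)) (dercoefD _ _ _)).
- exact: (@derivation_rule_addl (dpoly F m n) _ (dercoefD i)).
- exact: (etrans (congr1 _ (mulrDr _ _ _)) (dercoefD _ _ _)).
- exact: (@derivation_rule_addr (dpoly F m n) _ (dercoefD i)).
have e1 := etrans (congr1 (fun x => x * << b *g N >>) (dercoefU i c M))
  (malgMUU _ _ _ _).
have e2 := etrans (congr1 (fun x => << c *g M >> * x) (dercoefU i b N))
  (malgMUU _ _ _ _).
apply: etrans (congr1 _ (malgMUU _ _ _ _)) _.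
apply: etrans (dercoefU _ _ _) _.
apply: etrans (esym (congr2 +%R e1 e2)).
by rewrite derivM monalgUD.
Qed.

Lemma dercoefX i v : dercoef i (dX F v) = 0.
Proof. by rewrite /dX dercoefU deriv1 monalgU0. Qed.

Lemma vall_dercoef p i P : vall p P -> vall p (dercoef i P).
Proof.
move=> /vallP h; apply: vall_sum => M MP; apply: vallU => w.
exact: h.
Qed.

Lemma fsubset_vall (P Q : dpoly F m n) :
  (forall p, vall p P -> vall p Q) -> (dvars Q `<=` dvars P)%fset.
Proof.
by move=> h; apply/fsubsetP => v; apply: (h (fun v => v \in dvars P)).
Qed.

Lemma vall_fset0 P : (forall p, vall p P) -> dvars P = fset0.
Proof.
move=> h; apply/fsetP => v; rewrite in_fset0.
by apply/negP => /(h (fun=> False)).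
Qed.

Lemma fsubset_vall2 (P1 P2 Q : dpoly F m n) :
  (forall p, vall p P1 -> vall p P2 -> vall p Q) ->
  (dvars Q `<=` dvars P1 `|` dvars P2)%fset.
Proof.
move=> h; apply/fsubsetP.
apply: (h (fun v => v \in (dvars P1 `|` dvars P2)%fset)) => v vP;
  by rewrite in_fsetU vP ?orbT.
Qed.

(** Kept transparent: later sections read [der], [vars] and [pd] of this instance as [dder d],
    [dvars] and [pderiv] by conversion. *)
Definition dpoly_diffpoly : diffpoly n d.
Proof.
refine (@DiffPoly F m n d (dpoly F m n) (@mkmalgU (dmonom m n) F mone) (@dX F m n) (@dvars F m n) (@degv F m n)
  (@coefv F m n) (@pderiv F m n) dercoef (dder d)
  _ _ _ _ _ _ _ _ _ _ _ _ _ _ _ _ _ _ _ _ _ _ _ _ _ _ _ _).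
- by move=> c; apply: vall_fset0 => p; apply: vallC.
- exact: dvarsX.
- by move=> P Q; apply: fsubset_vall2 => p; apply: vallD.
- by move=> P Q; apply: fsubset_vall2 => p; apply: vallM.
- exact: vall_ind.
- by move=> P /const_dvars ->; exists P@_mone.
- exact: coefvD.
- exact: coefvM.
- exact: coefv_free.
- exact: coefvX.
- exact: coefv_expand.
- exact: coefv_gt.
- exact: degv_le_coefv.
- exact: degv_eq0.
- exact: degvX.
- exact: coefv_dvars.
- by move=> v k P; apply: fsubset_vall => p; apply: vall_coefv.
- exact: pderivD.
- exact: pderivM.
- exact: pderivC.
- exact: pderivX.
- by move=> v P; apply: fsubset_vall => p; apply: vall_pderiv.
- exact: dercoefD.
- exact: dercoefM.
- by move=> i c; apply: dercoefU.
- exact: dercoefX.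
- by move=> i P; apply: fsubset_vall => p; apply: vall_dercoef.
- by move=> i P.
Defined.

End Instance.

(** * Derivation operators and rankings of derivatives *)

Section ExponentVectors.
Variables (m n : nat).
Implicit Types (th tau : dmon m) (i j : 'I_m) (u v w : dvar m n).

Lemma dmonD th tau i : (th + tau) i = (th i + tau i)%N.
Proof. by rewrite ffunE. Qed.

Lemma dmon0 i : (0 : dmon m) i = 0%N.
Proof. by rewrite ffunE. Qed.

Lemma dgenE i j : dgen i j = (j == i).
Proof. by rewrite ffunE. Qed.

Lemma dmon_ind (K : dmon m -> Prop) :
  K 0 -> (forall i th, K th -> K (dgen i + th)) -> forall th, K th.
Proof.
move=> K0 KS th; have [k] := ubnP (\sum_i th i)%N; elim: k th => // k IH th.
rewrite ltnS => hk; case: (boolP [exists i, th i != 0%N]) => [/existsP[i thi]|h].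
  pose th' : dmon m := [ffun j => th j - dgen i j]%N.
  have e : th = dgen i + th'.
    apply/ffunP => j; rewrite dmonD !ffunE; case: (j =P i) => [->|_].
      by rewrite subnKC // lt0n.
    by rewrite subn0.
  rewrite e; apply: KS; apply: IH; apply: leq_trans hk.
  have -> : (\sum_j th j = \sum_j (dgen i j + th' j))%N.
    by apply: eq_bigr => j _; rewrite -dmonD -e.
  rewrite big_split /= -[X in (X < _)%N]add0n ltn_add2r (bigD1 i) //=.
  by rewrite dgenE eqxx.
have -> // : th = 0.
apply/ffunP => j; rewrite dmon0; apply/eqP.
by move: h; rewrite negb_exists => /forallP/(_ j); rewrite negbK.
Qed.

Lemma dmon_addIl th : injective (+%R th).
Proof.
move=> t1 t2 e; apply/ffunP => i; have := congr1 (fun f : dmon m => f i) e.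
by rewrite /= !dmonD => /addnI.
Qed.

Lemma dmon_addIr th : injective (+%R^~ th).
Proof. by move=> t1 t2; rewrite ![_ + th]addrC => /dmon_addIl. Qed.

Lemma dmon_onS D i th : dmon_on D (dgen i + th) -> i \in D /\ dmon_on D th.
Proof.
move=> h; split=> [|j hj]; first by apply: h; rewrite dmonD dgenE eqxx.
by apply: h; rewrite dmonD addn_eq0 negb_and hj orbT.
Qed.

Lemma dact0 v : dact 0 v = v.
Proof. by case: v => t j; rewrite /dact add0r. Qed.

Lemma dactD th tau v : dact (th + tau) v = dact th (dact tau v).
Proof. by rewrite /dact /= addrA. Qed.

Lemma dact_inj th tau v : dact th v = dact tau v -> th = tau.
Proof. by case=> /dmon_addIr. Qed.

End ExponentVectors.

Section Ranking.
Variables (m n : nat) (lt : rel (dvar m n)).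
Hypothesis hlt : ranking lt.
Implicit Types (th tau : dmon m) (u v w : dvar m n).

Definition rle v w := (v == w) || lt v w.

Lemma rlt_irr v : lt v v = false.
Proof. by have [[h _ _] _ _] := hlt; apply: h. Qed.

Lemma rlt_trans v u w : lt u v -> lt v w -> lt u w.
Proof. by have [[_ h _] _ _] := hlt; apply: h. Qed.

Lemma rle_lt_trans v u w : rle u v -> lt v w -> lt u w.
Proof. by case/orP => [/eqP ->|/rlt_trans]; [|apply]. Qed.

Lemma rlt_le_trans v u w : lt u v -> rle v w -> lt u w.
Proof. by move=> h /orP[/eqP <-|/(rlt_trans h)]. Qed.

Lemma rle_trans v u w : rle u v -> rle v w -> rle u w.
Proof.
by case/orP => [/eqP ->|h] // /(rlt_le_trans h) h'; rewrite /rle h' orbT.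
Qed.

Lemma rle_refl v : rle v v.
Proof. by rewrite /rle eqxx. Qed.

Lemma rltW u v : lt u v -> rle u v.
Proof. by rewrite /rle orbC => ->. Qed.

Lemma rltNge u v : lt u v = ~~ rle v u.
Proof.
have [[_ _ tot] _ _] := hlt; apply/idP/negP => [h /(rlt_le_trans h)|].
  by rewrite rlt_irr.
by rewrite /rle => /negP; rewrite negb_or => /andP[/tot /orP[->|]].
Qed.

Lemma rle_total u v : rle u v || rle v u.
Proof. by case: (boolP (rle v u)); rewrite ?orbT // -rltNge => /rltW ->. Qed.

Lemma rlt_dact th v w : lt v w -> lt (dact th v) (dact th w).
Proof.
move=> h; elim/dmon_ind: th => [|i th IH]; first by rewrite !dact0.
by rewrite !dactD; have [_ _ +] := hlt; apply.
Qed.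

Lemma rlt_gen i v : lt v (dact (dgen i) v).
Proof. by have [_ h _] := hlt; apply: h. Qed.

Lemma rle_dactl th v : rle v (dact th v).
Proof.
elim/dmon_ind: th => [|i th IH]; first by rewrite dact0 rle_refl.
by rewrite dactD; apply: rle_trans IH _; apply/rltW/rlt_gen.
Qed.

Lemma rlt_dactl th v : th != 0 -> lt v (dact th v).
Proof.
move=> th0; case/orP: (rle_dactl th v) => // /eqP e; case/eqP: th0.
by apply: (@dact_inj _ _ _ _ v); rewrite dact0.
Qed.

End Ranking.

(** * Leaders and linearity in the leader *)

Section DiffPolyTheory.
Variables (F : fieldType) (m n : nat) (d : 'I_m -> F -> F).
Variable (R : diffpoly n d).
Implicit Types (P Q A s : R) (u v w : dvar m n) (th tau : dmon m).

Local Notation C := (dpC R).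
Local Notation X := (dpX R).

Definition pall (p : dvar m n -> Prop) P := forall v, v \in vars P -> p v.

Lemma pallS (p q : dvar m n -> Prop) P :
  (forall v, p v -> q v) -> pall p P -> pall q P.
Proof. by move=> h pP v /pP /h. Qed.

Lemma pall_subset p P Q : (vars Q `<=` vars P)%fset -> pall p P -> pall p Q.
Proof. by move=> /fsubsetP QP h v /QP /h. Qed.

Lemma notin_pall v P : v \notin vars P <-> pall (fun w => w <> v) P.
Proof.
by split=> [vP w wP e|h]; [rewrite -e wP in vP|apply/negP => /h].
Qed.

Lemma pallC p c : pall p (C c).
Proof. by move=> v; rewrite varsC. Qed.

Lemma pall0 p : pall p 0.
Proof. by rewrite -(rmorph0 C); apply: pallC. Qed.

Lemma pall1 p : pall p 1.
Proof. by rewrite -(rmorph1 C); apply: pallC. Qed.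

Lemma pallX (p : dvar m n -> Prop) v : p v -> pall p (X v).
Proof. by move=> pv w; rewrite varsX in_fset1 => /eqP ->. Qed.

Lemma pallD p P Q : pall p P -> pall p Q -> pall p (P + Q).
Proof.
move=> hP hQ v /(fsubsetP (varsD _ _)).
by rewrite in_fsetU => /orP[/hP|/hQ].
Qed.

Lemma pallM p P Q : pall p P -> pall p Q -> pall p (P * Q).
Proof.
move=> hP hQ v /(fsubsetP (varsM_le _ _)).
by rewrite in_fsetU => /orP[/hP|/hQ].
Qed.

Lemma pallN p P : pall p P -> pall p (- P).
Proof.
by move=> h; rewrite -mulN1r -(rmorphN1 C); apply: pallM => //; apply: pallC.
Qed.

Lemma pallB p P Q : pall p P -> pall p Q -> pall p (P - Q).
Proof. by move=> hP hQ; apply: pallD => //; apply: pallN. Qed.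

Lemma pallXn p P k : pall p P -> pall p (P ^+ k).
Proof.
move=> h; elim: k => [|k IH]; first by rewrite expr0; apply: pall1.
by rewrite exprS; apply: pallM.
Qed.

Lemma pall_sum p (I : eqType) (r : seq I) (E : I -> R) :
  (forall i, i \in r -> pall p (E i)) -> pall p (\sum_(i <- r) E i).
Proof.
move=> h; rewrite big_seq; elim/big_ind: _ => //; first exact: pall0.
by move=> *; apply: pallD.
Qed.

Lemma coef0 v k : coef v k (0 : R) = 0.
Proof. by apply: (addrI (coef v k 0)); rewrite -coefD !addr0. Qed.

Lemma coefN v k P : coef v k (- P) = - coef v k P.
Proof. by apply: (addrI (coef v k P)); rewrite -coefD !subrr coef0. Qed.

Lemma deg_free v P : v \notin vars P -> deg v P = 0%N.
Proof. by rewrite -deg_eq0 => /eqP. Qed.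

Lemma deg_leD v k P Q :
  (deg v P <= k)%N -> (deg v Q <= k)%N -> (deg v (P + Q) <= k)%N.
Proof.
move=> hP hQ; apply: deg_le_coef => j hj.
by rewrite coefD !coef_gt ?addr0 //; [apply: leq_ltn_trans hQ hj|apply: leq_ltn_trans hP hj].
Qed.

Lemma deg_leN v k P : (deg v P <= k)%N -> (deg v (- P) <= k)%N.
Proof.
move=> hP; apply: deg_le_coef => j hj.
by rewrite coefN coef_gt ?oppr0 // (leq_ltn_trans hP).
Qed.

Lemma deg_leM v j k P Q :
  (deg v P <= j)%N -> (deg v Q <= k)%N -> (deg v (P * Q) <= j + k)%N.
Proof.
move=> hP hQ; apply: deg_le_coef => l hl; rewrite coefM big1 // => i _.
case: (leqP i j) => [ij|ji]; last by rewrite coef_gt ?mul0r // (leq_ltn_trans hP).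
rewrite [coef v (l - i)%N _]coef_gt ?mulr0 // (leq_ltn_trans hQ) //.
by rewrite ltn_subRL (leq_ltn_trans _ hl) // leq_add2r.
Qed.

Lemma coefM_top v j k P Q :
  (deg v P <= j)%N -> (deg v Q <= k)%N ->
  coef v (j + k) (P * Q) = coef v j P * coef v k Q.
Proof.
move=> hP hQ; rewrite coefM.
have hj : (j < (j + k).+1)%N by rewrite ltnS leq_addr.
rewrite (bigD1 (Ordinal hj)) //= addKn big1 ?addr0 // => i.
rewrite -val_eqE /=; case: (ltngtP i j) => // hij _; last first.
  by rewrite coef_gt ?mul0r // (leq_ltn_trans hP).
rewrite [coef v _ Q]coef_gt ?mulr0 // (leq_ltn_trans hQ) //.
by rewrite ltn_subRL ltn_add2r.
Qed.

Lemma deg_lt v k P :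
  (deg v P <= k)%N -> coef v k P = 0 -> (0 < k)%N -> (deg v P <= k.-1)%N.
Proof.
move=> h ck k0; apply: deg_le_coef => j; rewrite prednK // leq_eqVlt.
by case/orP => [/eqP <- //|kj]; apply: coef_gt; apply: leq_ltn_trans kj.
Qed.

Lemma coef_deg_neq0 v P : P != 0 -> coef v (deg v P) P != 0.
Proof.
move=> P0; case: (posnP (deg v P)) => [d0|dP].
  by rewrite d0 coef_free // -deg_eq0 d0.
apply/eqP => /(deg_lt (leqnn _))/(_ dP).
by rewrite leqNgt prednK // leqnn.
Qed.

Lemma deg_coef v k P : deg v (coef v k P) = 0%N.
Proof. by apply/deg_free/coef_vars. Qed.

Lemma deg_Xn v k : (deg v (X v ^+ k) <= k)%N.
Proof.
elim: k => [|k IH].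
  by rewrite expr0 deg_free //; apply/negP => /(@pall1 (fun=> False)).
by rewrite exprS -add1n; apply: deg_leM; rewrite ?deg_X.
Qed.

Lemma coef_Xn v k : coef v k (X v ^+ k) = 1.
Proof.
elim: k => [|k IH].
  by rewrite expr0 coef_free //; apply/negP => /(@pall1 (fun=> False)).
by rewrite exprS -add1n coefM_top ?deg_Xn ?deg_X // coef_X IH mul1r.
Qed.

(** That the ring is a domain follows by induction on the number of derivatives present: the leading
    coefficients of both factors in one of these derivatives are nonzero and free of it. *)
Lemma mulf_neq0_dp P Q : P != 0 -> Q != 0 -> P * Q != 0.
Proof.
have [N] := ubnP #|` (vars P `|` vars Q)%fset|.
elim: N P Q => // N IH P Q; rewrite ltnS => hN P0 Q0.
have [e|[v vPQ]] := fset_0Vmem (vars P `|` vars Q)%fset.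
  move/eqP: e; rewrite fsetU_eq0 => /andP[/eqP/vars0_const[a eP]].
  move=> /eqP/vars0_const[b eQ]; move: P0 Q0.
  by rewrite eP eQ -rmorphM !fmorph_eq0 mulf_eq0 => /negPf -> /negPf ->.
apply/negP => /eqP PQ0.
have := coefM_top (leqnn (deg v P)) (leqnn (deg v Q)).
rewrite PQ0 coef0 => /esym/eqP; apply/negP; apply: IH; last 2 first.
- exact: coef_deg_neq0.
- exact: coef_deg_neq0.
apply: leq_trans hN; apply: fproper_ltn_card; rewrite fproperE; apply/andP; split.
  apply/fsubsetP => w; rewrite !in_fsetU.
  by case/orP => /(fsubsetP (vars_coef _ _ _)) ->; rewrite ?orbT.
apply/negP => /fsubsetP/(_ v vPQ); apply/negP.
by rewrite in_fsetU negb_or !coef_vars.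
Qed.

Lemma mulf_eq0_dp P Q : P * Q = 0 -> P = 0 \/ Q = 0.
Proof.
move=> PQ; case: (P =P 0) => [|/eqP P0]; [by left|right].
by apply/eqP/negPn/negP => /(mulf_neq0_dp P0); rewrite PQ eqxx.
Qed.

Lemma expf_neq0_dp P k : P != 0 -> P ^+ k != 0.
Proof.
move=> P0; elim: k => [|k IH]; first by rewrite expr0 oner_neq0.
by rewrite exprS mulf_neq0_dp.
Qed.

Lemma degM v P Q :
  P != 0 -> Q != 0 -> deg v (P * Q) = (deg v P + deg v Q)%N.
Proof.
move=> P0 Q0; apply/eqP; rewrite eqn_leq deg_leM //= leqNgt; apply/negP.
move=> /coef_gt; rewrite coefM_top //; apply/eqP/mulf_neq0_dp;
exact: coef_deg_neq0.
Qed.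

Lemma varsM P Q :
  P != 0 -> Q != 0 -> vars (P * Q) = (vars P `|` vars Q)%fset.
Proof.
move=> P0 Q0; apply/fsetP => v; rewrite in_fsetU.
by apply: negb_inj; rewrite negb_or -!deg_eq0 degM // addn_eq0.
Qed.

Lemma pd_free v P : v \notin vars P -> pd v P = 0.
Proof.
move=> vP; suff h : pall (fun w => w != v) P.
  apply: (@vars_ind _ _ _ _ R (fun w => w != v) (fun P => pd v P = 0)) h.
  - by move=> c; rewrite pdC.
  - by move=> P1 P2 h1 h2; rewrite pdD h1 h2 addr0.
  - by move=> P1 P2 h1 h2; rewrite pdM h1 h2 mul0r mulr0 addr0.
  - by move=> w /negPf wv; rewrite pdX wv.
by move=> w wP; apply: contraNneq vP => <-.
Qed.

(** Absent derivatives contribute 0, so the sum may run over any larger set; this gives [P], [Q] and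
    their sum or product a common index set. *)
Lemma derEw i (D : {fset dvar m n}) P : (vars P `<=` D)%fset ->
  der i P = dcf i P + \sum_(v <- D) pd v P * X (dact (dgen i) v).
Proof.
move=> PD; rewrite derE; congr (_ + _); apply: big_fset_incl => // v _ vP.
by rewrite pd_free // mul0r.
Qed.

Lemma derD i P Q : der i (P + Q) = der i P + der i Q.
Proof.
rewrite (derEw i (varsD P Q)) (derEw i (fsubsetUl (vars P) (vars Q))).
rewrite (derEw i (fsubsetUr (vars P) (vars Q))) dcfD addrACA; congr (_ + _).
by rewrite -big_split; apply: eq_bigr => v _; rewrite pdD mulrDl.
Qed.

Lemma derM i P Q : der i (P * Q) = der i P * Q + P * der i Q.
Proof.
rewrite (derEw i (varsM_le P Q)) (derEw i (fsubsetUl (vars P) (vars Q))).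
rewrite (derEw i (fsubsetUr (vars P) (vars Q))) dcfM.
rewrite mulrDl mulrDr addrACA; congr (_ + _).
rewrite mulr_suml mulr_sumr -big_split; apply: eq_bigr => v _.
by rewrite pdM /=; ring.
Qed.

Lemma derC i c : der i (C c) = C (d i c).
Proof. by rewrite derE varsC big_nil addr0 dcfC. Qed.

Lemma derX i v : der i (X v) = X (dact (dgen i) v).
Proof. by rewrite derE varsX big_seq_fset1 dcfX pdX eqxx mul1r add0r. Qed.

Lemma der0 i : der i (0 : R) = 0.
Proof. by apply: (addrI (der i 0)); rewrite -derD !addr0. Qed.

Lemma derN i P : der i (- P) = - der i P.
Proof. by apply: (addrI (der i P)); rewrite -derD !subrr der0. Qed.

Lemma derB i P Q : der i (P - Q) = der i P - der i Q.
Proof. by rewrite derD derN. Qed.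

Lemma derXn i P k : der i (P ^+ k.+1) = k.+1%:R * P ^+ k * der i P.
Proof.
elim: k => [|k IH]; first by rewrite expr1 expr0 !mul1r.
by rewrite exprS derM IH exprS -[k.+2]add1n natrD; ring.
Qed.

Definition derm th P : R :=
  foldr (fun i Q => iter (th i) (der i) Q) P (enum 'I_m).

Hypothesis hcomm : forall i j a, d i (d j a) = d j (d i a).

Lemma der_comm i j P : der i (der j P) = der j (der i P).
Proof.
have := fun v (_ : v \in vars P) => I.
apply: (@vars_ind _ _ _ _ R (fun=> True)
          (fun P => der i (der j P) = der j (der i P))).
- by move=> c; rewrite !derC hcomm.
- by move=> P1 P2 h1 h2; rewrite !derD h1 h2.
- by move=> P1 P2 h1 h2; rewrite !derM !derD !derM h1 h2; ring.
- by move=> v _; rewrite !derX -!dactD addrC.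
Qed.

Lemma derm0 P : derm 0 P = P.
Proof.
rewrite /derm; elim: (enum 'I_m) => //= i s IH.
by rewrite dmon0.
Qed.

(** [derm] applies the derivations in the order of [enum 'I_m]; [der_comm] carries the extra [der i]
    from its place in that order to the outside. *)
Lemma derm_gen i th P : derm (dgen i + th) P = der i (derm th P).
Proof.
rewrite /derm; have := mem_enum 'I_m i; have := enum_uniq 'I_m.
rewrite inE; elim: (enum 'I_m) => //= j s IH /andP[js us].
rewrite in_cons => /orP[/eqP e|ins]; first subst j.
  have -> : foldr (fun k Q => iter ((dgen i + th)%R k) (der k) Q) P s =
            foldr (fun k Q => iter (th k) (der k) Q) P s.
    elim: s js {us IH} => //= k s IH; rewrite in_cons negb_or => /andP[ik /IH ->].
    by rewrite dmonD dgenE eq_sym (negPf ik).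
  by rewrite dmonD dgenE eqxx add1n.
rewrite IH // dmonD dgenE; case: (j =P i) => [e|_]; first by rewrite e ins in js.
by rewrite add0n; elim: (th j) => //= k ->; rewrite der_comm.
Qed.

Lemma dermA th tau P : derm (th + tau) P = derm th (derm tau P).
Proof.
elim/dmon_ind: th => [|i th IH]; first by rewrite add0r derm0.
by rewrite -addrA !derm_gen IH.
Qed.

Lemma dermD th P Q : derm th (P + Q) = derm th P + derm th Q.
Proof.
elim/dmon_ind: th => [|i th IH]; first by rewrite !derm0.
by rewrite !derm_gen IH derD.
Qed.

Lemma derm_zero th : derm th 0 = 0.
Proof. by apply: (addrI (derm th 0)); rewrite -dermD !addr0. Qed.

Lemma dermN th P : derm th (- P) = - derm th P.
Proof. by apply: (addrI (derm th P)); rewrite -dermD !subrr derm_zero. Qed.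

Lemma dermB th P Q : derm th (P - Q) = derm th P - derm th Q.
Proof. by rewrite dermD dermN. Qed.

Lemma derm_sum th (I : Type) (r : seq I) (E : I -> R) :
  derm th (\sum_(i <- r) E i) = \sum_(i <- r) derm th (E i).
Proof. exact: (big_morph _ (dermD th) (derm_zero th)). Qed.

(** Operators in the derivations of [D] treat elements of [K_D] as scalars; this is what makes
    [theta_j] commute with [L_i]. *)
Lemma derm_const D th c P : dmon_on D th -> const_field d D c ->
  derm th (C c * P) = C c * derm th P.
Proof.
move=> + hc; elim/dmon_ind: th => [|i th IH]; first by rewrite !derm0.
move=> /dmon_onS[iD /IH {}IH].
by rewrite !derm_gen IH derM derC hc // rmorph0 mul0r add0r.
Qed.

Variables (lt : rel (dvar m n)) (hlt : ranking lt).

Local Notation below w := (pall (fun v => lt v w)).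
Local Notation upto w := (pall (fun v => rle lt v w)).

(* P = s * X w + (terms in derivatives below w), with s below w. *)
Definition lin P w s := below w s /\ below w (P - s * X w).

Lemma below_notin w P : below w P -> w \notin vars P.
Proof. by move=> h; apply/negP => /h; rewrite (rlt_irr hlt). Qed.

Lemma belowW u w P : lt u w -> upto u P -> below w P.
Proof. by move=> uw; apply: pallS => v vu; apply: (rle_lt_trans hlt) uw. Qed.

Lemma below_upto w P : below w P -> upto w P.
Proof. by apply: pallS => v /rltW. Qed.

Lemma lin_deg P w s : lin P w s -> (deg w P <= 1)%N.
Proof.
case=> hs hT; rewrite -[P](subrK (s * X w)); apply: deg_leD.
  by rewrite deg_free // below_notin.
rewrite -[1%N]add0n; apply: deg_leM; last by rewrite deg_X.
by rewrite deg_free // below_notin.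
Qed.

Lemma lin_coef P w s : lin P w s -> coef w 1 P = s.
Proof.
case=> hs hT; rewrite -[P](subrK (s * X w)) coefD.
rewrite coef_gt ?deg_free ?below_notin // add0r.
have := @coefM_top w 0 1 s (X w); rewrite add0n => ->.
- by rewrite coef_X mulr1 coef_free // below_notin.
- by rewrite deg_free // below_notin.
- by rewrite deg_X.
Qed.

Lemma lin_deg1 P w s : lin P w s -> s != 0 -> deg w P = 1%N.
Proof.
move=> h s0; apply/eqP; rewrite eqn_leq (lin_deg h) lt0n.
apply: contraNneq s0 => dP; rewrite -(lin_coef h) coef_gt //.
by rewrite dP.
Qed.

Lemma lin_vars P w s : lin P w s -> s != 0 -> w \in vars P.
Proof. by move=> h s0; rewrite -[_ \in _]negbK -deg_eq0 (lin_deg1 h). Qed.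

Lemma lin_upto P w s : lin P w s -> upto w P.
Proof.
case=> hs hT; rewrite -[P](subrK (s * X w)); apply: pallD.
  exact: below_upto.
apply: pallM; first exact: below_upto.
by apply: pallX; rewrite rle_refl.
Qed.

Lemma lin_pd P w s : lin P w s -> pd w P = s.
Proof.
case=> hs hT; rewrite -[P](subrK (s * X w)) pdD pdM pdX eqxx mulr1.
by rewrite !pd_free ?below_notin // mul0r !add0r.
Qed.

Lemma lin_lead P w s : lin P w s -> s != 0 ->
  w \in vars P /\ forall v, v \in vars P -> v = w \/ lt v w.
Proof.
move=> h s0; split; first exact: lin_vars h s0.
by move=> v /(lin_upto h)/orP[/eqP ->|]; [left|right].
Qed.

Lemma linD P Q w s : lin P w s -> below w Q -> lin (P + Q) w s.
Proof. by case=> hs hT hQ; split=> //; rewrite addrAC; apply: pallD. Qed.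

Lemma linM P w s c : lin P w s -> below w c -> lin (c * P) w (c * s).
Proof.
case=> hs hT hc; split; first exact: pallM.
by rewrite -mulrA -mulrBr; apply: pallM.
Qed.

(** In the chain rule only the summand of [v] reaches [dact (dgen i) v]: a derivative below [v] is
    sent below it by monotonicity of the ranking. So the result is linear in its leader, with the
    separant as coefficient, whatever the degree of [P] in [v]. *)
Lemma upto_der i v P : upto v P -> lin (der i P) (dact (dgen i) v) (pd v P).
Proof.
move=> hP; have vv := rlt_gen hlt i v.
split; first by apply: (belowW vv); apply: pall_subset hP; apply: vars_pd.
(* [v] is adjoined to the index set because it need not occur in [P]; its summand is then 0. *)
rewrite (derEw i (fsubsetUr [fset v]%fset (vars P))).
rewrite (big_fsetD1 v) ?in_fsetU ?in_fset1 ?eqxx //=.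
rewrite addrCA [X in pall _ (X - _)]addrC addrK; apply: pallD.
  by apply: (belowW vv); apply: pall_subset hP; apply: vars_dcf.
apply: pall_sum => u; rewrite in_fsetD1 in_fsetU in_fset1 => /andP[uv].
rewrite (negPf uv) /= => uP; apply: pallM.
  by apply: (belowW vv); apply: pall_subset hP; apply: vars_pd.
apply: pallX; have [_ _ mon] := hlt; apply: mon.
by move: (hP _ uP); rewrite /rle (negPf uv).
Qed.

(** For [P] linear in its leader the partial derivative is [s] itself, so [upto_der] passes the same
    [s] on at every derivation. *)
Lemma lin_derm th P w s : lin P w s -> lin (derm th P) (dact th w) s.
Proof.
move=> h; elim/dmon_ind: th => [|i th IH]; first by rewrite derm0 dact0.
by rewrite derm_gen dactD -[s](lin_pd IH); apply: upto_der; apply: lin_upto IH.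
Qed.

(** The first derivation makes [P] linear in the new leader, and the later ones keep the separant as
    coefficient; for [th = 0] nothing forces linearity. *)
Lemma upto_derm th v P :
  th != 0 -> upto v P -> lin (derm th P) (dact th v) (pd v P).
Proof.
elim/dmon_ind: th => [|i th IH]; first by rewrite eqxx.
move=> _ hP; rewrite derm_gen dactD; case: (eqVneq th 0) => [->|/IH/(_ hP) h].
  by rewrite derm0 dact0; apply: upto_der.
by rewrite -[pd v P](lin_pd h); apply: upto_der; apply: lin_upto h.
Qed.

End DiffPolyTheory.

(** * Dickson's lemma and termination *)

(** The subsequence always jumps to a position that minimises [h] over all remaining indices. *)
Lemma nondecreasing_subsequence (h : nat -> nat) :
  exists g : nat -> nat, (forall i j, (i < j)%N -> (g i < g j)%N) /\
    (forall i j, (i <= j)%N -> (h (g i) <= h (g j))%N).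
Proof.
have amin N : exists k, (N <= k)%N /\ forall j, (N <= j)%N -> (h k <= h j)%N.
  suff main b M : (N <= M)%N -> (h M < b)%N ->
      exists k, (N <= k)%N /\ forall j, (N <= j)%N -> (h k <= h j)%N.
    exact: (main _ N (leqnn N) (ltnSn _)).
  elim: b M => // b IH M NM; rewrite ltnS => hM.
  case: (classic (exists j, (N <= j)%N /\ (h j < h M)%N)) => [[j [Nj jM]]|no].
    by apply: (IH j) => //; apply: leq_trans hM.
  exists M; split=> // j Nj; rewrite leqNgt; apply/negP => jM.
  by case: no; exists j.
have [k hk] := functional_choice _ amin.
pose g := fix g n := if n is n'.+1 then k (g n').+1 else k 0%N.
have gS n : (g n < g n.+1)%N by have [] := hk (g n).+1.
have gmono i j : (i < j)%N -> (g i < g j)%N.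
  by elim: j => // j IH; rewrite ltnS leq_eqVlt => /orP[/eqP ->|/IH/ltn_trans ->].
have gmin n j : (g n <= j)%N -> (h (g n) <= h j)%N.
  case: n => [|n] nj; first by have [_] := hk 0%N; apply.
  by have [gk] := hk (g n).+1; apply; apply: leq_trans gk nj.
exists g; split=> // i j; rewrite leq_eqVlt => /orP[/eqP -> //|/gmono/ltnW].
exact: gmin.
Qed.

(** One coordinate after the other is made nondecreasing by passing to a subsequence, which
    preserves the coordinates already treated; the first two terms of the last subsequence then
    serve. *)
Lemma dickson m (f : nat -> dmon m) :
  exists i j, (i < j)%N /\ forall x, (f i x <= f j x)%N.
Proof.
have [g [gmono gle]] : exists g : nat -> nat,
    (forall i j, (i < j)%N -> (g i < g j)%N) /\
    (forall x, x \in enum 'I_m ->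
       forall i j, (i <= j)%N -> (f (g i) x <= f (g j) x)%N).
  elim: (enum 'I_m) => [|x s [g [gmono gle]]]; first by exists id.
  have [g' [g'mono g'le]] := nondecreasing_subsequence (fun k => f (g k) x).
  exists (g \o g'); split=> [i j /g'mono/gmono //|y].
  rewrite in_cons => /orP[/eqP -> //|/gle h] i j ij; apply: h.
  by move: ij; rewrite leq_eqVlt => /orP[/eqP -> //|/g'mono/ltnW].
exists (g 0%N), (g 1%N); split; first exact: gmono.
by move=> x; apply: gle; rewrite ?mem_enum.
Qed.

Lemma dickson_var m n (f : nat -> dvar m n) :
  exists i j th, (i < j)%N /\ f j = dact th (f i).
Proof.
(* The index of the differential indeterminate is turned into indicator coordinates: at the
   coordinate of the index of [f i] the left side of the domination is 1, which forces [f j] to have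
   the same index. *)
pose aug k : dmon (m + n + n) := [ffun x : 'I_(m + n + n) =>
  match split x with
  | inl y => match split y with
             | inl i => (f k).1 i | inr j => ((f k).2 == j : nat) end
  | inr j => ((f k).2 != j : nat) end].
have [i [j [ij h]]] := dickson aug; exists i, j.
have e2 : (f i).2 = (f j).2.
  have := h (lshift n (rshift m (f i).2)).
  rewrite !ffunE; case: splitP => [y /= /eqP|y /eqP]; last first.
    rewrite /= => /eqP e; have := ltn_ord (f i).2.
    have : (m + (f i).2 < m + n)%N by rewrite ltn_add2l.
    by rewrite e => H _; move: H; rewrite ltnNge leq_addr.
  move=> /eqP e; case: splitP => [x ex|x ex].
    by have := ltn_ord x; rewrite -ex -e ltnNge leq_addr.
  have -> : x = (f i).2 by apply: val_inj; apply/eqP; rewrite -(eqn_add2l m) -ex -e.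
  by rewrite eqxx; case: eqP.
have e1 x : ((f i).1 x <= (f j).1 x)%N.
  have := h (lshift n (lshift n x)).
  rewrite !ffunE; case: splitP => [y /= e|y /= e]; last first.
    by have := ltn_ord x; rewrite e -addnA ltnNge leq_addr.
  case: splitP => [w ew|w ew].
    by have -> : w = x by apply: val_inj; rewrite /= -ew -e.
  by have := ltn_ord x; rewrite e ew ltnNge leq_addr.
exists [ffun x => ((f j).1 x - (f i).1 x)%N]; split=> //.
rewrite /dact e2 [LHS]surjective_pairing; congr (_, _).
by apply/ffunP => x; rewrite dmonD ffunE subnK.
Qed.

(** By [dickson_var] an infinite descent would contain a derivative of an earlier term, which a
    ranking never places lower. *)
Lemma ranking_wf m n (lt : rel (dvar m n)) :
  ranking lt -> well_founded (fun u v => lt u v).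
Proof.
move=> hlt; apply: NNPP => nwf.
have [x0 nx0] := not_all_ex_not _ _ nwf.
have nxt (x : {x | ~ Acc (fun u v => lt u v) x}) :
    exists y : {x | ~ Acc (fun u v => lt u v) x}, lt (sval y) (sval x).
  case: x => x nx /=; apply: NNPP => no; apply: nx; constructor => y yx.
  by apply: NNPP => ny; apply: no; exists (exist _ y ny).
have [g hg] := functional_choice _ nxt.
pose f k := sval (iter k g (exist _ x0 nx0)).
have fS k : lt (f k.+1) (f k) by apply: hg.
have fdec i j : (i < j)%N -> lt (f j) (f i).
  elim: j => // j IH; rewrite ltnS leq_eqVlt => /orP[/eqP -> //|/IH].
  exact: (rlt_trans hlt (fS j)).
have [i [j [th [ij e]]]] := dickson_var f.
have := fdec _ _ ij; rewrite e (rltNge hlt) => /negP; apply.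
exact: rle_dactl.
Qed.

Lemma exists_rmax m n (lt : rel (dvar m n)) (s : seq (dvar m n)) :
  ranking lt -> s != [::] ->
  exists2 v, v \in s & forall w, w \in s -> rle lt w v.
Proof.
move=> hlt; elim: s => // x s IH _; case: (eqVneq s [::]) => [->|/IH[v vs hv]].
  by exists x; rewrite ?mem_head // => w; rewrite inE => /eqP ->; apply: rle_refl.
case/orP: (rle_total hlt x v) => h; [exists v|exists x]; rewrite ?mem_head //.
- by rewrite in_cons vs orbT.
- by move=> w; rewrite in_cons => /orP[/eqP -> //|/hv].
- move=> w; rewrite in_cons => /orP[/eqP ->|/hv /(rle_trans hlt)]; last exact.
  exact: rle_refl.
Qed.

(** * Pseudo-division by two polynomials linear in their leaders *)

Section Reduction.
Variables (F : fieldType) (m n : nat) (d : 'I_m -> F -> F).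
Hypothesis hcomm : forall i j a, d i (d j a) = d j (d i a).
Variable (R : diffpoly n d).
Variables (lt : rel (dvar m n)) (hlt : ranking lt).
Implicit Types (P Q : R) (v w : dvar m n) (th tau : dmon m) (b : bool).

Variables (A s : bool -> R) (u : bool -> dvar m n).
Hypothesis hA : forall b, lin lt (A b) (u b) (s b).

(** The derivatives of the two leaders, leaders included. The comparison of exponents makes this
    decidable, so that it can filter the variables of a polynomial. *)
Definition principal w :=
  [exists b, (w.2 == (u b).2) && [forall i, (u b).1 i <= w.1 i]]%N.

Lemma principalP w :
  reflect (exists tau b, w = dact tau (u b)) (principal w).
Proof.
apply: (iffP existsP) => [[b /andP[/eqP e /forallP h]]|[tau [b ->]]].
  exists [ffun i => (w.1 i - (u b).1 i)%N], b.
  rewrite /dact -e; case: w {e} h => t j /= h; congr (_, _).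
  by apply/ffunP => i; rewrite dmonD ffunE subnK.
exists b; rewrite /= eqxx; apply/forallP => i.
by rewrite dmonD leq_addl.
Qed.

Hypothesis hs : forall b, pall (fun w => ~~ principal w) (s b).

(** [derm tau (A b)] has degree 1 in [v] with coefficient [s b] whether or not [tau] is 0, so one
    formula covers division by [A b] and by its derivatives. *)
Definition eliminate v tau b P : R :=
  s b * P - coef v (deg v P) P * dpX R v ^+ (deg v P).-1 * derm tau (A b).

Lemma deg_eliminate v tau b P : v = dact tau (u b) -> v \in vars P ->
  (deg v (eliminate v tau b P) <= (deg v P).-1)%N.
Proof.
move=> ev vP; have hl : lin lt (derm tau (A b)) v (s b).
  by rewrite ev; apply: lin_derm.
have [sv _] := hl; have dP : (0 < deg v P)%N by rewrite lt0n deg_eq0 negbK.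
have ds : deg v (s b) = 0%N by apply/deg_free/(below_notin hlt).
have dcX : (deg v (coef v (deg v P) P * dpX R v ^+ (deg v P).-1) <= (deg v P).-1)%N.
  by rewrite -[X in (_ <= X)%N]add0n deg_leM ?deg_coef ?deg_Xn.
apply: deg_lt => //.
  apply: deg_leD; first by rewrite -[X in (_ <= X)%N]add0n deg_leM ?ds.
  apply: deg_leN; apply: leq_trans (deg_leM dcX (lin_deg hlt hl)) _.
  by rewrite addn1 prednK.
rewrite coefD coefN.
have -> : coef v (deg v P) (s b * P) = s b * coef v (deg v P) P.
  rewrite -{1}[deg v P]add0n coefM_top ?ds // coef_free //.
  exact: (below_notin hlt).
have eP : deg v P = ((deg v P).-1 + 1)%N by rewrite addn1 prednK.
rewrite [X in coef v X (_ * derm _ _)]eP (coefM_top dcX (lin_deg hlt hl)).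
rewrite (lin_coef hlt hl) -[X in coef v X (_ * _)]add0n.
rewrite coefM_top ?deg_coef ?deg_Xn //.
rewrite coef_Xn mulr1 coef_free ?coef_vars //.
by rewrite mulrC subrr.
Qed.

(** The factor [s b] brings in no principal derivative by [hs], and [derm tau (A b)] has nothing
    above its leader [v]. *)
Lemma eliminate_upto v tau b P : v = dact tau (u b) -> v \in vars P ->
  pall (fun w => principal w -> rle lt w v) P ->
  pall (fun w => principal w -> rle lt w v) (eliminate v tau b P).
Proof.
move=> ev vP hP; apply: pallB.
  by apply: pallM => // w /hs /negPf ->.
apply: pallM; last first.
  have hl : lin lt (derm tau (A b)) v (s b) by rewrite ev; apply: lin_derm.
  by move=> w /(lin_upto hl).
apply: pallM; first by apply: pall_subset hP; apply: vars_coef.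
by apply: pallXn; apply: pallX => _; apply: rle_refl.
Qed.

(** Lexicographic induction on the highest principal derivative and on the degree in it; both the
    pseudo-reductions and the existence of remainders rest on it. *)
Lemma elimination_ind (K : R -> Prop) :
  (forall P, pall (fun w => ~~ principal w) P -> K P) ->
  (forall P v tau b, v = dact tau (u b) -> v \in vars P ->
     (forall w, w \in vars P -> principal w -> rle lt w v) ->
     K (eliminate v tau b P) -> K P) ->
  forall P, K P.
Proof.
move=> K0 KS.
have top P : pall (fun w => ~~ principal w) P \/
    exists v, [/\ v \in vars P, principal v &
      forall w, w \in vars P -> principal w -> rle lt w v].
  case: (eqVneq [seq w <- vars P | principal w] [::]) => [e|/(exists_rmax hlt)].
    left=> w wP; apply/negP => pw.
    have : w \in [seq w <- vars P | principal w] by rewrite mem_filter pw.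
    by rewrite e.
  case=> v; rewrite mem_filter => /andP[pv vP] hv; right; exists v; split=> //.
  by move=> w wP pw; apply: hv; rewrite mem_filter pw.
(* [v] and [k] are mere upper bounds, so the induction survives the disappearance of [v]: the
   highest principal derivative that is left then lies strictly below [v]. *)
suff main v k P : pall (fun w => principal w -> rle lt w v) P ->
    (deg v P <= k)%N -> K P.
  move=> P; case: (top P) => [/K0 //|[v [vP pv hv]]].
  exact: (main v (deg v P)).
elim/(well_founded_ind (ranking_wf hlt)): v k P => v IHv k.
elim: k => [|k IHk] P hP dP; last first.
  case: (boolP (principal v && (v \in vars P))) => [/andP[/principalP]|].
    case=> tau [b ev] vP; apply: (KS P v tau b) => //.
    apply: IHk; first exact: eliminate_upto.
    apply: leq_trans (deg_eliminate ev vP) _.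
    by rewrite -ltnS prednK // lt0n deg_eq0 negbK.
  move=> nv; case: (top P) => [/K0 //|[w [wP pw hw]]].
  apply: (IHv w) (leqnn _) => //.
  move: (hP _ wP pw) => /orP[/eqP e|//].
  by rewrite -e pw wP in nv.
case: (top P) => [/K0 //|[w [wP pw hw]]].
apply: (IHv w) (leqnn _) => //.
move: (hP _ wP pw) => /orP[/eqP e|//].
by move: dP; rewrite leqn0 deg_eq0 -e wP.
Qed.

End Reduction.

Section SeparantNonzero.
Variables (F : fieldType) (m n : nat) (d : 'I_m -> F -> F).
Hypothesis hchar : [pchar F] =i pred0.
Variable (R : diffpoly n d).
Implicit Types (P : R) (v : dvar m n).

Lemma natr_dp_neq0 k : (k.+1%:R : R) != 0.
Proof. by rewrite -(rmorph_nat (dpC R)) fmorph_eq0 ((pcharf0P F).1 hchar). Qed.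

Lemma pd_Xn v k : pd v (dpX R v ^+ k.+1) = k.+1%:R * dpX R v ^+ k.
Proof.
elim: k => [|k IH]; first by rewrite expr1 pdX eqxx expr0 mulr1.
by rewrite exprS pdM IH pdX eqxx mul1r exprS -[k.+2]add1n natrD; ring.
Qed.

Lemma pd_zero v : pd v (0 : R) = 0.
Proof. by apply: (addrI (pd v 0)); rewrite -pdD !addr0. Qed.

(** Characteristic 0 enters here: if [P] has degree [k.+1] in [v] with leading coefficient [c], the
    coefficient of [v ^+ k] in the partial derivative is [c * k.+1%:R]. *)
Lemma pd_neq0 v P : v \in vars P -> pd v P != 0.
Proof.
move=> vP; have dP : (0 < deg v P)%N by rewrite lt0n deg_eq0 negbK.
have P0 : P != 0 by apply: contraTneq vP => ->; apply/negP => /(@pall0 _ _ _ _ _ (fun=> False)).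
move: (coef_deg_neq0 v P0) (coef_expand (leqnn (deg v P))).
case: (deg v P) dP => // k _ ck e.
rewrite big_ord_recr /= in e; set c := coef v k.+1 P in ck e.
have pdE j : pd v (coef v j P * dpX R v ^+ j) = coef v j P * pd v (dpX R v ^+ j).
  by rewrite pdM pd_free ?coef_vars // mul0r add0r.
have: coef v k (pd v P) = c * k.+1%:R.
  rewrite e pdD pdM (pd_free (coef_vars v k.+1 P)) mul0r add0r pd_Xn coefD mulrA.
  rewrite [X in X + _](_ : _ = 0) ?add0r; last first.
    rewrite (big_morph (pd v) (pdD v) (pd_zero v)).
    rewrite (big_morph (coef v k) (coefD v k) (coef0 _ v k)).
    apply: big1 => -[[|j] hj] _ /=; rewrite pdE.
      by rewrite expr0 pd_free ?mulr0 ?coef0 //; apply/negP => /(@pall1 _ _ _ _ _ (fun=> False)).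
    rewrite pd_Xn coef_gt //; apply: (@leq_ltn_trans j) => //.
    rewrite -[X in (_ <= X)%N]add0n deg_leM ?deg_coef //.
    rewrite -[X in (_ <= X)%N]add0n deg_leM ?deg_Xn //.
    by rewrite -(rmorph_nat (dpC R)) deg_free // varsC.
  have cf : v \notin vars (c * k.+1%:R).
    have /notin_pall vc : v \notin vars c by apply: coef_vars.
    apply/notin_pall; apply: pallM; first exact: vc.
    by rewrite -(rmorph_nat (dpC R)); apply: pallC.
  rewrite -{1}[k]add0n coefM_top ?deg_Xn ?deg_free //.
  by rewrite coef_Xn mulr1 coef_free.
move=> ec; apply: contraNneq (mulf_neq0_dp ck (natr_dp_neq0 k)) => e0.
by rewrite -ec e0 coef0.
Qed.

End SeparantNonzero.

(** * Coherent pairs *)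

Section GeneratedIdeal.
Variables (F : fieldType) (m n : nat) (d : 'I_m -> F -> F).
Hypothesis hcomm : forall i j a, d i (d j a) = d j (d i a).
Variable (R : diffpoly n d).
Variables (lt : rel (dvar m n)) (hlt : ranking lt).
Implicit Types (P Q G : R) (v w : dvar m n) (th tau : dmon m) (b : bool).
Variables (A : bool -> R) (u : bool -> dvar m n).

(* [gen bnd] is the set of combinations of derivatives of the [A b] whose leaders
   satisfy [bnd]; without restriction on the leaders it is the differential
   ideal they generate. *)
Inductive gen (bnd : dvar m n -> Prop) : R -> Prop :=
| Gen0 : gen bnd 0
| GenS G tau b Q : bnd (dact tau (u b)) -> gen bnd Q ->
    gen bnd (G * derm tau (A b) + Q).

Lemma genW (bnd bnd' : dvar m n -> Prop) Q :
  (forall v, bnd v -> bnd' v) -> gen bnd Q -> gen bnd' Q.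
Proof.
move=> h; elim=> [|G tau b P /h hb _ IH]; first exact: Gen0.
exact: GenS.
Qed.

Lemma genD bnd P Q : gen bnd P -> gen bnd Q -> gen bnd (P + Q).
Proof.
move=> hP hQ; elim: hP => [|G tau b P' hb _ IH]; first by rewrite add0r.
by rewrite -addrA; apply: GenS.
Qed.

Lemma genM bnd P Q : gen bnd Q -> gen bnd (P * Q).
Proof.
elim=> [|G tau b P' hb _ IH]; first by rewrite mulr0; apply: Gen0.
by rewrite mulrDr mulrA; apply: GenS.
Qed.

Lemma genN bnd Q : gen bnd Q -> gen bnd (- Q).
Proof. by rewrite -mulN1r; apply: genM. Qed.

Lemma genB bnd P Q : gen bnd P -> gen bnd Q -> gen bnd (P - Q).
Proof. by move=> hP hQ; apply: genD => //; apply: genN. Qed.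

Lemma gen_scaled (bnd : dvar m n -> Prop) G tau b :
  bnd (dact tau (u b)) -> gen bnd (G * derm tau (A b)).
Proof. by move=> h; rewrite -[_ * _]addr0; apply: GenS h (Gen0 _). Qed.

Lemma gen_sum bnd (I : eqType) (r : seq I) (E : I -> R) :
  (forall i, i \in r -> gen bnd (E i)) -> gen bnd (\sum_(i <- r) E i).
Proof.
move=> h; rewrite big_seq; elim/big_ind: _ => //; first exact: Gen0.
by move=> *; apply: genD.
Qed.

(** By the Leibniz rule a multiple of [theta A] yields a multiple of [theta A] and one of its
    derivative, so [bnd'] has to admit both leaders. *)
Lemma gen_der (bnd bnd' : dvar m n -> Prop) i Q :
  (forall v, bnd v -> bnd' v /\ bnd' (dact (dgen i) v)) ->
  gen bnd Q -> gen bnd' (der i Q).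
Proof.
move=> h; elim=> [|G tau b P /h[hb1 hb2] _ IH]; first by rewrite der0; apply: Gen0.
rewrite derD derM; apply: genD => //; apply: genD; first exact: gen_scaled.
by rewrite -derm_gen //; apply: gen_scaled; rewrite dactD.
Qed.

Lemma gen_top bnd Q : gen bnd Q ->
  Q = 0 \/ exists w, bnd w /\ gen (fun v => rle lt v w) Q.
Proof.
elim=> [|G tau b P hb hP IH]; [by left|right].
have hv := rle_refl lt (dact tau (u b)).
case: IH => [->|[w [hw gw]]].
  by exists (dact tau (u b)); split=> //; apply: GenS => //; apply: Gen0.
case/orP: (rle_total hlt (dact tau (u b)) w) => h.
  by exists w; split=> //; apply: GenS.
exists (dact tau (u b)); split=> //; apply: GenS => //.
by apply: genW gw => v /(rle_trans hlt); apply.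
Qed.

End GeneratedIdeal.

Section Coherence.
Variables (F : fieldType) (m n : nat) (d : 'I_m -> F -> F).
Hypothesis hcomm : forall i j a, d i (d j a) = d j (d i a).
Variable (R : diffpoly n d).
Variables (lt : rel (dvar m n)) (hlt : ranking lt).
Implicit Types (P Q G H : R) (v w : dvar m n) (th tau : dmon m) (b : bool).
Variables (A s : bool -> R) (u : bool -> dvar m n).
Hypothesis hA : forall b, lin lt (A b) (u b) (s b).
Hypothesis hs : forall b, pall (fun w => ~~ principal u w) (s b).
Hypothesis hs0 : forall b, s b != 0.
(* Coherence, in Rosenfeld's sense. *)
Hypothesis hcoh : forall tau tau' b b' w,
  dact tau (u b) = w -> dact tau' (u b') = w -> exists c : F,
  gen A u (fun v => lt v w) (derm tau (A b) - dpC R c * derm tau' (A b')).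

Local Notation genlt w := (gen A u (fun v => lt v w)).
Local Notation genle w := (gen A u (fun v => rle lt v w)).

(** Coherence merges all terms whose leader is exactly [w] into a multiple of a single derivative,
    at the cost of terms with lower leaders. *)
Lemma genle_split w Q : genle w Q ->
  genlt w Q \/ exists G tau b,
    dact tau (u b) = w /\ genlt w (Q - G * derm tau (A b)).
Proof.
elim=> [|G tau b P hb _ IH]; first by left; apply: Gen0.
case: (eqVneq (dact tau (u b)) w) hb => [hw _|hw]; last first.
  rewrite /rle (negPf hw) /= => hb; case: IH => [h|[G' [tau' [b' [e h]]]]].
    by left; apply: GenS.
  by right; exists G', tau', b'; split=> //; rewrite -addrA; apply: GenS.
right; case: IH => [h|[G' [tau' [b' [e h]]]]].
  by exists G, tau, b; split=> //; rewrite addrC addKr.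
have [c hc] := hcoh e hw.
exists (G + G' * dpC R c), tau, b; split=> //.
have -> : G * derm tau (A b) + P - (G + G' * dpC R c) * derm tau (A b) =
  (P - G' * derm tau' (A b')) +
  G' * (derm tau' (A b') - dpC R c * derm tau (A b)) by ring.
by apply: genD => //; apply: genM.
Qed.

(** The existential form lends itself to structural induction on [G]: it passes to sums and
    products, and the only generator needing work is [w] itself. *)
Lemma pseudo_division w (E t : R) G : lin lt E w t ->
  exists k H G', t ^+ k * G = H * E + G' /\ w \notin vars G'.
Proof.
move=> [ht hT]; have wt := below_notin hlt ht.
apply: (@vars_ind _ _ _ _ R (fun=> True) (fun G => exists k H G',
    t ^+ k * G = H * E + G' /\ w \notin vars G')) => //.
- by move=> c; exists 0%N, 0, (dpC R c); rewrite mul0r add0r mul1r varsC.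
- move=> G1 G2 [k1 [H1 [R1 [e1 f1]]]] [k2 [H2 [R2 [e2 f2]]]].
  exists (k1 + k2)%N, (t ^+ k2 * H1 + t ^+ k1 * H2), (t ^+ k2 * R1 + t ^+ k1 * R2).
  split.
    have -> : t ^+ (k1 + k2) * (G1 + G2) =
      t ^+ k2 * (t ^+ k1 * G1) + t ^+ k1 * (t ^+ k2 * G2) by rewrite exprD; ring.
    by rewrite e1 e2; ring.
  move/notin_pall: wt => wt; move/notin_pall: f1 => f1; move/notin_pall: f2 => f2.
  by apply/notin_pall; apply: pallD; apply: pallM => //; apply: pallXn.
- move=> G1 G2 [k1 [H1 [R1 [e1 f1]]]] [k2 [H2 [R2 [e2 f2]]]].
  exists (k1 + k2)%N, (H1 * H2 * E + H1 * R2 + H2 * R1), (R1 * R2); split.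
    have -> : t ^+ (k1 + k2) * (G1 * G2) = (t ^+ k1 * G1) * (t ^+ k2 * G2).
      by rewrite exprD; ring.
    by rewrite e1 e2; ring.
  move/notin_pall: f1 => f1; move/notin_pall: f2 => f2.
  by apply/notin_pall; apply: pallM.
move=> v _; case: (eqVneq v w) => [->|vw].
  (* [t] times [w] is [E] minus the part of [E] that lies below [w]. *)
  exists 1%N, 1, (- (E - t * dpX R w)); split; first by rewrite expr1; ring.
  by apply/notin_pall; apply: pallN => x /hT h e; rewrite e (rlt_irr hlt) in h.
exists 0%N, 0, (dpX R v); rewrite mul0r add0r mul1r varsX in_fset1; split=> //.
by rewrite eq_sym.
Qed.

(** Only the multipliers [G] can involve [w], since the derivatives of the [A b] in the
    representation have leaders below [w]. Dividing each multiplier by [E] leaves a combination free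
    of [w]. *)
Lemma genlt_division w (E t : R) Q : lin lt E w t -> genlt w Q ->
  exists k H Q', [/\ t ^+ k * Q = H * E + Q', genlt w Q' & w \notin vars Q'].
Proof.
move=> hE; have [ht _] := hE; have wt := below_notin hlt ht.
elim=> [|G tau b P hb _ [k [H [Q' [e g f]]]]].
  exists 0%N, 0, 0; split; first by rewrite mulr0 mul0r addr0.
    exact: Gen0.
  by apply/negP => /(@pall0 _ _ _ _ _ (fun=> False)).
have [k1 [H1 [G1 [e1 f1]]]] := pseudo_division G hE.
exists (k1 + k)%N, (t ^+ k * H1 * derm tau (A b) + t ^+ k1 * H),
  (t ^+ k * G1 * derm tau (A b) + t ^+ k1 * Q'); split.
- have -> : t ^+ (k1 + k) * (G * derm tau (A b) + P) =
    t ^+ k * (t ^+ k1 * G) * derm tau (A b) + t ^+ k1 * (t ^+ k * P).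
    by rewrite exprD; ring.
  by rewrite e1 e; ring.
- by apply: GenS => //; apply: genM.
have lD : w \notin vars (derm tau (A b)).
  apply: (below_notin hlt); apply: (belowW hlt hb).
  by apply: lin_upto (lin_derm _ _ _ (hA b)).
move/notin_pall: wt => wt; move/notin_pall: f1 => f1; move/notin_pall: f => f.
move/notin_pall: lD => lD.
by apply/notin_pall; apply: pallD; apply: pallM => //; try apply: pallM => //; apply: pallXn.
Qed.

(** After division, [t ^+ k * Q - Q'] is a multiple of [E] that is free of [w], whereas [E] has
    degree 1 in [w]; additivity of degrees forces this multiple to be 0. *)
Lemma genlt_elim w (E t : R) G Q : lin lt E w t -> t != 0 ->
  w \notin vars Q -> genlt w (Q - G * E) -> exists k, genlt w (t ^+ k * Q).
Proof.
move=> hE t0 wQ /(genlt_division hE)[k [H [Q' [e g f]]]]; exists k.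
have [ht _] := hE; have wt := below_notin hlt ht.
have e2 : t ^+ k * Q - Q' = (t ^+ k * G + H) * E.
  by apply/eqP; rewrite subr_eq -[_ * E + _]addrC; apply/eqP; move: e;
     rewrite mulrBr => /eqP; rewrite subr_eq => /eqP ->; ring.
suff h : t ^+ k * Q - Q' = 0 by rewrite -[_ * Q](subrK Q') h add0r.
case: (eqVneq (t ^+ k * G + H) 0) => [h|h]; first by rewrite e2 h mul0r.
have E0 : E != 0.
  by apply: contraTneq (lin_vars hlt hE t0) => ->;
     apply/negP => /(@pall0 _ _ _ _ _ (fun=> False)).
have := degM w h E0; rewrite -e2 (lin_deg1 hlt hE t0) addn1.
rewrite deg_free //.
move/notin_pall: wt => wt; move/notin_pall: f => f; move/notin_pall: wQ => wQ.
by apply/notin_pall; apply: pallB => //; apply: pallM => //; apply: pallXn.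
Qed.

(* Rosenfeld's lemma: the highest leader [w] occurring in a representation of [Q]
   can be lowered, at the cost of multiplying [Q] by a separant. *)
Lemma gen_free0 bnd Q :
  gen A u bnd Q -> pall (fun w => ~~ principal u w) Q -> Q = 0.
Proof.
case/(gen_top hlt) => [//|[w [_ hQ]]] fQ.
elim/(well_founded_ind (ranking_wf hlt)): w Q hQ fQ => w IH Q hQ fQ.
have [t [t0 ft gt]] : exists t, [/\ t != 0,
    pall (fun w => ~~ principal u w) t & genlt w (t * Q)].
  case: (genle_split hQ) => [g|[G [tau [b [ew g]]]]].
    by exists 1; rewrite oner_neq0 mul1r; split=> //; apply: pall1.
  have hE : lin lt (derm tau (A b)) w (s b) by rewrite -ew; apply: lin_derm.
  have wQ : w \notin vars Q.
    apply/negP => /fQ /negP; apply; apply/principalP.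
    by exists tau, b.
  have [k gk] := genlt_elim hE (hs0 b) wQ g.
  exists (s b ^+ k); split=> //; first exact: expf_neq0_dp.
  by apply: pallXn.
have ftQ : pall (fun w => ~~ principal u w) (t * Q) by apply: pallM.
have tQ : t * Q = 0.
  by case/(gen_top hlt): gt => [//|[w' [ww' h]]]; apply: IH h ftQ.
by case: (mulf_eq0_dp tQ) => // t00; rewrite t00 eqxx in t0.
Qed.

End Coherence.

(** * The pair (theta_i - L_i) z *)

Section Pair.
Variables (F : fieldType) (m n : nat) (d : 'I_m -> F -> F).
Hypothesis hchar : [pchar F] =i pred0.
Hypothesis hcomm : forall i j a, d i (d j a) = d j (d i a).
Variable (R : diffpoly n d).
Variables (lt : rel (dvar m n)) (hlt : ranking lt).
Implicit Types (P Q G H : R) (v w : dvar m n) (tau t : dmon m) (b : bool).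

Variable Dl : bool -> {set 'I_m}.
Hypothesis hDl : forall b i, i \in Dl b -> i \notin Dl (~~ b).
Variables (z : R) (vz : dvar m n).
Hypothesis hvz : vz \in vars z /\ forall w, w \in vars z -> w = vz \/ lt w vz.
Variable th : bool -> dmon m.
Hypothesis hth : forall b, dmon_on (Dl b) (th b).
Hypothesis hth0 : forall b, th b != 0.
Variable L : bool -> dop F m.
Hypothesis hL : forall b t,
  t \in msupp (L b) -> const_field d (Dl (~~ b)) (L b)@_t.

Definition act (T : dop F m) Q : R :=
  \sum_(t <- msupp T) dpC R T@_t * derm t Q.

Hypothesis hLL : act (L false) (act (L true) z) = act (L true) (act (L false) z).

(* [false] and [true] stand for the indices 1 and 2: [member b] is P_i and
   [~~ b] is the other index. *)
Definition member b : R := derm (th b) z - act (L b) z.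
Definition leader b : dvar m n := dact (th b) vz.

Hypothesis hlead : forall b, leader b \in vars (member b) /\
  forall w, w \in vars (member b) -> w = leader b \/ lt w (leader b).

(* [L b] may contain [th b] itself; [topcoef b] is the resulting coefficient of
   [th b] in [th b - L b]. *)
Definition topcoef b : F := 1 - (L b)@_(th b).
Definition lsupp b : {fset dmon m} := (msupp (L b) `\ th b)%fset.

Local Notation C := (dpC R).
Local Notation S := (pd vz z).

Lemma S_neq0 : S != 0.
Proof. by apply: pd_neq0 => //; case: hvz. Qed.

Lemma upto_z : pall (fun w => rle lt w vz) z.
Proof.
by move=> w /hvz.2[->|/rltW //]; apply: rle_refl.
Qed.

Lemma derm_upto t : pall (fun w => rle lt w (dact t vz)) (derm t z).
Proof.
case: (eqVneq t 0) => [->|t0]; first by rewrite dact0 derm0; apply: upto_z.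
exact: lin_upto (upto_derm hcomm hlt t0 upto_z).
Qed.

(** The condition [t0 != 0] matters: [z] need not be linear in [vz], but every proper derivative of
    it is linear in its leader, with coefficient the separant of [z]. *)
Lemma sum_derm_lin (D : {fset dmon m}) (k : dmon m -> F) t0 :
  t0 \in D -> t0 != 0 ->
  (forall t, t \in D -> t != t0 -> k t != 0 -> lt (dact t vz) (dact t0 vz)) ->
  lin lt (\sum_(t <- D) C (k t) * derm t z) (dact t0 vz) (C (k t0) * S).
Proof.
move=> t0D t00 hk; rewrite (big_fsetD1 t0) //=; apply: (linD).
  apply: linM; last exact: pallC.
  exact: upto_derm upto_z.
apply: pall_sum => t; rewrite in_fsetD1 => /andP[tt0 tD].
case: (eqVneq (k t) 0) => [->|kt]; first by rewrite rmorph0 mul0r; apply: pall0.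
apply: pallM; first exact: pallC.
exact: (belowW hlt (hk t tD tt0 kt) (@derm_upto t)).
Qed.

Lemma member_sum b :
  member b = \sum_(t <- (th b |` msupp (L b))%fset)
    C ((t == th b)%:R - (L b)@_t) * derm t z.
Proof.
rewrite /member /act; set D := (_ |` _)%fset.
rewrite (big_fset_incl _ (fsubsetUr [fset th b]%fset (msupp (L b)))) /=; last first.
  by move=> t _ /mcoeff_outdom ->; rewrite rmorph0 mul0r.
have -> : derm (th b) z = \sum_(t <- D) C (t == th b)%:R * derm t z.
  rewrite (big_fsetD1 (th b)) /=; last by rewrite in_fsetU in_fset1 eqxx.
  rewrite eqxx rmorph1 mul1r big1_fset ?addr0 // => t.
  by rewrite in_fsetD1 => /andP[/negPf -> _] _; rewrite rmorph0 mul0r.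
rewrite -sumrB; apply: eq_bigr => t _.
by rewrite rmorphB mulrBl.
Qed.

(** Information on [L b] is extracted from the leader of [member b]. Among the operators with
    nonzero coefficient in [th b - L b], let [t0] be the one that ranks [vz] highest; its derivative
    is the leader of the sum, so [t0] can only be [th b]. *)
Lemma member_lead b :
  topcoef b != 0 /\
  forall t, t \in lsupp b -> lt (dact t vz) (leader b).
Proof.
set D := (th b |` msupp (L b))%fset.
pose k t := (t == th b)%:R - (L b)@_t.
have eP : member b = \sum_(t <- D) C (k t) * derm t z := member_sum b.
have [lP topP] := hlead b.
have kth : k (th b) = topcoef b by rewrite /k eqxx.
pose nz := [seq dact t vz | t <- D & k t != 0].
case: (eqVneq nz [::]) => [e|/(exists_rmax hlt)[v]].
  have P0 : member b = 0.
    rewrite eP big1_fset // => t tD _; case: (eqVneq (k t) 0) => [->|kt].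
      by rewrite rmorph0 mul0r.
    have : dact t vz \in nz by apply: map_f; rewrite mem_filter kt.
    by rewrite e.
  by move: lP; rewrite P0 => /(@pall0 _ _ _ _ _ (fun=> False)).
case/mapP => t0; rewrite mem_filter => /andP[k0 t0D] -> hmax.
have hmx t : t \in D -> k t != 0 -> rle lt (dact t vz) (dact t0 vz).
  by move=> tD kt; apply: hmax; apply: map_f; rewrite mem_filter kt.
have et0 : t0 = th b.
  (* If the highest operator were the identity, all of [member b] would stay at or below [vz], which
     lies below the leader since [th b] is nonzero. *)
  case: (eqVneq t0 0) => [e0|t00].
    have : pall (fun w => rle lt w vz) (member b).
      rewrite eP; apply: pall_sum => t tD.
      case: (eqVneq (k t) 0) => [->|kt]; first by rewrite rmorph0 mul0r; apply: pall0.
      apply: pallM; first exact: pallC.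
      move=> w /derm_upto /(rle_trans hlt); apply.
      by have := hmx t tD kt; rewrite e0 dact0.
    move=> /(_ _ lP); rewrite -[rle _ _ _]negbK -(rltNge hlt).
    by rewrite (rlt_dactl hlt).
  have hl : lin lt (member b) (dact t0 vz) (C (k t0) * S).
    rewrite eP; apply: sum_derm_lin => // t tD tt0 kt.
    have := hmx t tD kt; rewrite /rle; case: eqP => // /dact_inj e.
    by rewrite e eqxx in tt0.
  have ks0 : C (k t0) * S != 0.
    by apply: mulf_neq0_dp S_neq0; rewrite fmorph_eq0.
  have [v1 v2] := lin_lead hlt hl ks0.
  have [/dact_inj //|h1] := topP _ v1; have [/dact_inj //|h2] := v2 _ lP.
  by move: (rlt_trans hlt h1 h2); rewrite (rlt_irr hlt).
split=> [|t]; first by rewrite -kth -et0.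
rewrite in_fsetD1 => /andP[tth tL].
have kt : k t != 0 by rewrite /k (negPf tth) sub0r oppr_eq0 mcoeff_neq0.
have tD : t \in D by rewrite in_fsetU tL orbT.
have := hmx t tD kt; rewrite et0 /rle; case: eqP => // /dact_inj e.
by rewrite e eqxx in tth.
Qed.

Definition sep b : R := C (topcoef b) * S.

Lemma member_lin b : lin lt (member b) (leader b) (sep b).
Proof.
rewrite member_sum /sep.
have -> : topcoef b = ((th b) == th b)%:R - (L b)@_(th b) by rewrite eqxx.
apply: (@sum_derm_lin _ (fun t => (t == th b)%:R - (L b)@_t)) => //.
  by rewrite in_fsetU in_fset1 eqxx.
move=> t; rewrite in_fsetU in_fset1 => /orP[->//|tL] tth _.
by apply: (member_lead b).2; rewrite in_fsetD1 tth.
Qed.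

Lemma sep_neq0 b : sep b != 0.
Proof.
apply: mulf_neq0_dp S_neq0.
by rewrite fmorph_eq0; apply: (member_lead b).1.
Qed.

Lemma upto_nonprincipal P :
  pall (fun w => rle lt w vz) P -> pall (fun w => ~~ principal leader w) P.
Proof.
move=> hP w /hP hw; apply/principalP => -[tau [b e]].
move: hw; rewrite -[rle _ _ _]negbK -(rltNge hlt) e => /negP; apply.
apply: (rlt_le_trans hlt _ (rle_dactl hlt tau _)).
exact: (rlt_dactl hlt).
Qed.

Lemma S_upto : pall (fun w => rle lt w vz) S.
Proof. by apply: pall_subset upto_z; apply: vars_pd. Qed.

Lemma sep_nonprincipal b : pall (fun w => ~~ principal leader w) (sep b).
Proof.
by apply: upto_nonprincipal; apply: pallM; [apply: pallC|apply: S_upto].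
Qed.

Lemma actB T P Q : act T (P - Q) = act T P - act T Q.
Proof.
rewrite /act -sumrB; apply: eq_bigr => t _.
by rewrite (dermB hcomm) mulrBr.
Qed.

(** The coefficients of [L b] are killed by the derivations of [Dl (~~ b)], the only ones in
    [th (~~ b)]. *)
Lemma derm_act b Q :
  derm (th (~~ b)) (act (L b) Q) = act (L b) (derm (th (~~ b)) Q).
Proof.
rewrite /act (derm_sum hcomm) !big_seq; apply: eq_bigr => t tL.
rewrite (derm_const hcomm _ (@hth (~~ b))) //; last exact: hL.
by rewrite -!(dermA hcomm) addrC.
Qed.

Definition lower b Q : R := \sum_(t <- lsupp b) C (L b)@_t * derm t Q.

Lemma act_lower b Q :
  act (L b) Q = (1 - C (topcoef b)) * derm (th b) Q + lower b Q.
Proof.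
rewrite /act /topcoef rmorphB rmorph1 subKr; case: (boolP (th b \in msupp (L b))) => hb.
  by rewrite (big_fsetD1 (th b)).
rewrite mcoeff_outdom // rmorph0 mul0r add0r /lower /lsupp.
congr bigop.body; congr (enum_fset _); apply/fsetP => t; rewrite in_fsetD1.
by case: eqP => // ->; rewrite (negPf hb).
Qed.

Definition spol b : R :=
  derm (th (~~ b)) (member b) - derm (th b) (member (~~ b)).

Lemma spol_act b :
  spol b = act (L (~~ b)) (member b) - act (L b) (member (~~ b)).
Proof.
rewrite /spol /member !(dermB hcomm) !actB derm_act.
have -> : derm (th b) (act (L (~~ b)) z) = act (L (~~ b)) (derm (th b) z).
  by rewrite -[th b](congr1 th (negbK b)) derm_act negbK.
have -> : act (L b) (act (L (~~ b)) z) = act (L (~~ b)) (act (L b) z).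
  by case: b; rewrite /= hLL.
by rewrite -!(dermA hcomm) [th b + _]addrC; ring.
Qed.

Lemma coherence b :
  C (topcoef (~~ b)) * derm (th (~~ b)) (member b)
  - C (topcoef b) * derm (th b) (member (~~ b))
  = lower (~~ b) (member b) - lower b (member (~~ b)).
Proof.
have := spol_act b; rewrite !act_lower /spol => e.
have -> : lower (~~ b) (member b) = derm (th (~~ b)) (member b)
  - derm (th b) (member (~~ b)) + ((1 - C (topcoef b)) * derm (th b) (member (~~ b)) + lower b (member (~~ b))) - (1 - C (topcoef (~~ b))) * derm (th (~~ b)) (member b).
  by rewrite e; ring.
by ring.
Qed.

Local Notation genlt w := (gen member leader (fun v => lt v w)).

Lemma genlt_lower b :
  genlt (dact (th (~~ b)) (leader b)) (lower (~~ b) (member b)).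
Proof.
apply: gen_sum => t tL; apply: gen_scaled.
rewrite /leader -!dactD ![_ + th b]addrC !dactD; apply: (rlt_dact hlt).
exact: (member_lead (~~ b)).2.
Qed.

Lemma leader_swap b : dact (th (~~ b)) (leader b) = dact (th b) (leader (~~ b)).
Proof. by rewrite /leader -!dactD addrC. Qed.

Lemma coherence_gen b tau :
  genlt (dact (tau + th (~~ b)) (leader b))
    (C (topcoef (~~ b)) * derm (tau + th (~~ b)) (member b)
     - C (topcoef b) * derm (tau + th b) (member (~~ b))).
Proof.
elim/dmon_ind: tau => [|i tau IH].
  rewrite !add0r coherence; apply: genB; first exact: genlt_lower.
  have := genlt_lower (~~ b); rewrite negbK => h.
  by rewrite leader_swap.
set w := dact (tau + _) _ in IH *.
have ew : dact (dgen i + tau + th (~~ b)) (leader b) = dact (dgen i) w.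
  by rewrite -addrA dactD.
have ww := rlt_gen hlt i w.
rewrite ew -!addrA !(derm_gen hcomm).
set D1 := derm _ _; set D2 := derm _ (member (~~ b)).
(* The top coefficients need not be constants. Their derivatives multiply [D1] and [D2], whose
   leader [w] is below the new bound [dact (dgen i) w]. *)
have -> : C (topcoef (~~ b)) * der i D1 - C (topcoef b) * der i D2 =
  der i (C (topcoef (~~ b)) * D1 - C (topcoef b) * D2)
  - (C (d i (topcoef (~~ b))) * D1 - C (d i (topcoef b)) * D2).
  by rewrite derB !derM !derC; ring.
apply: genB.
  apply: gen_der IH => // v vw; split; first exact: (rlt_trans hlt vw).
  by have [_ _] := hlt; apply.
apply: genB; apply: gen_scaled; first exact: ww.
suff -> : dact (tau + th b) (leader (~~ b)) = w by exact: ww.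
by rewrite /w dactD -leader_swap -dactD.
Qed.

(** For different indices a common leader means [tau + th b = tau' + th (~~ b)]. As [th b] and
    [th (~~ b)] involve disjoint sets of derivations, [tau] is a multiple of [th (~~ b)], and the
    relation is a derivative of [coherence]. *)
Lemma member_coherent tau tau' b b' w :
  dact tau (leader b) = w -> dact tau' (leader b') = w -> exists c : F,
  genlt w (derm tau (member b) - C c * derm tau' (member b')).
Proof.
move=> e e'; case: (eqVneq b b') => [eb|].
  exists 1; rewrite rmorph1 mul1r -eb.
  have -> : tau = tau' by apply: (@dact_inj _ _ _ _ (leader b)); rewrite e {1}eb e'.
  by rewrite subrr; apply: Gen0.
move=> bb'; have eb' : b' = ~~ b by case: b b' bb' {e e'} => -[].
subst b'; have ett : tau + th b = tau' + th (~~ b).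
  by apply: (@dact_inj _ _ _ _ vz); rewrite !dactD -/(leader _) e -/(leader _) e'.
have ge i : (th (~~ b) i <= tau i)%N.
  case: (posnP (th (~~ b) i)) => [-> //|h].
  have := congr1 (fun f : dmon m => f i) ett; rewrite /= !dmonD.
  suff -> : th b i = 0%N by rewrite addn0 => ->; rewrite leq_addl.
  apply/eqP/negPn/negP => /(hth (b := b))/hDl.
  by rewrite (hth (b := ~~ b)) // -lt0n.
pose sg : dmon m := [ffun i => (tau i - th (~~ b) i)%N].
have e1 : tau = sg + th (~~ b).
  by apply/ffunP => i; rewrite dmonD ffunE subnK.
have e2 : tau' = sg + th b.
  apply: (@dmon_addIr m (th (~~ b))); rewrite -ett e1.
  by rewrite addrAC.
have an := (member_lead (~~ b)).1.
(* Both derivatives have [S] times their top coefficient in front of [w]; this ratio equalises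
   them. *)
exists (topcoef b / topcoef (~~ b)).
rewrite -e e1 e2.
have -> : derm (sg + th (~~ b)) (member b) -
   C (topcoef b / topcoef (~~ b)) * derm (sg + th b) (member (~~ b)) =
   C (topcoef (~~ b))^-1 *
   (C (topcoef (~~ b)) * derm (sg + th (~~ b)) (member b)
     - C (topcoef b) * derm (sg + th b) (member (~~ b))).
  rewrite mulrBr !mulrA -!rmorphM mulVf // rmorph1 mul1r.
  by rewrite [(_^-1 * _)%R]mulrC.
by apply: genM; apply: coherence_gen.
Qed.

Lemma gen_nonprincipal0 Q :
  gen member leader (fun=> True) Q ->
  pall (fun w => ~~ principal leader w) Q -> Q = 0.
Proof.
exact: (gen_free0 hcomm hlt member_lin sep_nonprincipal sep_neq0 member_coherent).
Qed.

Implicit Type x : F * dmon m * bool.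
(** A triple [(c, tau, b)] encodes the term [c] times [derm tau (member b)], whose leader is
    [dact (tau + th b) vz]. *)
Definition leading_theta x : dmon m := x.1.2 + th x.2.
Definition val_term x : R := C x.1.1 * derm x.1.2 (member x.2).

(** A multiple of [th b] sends [vz] to a derivative ranking at least as high as the leader, but the
    operators of [lsupp b] stay strictly below it. *)
Lemma lsupp_not_above b t : t \in lsupp b -> ~ (forall i, (th b i <= t i)%N).
Proof.
move=> /(member_lead b).2 + h; have -> : t = [ffun i => (t i - th b i)%N] + th b.
  by apply/ffunP => i; rewrite dmonD ffunE subnK.
by rewrite dactD (rltNge hlt) => /negP; apply; apply: rle_dactl.
Qed.

Lemma lsupp_neq t t' :
  t \in lsupp true -> t' \in lsupp false -> t + th false <> t' + th true.
Proof.
move=> tL /lsupp_not_above h e; apply: h => i.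
case: (posnP (th false i)) => [-> //|h].
have iD : i \in Dl false by apply: hth; rewrite -lt0n.
have := congr1 (fun f : dmon m => f i) e; rewrite /= !dmonD.
have -> : th true i = 0%N.
  by apply/eqP/negPn/negP => /(hth (b := true))/hDl; rewrite iD.
by rewrite addn0 => <-; rewrite leq_addl.
Qed.

Lemma spol_terms : exists s : seq (F * dmon m * bool),
  [/\ forall x, x \in s -> x.1.1 != 0, uniq [seq leading_theta x | x <- s]
    & spol false = \sum_(x <- s) val_term x].
Proof.
pose a1 := topcoef false; pose a2 := topcoef true.
have a10 : a1 != 0 := (member_lead false).1.
(* [coherence] is solved for [theta_1 P_2], after division by [a1]; the coefficient of [theta_2 P_1]
   in the S-polynomial becomes [1 - a2 / a1]. It vanishes when the top coefficients agree, whence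
   the filter on nonzero scalars. *)
pose x0 := (1 - a2 / a1, th true, false).
pose f1 t := (a1^-1 * (L true)@_t, t, false).
pose f2 t := (- (a1^-1 * (L false)@_t), t, true).
pose s := x0 :: map f1 (lsupp true) ++ map f2 (lsupp false).
exists [seq x <- s | x.1.1 != 0]; split.
- by move=> x; rewrite mem_filter => /andP[].
- apply: (subseq_uniq (map_subseq _ (filter_subseq _ _))).
  rewrite /s /= map_cat -!map_comp cat_uniq mem_cat negb_or.
  rewrite !map_inj_uniq ?fset_uniq ?andbT /=; [|by move=> ? ? /dmon_addIr|by move=> ? ? /dmon_addIr].
  apply/andP; split; last first.
    apply/hasPn => _ /mapP[t tL ->]; apply/mapP => -[t' tL' /= e].
    exact: (lsupp_neq tL' tL).
  apply/andP; split; apply/mapP => -[t tL /= e].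
    move: e; rewrite /leading_theta /= => /dmon_addIr e.
    by rewrite -e !inE eqxx in tL.
  move: e; rewrite /leading_theta /= addrC => /dmon_addIr e.
  by rewrite -e !inE eqxx in tL.
rewrite big_filter.
have -> : \sum_(x <- s | x.1.1 != 0) val_term x = \sum_(x <- s) val_term x.
  rewrite big_mkcond; apply: eq_bigr => x _; case: eqP => //= e.
  by rewrite /val_term e rmorph0 mul0r.
rewrite /s big_cons big_cat !big_map.
have e1 : \sum_(t <- lsupp true) val_term (f1 t) =
    C a1^-1 * lower true (member false).
  rewrite /lower mulr_sumr; apply: eq_bigr => t _.
  by rewrite /val_term /= rmorphM mulrA.
have e2 : \sum_(t <- lsupp false) val_term (f2 t) =
    - (C a1^-1 * lower false (member true)).
  rewrite /lower mulr_sumr -sumrN; apply: eq_bigr => t _.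
  by rewrite /val_term /= rmorphN rmorphM mulNr mulrA.
rewrite [X in X + _]/val_term /= e1 e2 -mulrBr.
have := coherence false; rewrite /= -/a1 -/a2 => <-.
have h : C a1^-1 * C a1 = 1 by rewrite -rmorphM mulVf // rmorph1.
rewrite /spol rmorphB rmorph1 rmorphM /=.
move: (derm (th true) _) (derm (th false) _) => X Y.
have hY : C a1^-1 * (C a1 * Y) = Y by rewrite mulrA h mul1r.
by rewrite mulrBr hY; ring.
Qed.

(* The list keeps pairwise distinct leaders, so its top term is the leading   *)
(* term of the sum and each elimination removes exactly this term.            *)
Lemma eliminate_terms (K : R -> Prop) : K 0 ->
  (forall P v tau b, v = dact tau (leader b) -> v \in vars P ->
     (forall w, w \in vars P -> principal leader w -> rle lt w v) ->
     K (eliminate member sep v tau b P) -> K P) ->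
  forall (s : seq (F * dmon m * bool)) (h : F) r,
  h != 0 -> (forall x, x \in s -> x.1.1 != 0) -> uniq [seq leading_theta x | x <- s] ->
  K (C h * S ^+ r * \sum_(x <- s) val_term x).
Proof.
move=> K0 KS s; have [k] := ubnP (size s).
elim: k s => // k IH s; rewrite ltnS => hk h r h0 hs us.
case: (eqVneq s [::]) => [->|sn]; first by rewrite big_nil mulr0.
have : [seq dact (leading_theta x) vz | x <- s] != [::] by case: (s) sn.
case/(exists_rmax hlt) => v /mapP[x xs ev] hmax.
have xE : perm_eq s (x :: rem x s) by apply: perm_to_rem.
rewrite (perm_big _ xE) big_cons /=.
set T := \sum_(y <- rem x s) val_term y.
have us' : uniq (leading_theta x :: [seq leading_theta y | y <- rem x s]).
  by rewrite -(perm_uniq (perm_map leading_theta xE)).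
have TE : pall (fun w => lt w v) T.
  apply: pall_sum => y yr; apply: pallM; first exact: pallC.
  have ys : y \in s by apply: mem_rem yr.
  have yx : leading_theta y != leading_theta x.
    by case/andP: us' => /mapP nx _; apply/eqP => e; apply: nx; exists y.
  have ly := lin_derm hcomm hlt y.1.2 (member_lin y.2).
  have ky : lt (dact (leading_theta y) vz) v.
    have := hmax _ (map_f (fun x => dact (leading_theta x) vz) ys).
    rewrite /rle; case: eqP => // e; rewrite ev in e.
    by rewrite (dact_inj e) eqxx in yx.
  by rewrite dactD in ky; apply: (belowW hlt ky); apply: lin_upto ly.
have lx : lin lt (val_term x) v (C x.1.1 * sep x.2).
  rewrite ev dactD; apply: linM; last exact: pallC.
  exact: (lin_derm hcomm hlt _ (member_lin _)).
have vzv : lt vz v.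
  rewrite ev /leading_theta addrC dactD.
  apply: (rlt_le_trans hlt (rlt_dactl hlt _ (hth0 x.2))).
  by rewrite -dactD addrC dactD; apply: (rle_dactl hlt).
have hSb : pall (fun w => lt w v) (C h * S ^+ r).
  apply: pallM; first exact: pallC.
  by apply: pallXn; apply: (belowW hlt vzv); apply: S_upto.
have lP : lin lt (C h * S ^+ r * (val_term x + T)) v
    (C h * S ^+ r * (C x.1.1 * sep x.2)).
  by apply: linM => //; apply: linD.
have lP0 : C h * S ^+ r * (C x.1.1 * sep x.2) != 0.
  apply: mulf_neq0_dp; apply: mulf_neq0_dp.
  - by rewrite fmorph_eq0.
  - by apply: expf_neq0_dp; apply: S_neq0.
  - by rewrite fmorph_eq0; apply: hs.
  - exact: sep_neq0.
have [vP topP] := lin_lead hlt lP lP0.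
apply: (KS _ v x.1.2 x.2) => //.
- by rewrite ev dactD.
- move=> w /topP[-> _|/rltW //]; exact: rle_refl.
have -> : eliminate member sep v x.1.2 x.2 (C h * S ^+ r * (val_term x + T)) =
    C (topcoef x.2 * h) * S ^+ r.+1 * T.
  rewrite /eliminate (lin_deg1 hlt lP lP0) (lin_coef hlt lP) expr0 mulr1.
  rewrite /sep /val_term exprS rmorphM /=.
  by ring.
apply: IH.
- by rewrite size_rem // -ltnS prednK // lt0n size_eq0.
- by rewrite mulf_neq0 // (member_lead x.2).1.
- by move=> y /mem_rem /hs.
- by case/andP: us'.
Qed.

Lemma spol_eliminate (K : R -> Prop) : K 0 ->
  (forall P v tau b, v = dact tau (leader b) -> v \in vars P ->
     (forall w, w \in vars P -> principal leader w -> rle lt w v) ->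
     K (eliminate member sep v tau b P) -> K P) ->
  K (spol false).
Proof.
move=> K0 KS; have [s [s0 us ->]] := spol_terms.
rewrite -[X in K X]mul1r -[1]mulr1 -{1}(rmorph1 C) -(expr0 S).
by apply: eliminate_terms => //; apply: oner_neq0.
Qed.

Local Notation genT := (gen member leader (fun=> True)).
Local Notation nonprincipal := (pall (fun w => ~~ principal leader w)).

(* The ideal [P_1, P_2] : S_z^oo. *)
Definition sat Q := exists r, genT (S ^+ r * Q).

Lemma genT_sat Q : genT Q -> sat Q.
Proof. by move=> h; exists 0%N; rewrite mul1r. Qed.

Lemma genT_der i Q : genT Q -> genT (der i Q).
Proof. exact: gen_der. Qed.

Lemma satM P Q : sat Q -> sat (P * Q).
Proof. by case=> r h; exists r; rewrite mulrCA; apply: genM. Qed.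

Lemma satD P Q : sat P -> sat Q -> sat (P + Q).
Proof.
move=> [r1 h1] [r2 h2]; exists (r1 + r2)%N.
have -> : S ^+ (r1 + r2) * (P + Q) =
  S ^+ r2 * (S ^+ r1 * P) + S ^+ r1 * (S ^+ r2 * Q) by rewrite exprD; ring.
by apply: genD; apply: genM.
Qed.

Lemma satB P Q : sat P -> sat Q -> sat (P - Q).
Proof. by move=> hP hQ; rewrite -mulN1r; apply: satD => //; apply: satM. Qed.

Lemma sat_expS r Q : sat (S ^+ r * Q) -> sat Q.
Proof. by case=> k h; exists (k + r)%N; rewrite exprD -mulrA. Qed.

Lemma sat_const e Q : e != 0 -> S = C e -> sat Q -> genT Q.
Proof.
move=> e0 eS [r]; rewrite eS -rmorphXn => h.
have -> : Q = C (e ^+ r)^-1 * (C (e ^+ r) * Q).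
  by rewrite mulrA -rmorphM mulVf ?expf_neq0 // rmorph1 mul1r.
exact: genM.
Qed.

(** Differentiating [S ^+ r * Q] leaves a term with [S ^+ r.-1]; one more factor [S] turns it into a
    multiple of [S ^+ r * Q]. *)
Lemma sat_der i Q : sat Q -> sat (der i Q).
Proof.
case=> r h; exists r.+1.
have -> : S ^+ r.+1 * der i Q =
  S * der i (S ^+ r * Q) - der i S * (r%:R * (S ^+ r * Q)).
  case: r {h} => [|r]; first by rewrite expr0 expr1 !mul1r mul0r mulr0 subr0.
  by rewrite derM derXn [S ^+ r.+2]exprS [S ^+ r.+1]exprS; ring.
apply: genB; apply: genM; first exact: genT_der.
exact: genM.
Qed.

Lemma sat_member b tau : sat (derm tau (member b)).
Proof. by apply: genT_sat; rewrite -[derm _ _]mul1r; apply: gen_scaled. Qed.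

Lemma S_nonprincipal : nonprincipal S.
Proof. by apply: upto_nonprincipal; apply: S_upto. Qed.

Lemma sat_nonprincipal0 Q : sat Q -> nonprincipal Q -> Q = 0.
Proof.
move=> [r h] fQ; have fSQ : nonprincipal (S ^+ r * Q).
  by apply: pallM => //; apply: pallXn; apply: S_nonprincipal.
case: (mulf_eq0_dp (gen_nonprincipal0 h fSQ)) => // e.
by have := expf_neq0_dp r S_neq0; rewrite e eqxx.
Qed.

Lemma sat_remainder Q : exists r Q0, nonprincipal Q0 /\ sat (S ^+ r * Q - Q0).
Proof.
elim/(elimination_ind hcomm hlt member_lin sep_nonprincipal): Q => [Q fQ|].
  by exists 0%N, Q; split=> //; rewrite mul1r subrr; exists 0%N; rewrite mulr0; apply: Gen0.
move=> P v tau b _ _ _ [r [Q0 [fQ h]]].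
have a0 := (member_lead b).1; set a := topcoef b in a0.
(* An elimination multiplies by [sep b], that is by [a] times [S]; dividing the remainder by [a]
   leaves an exact power of [S]. *)
exists r.+1, (C a^-1 * Q0); split; first by apply: pallM => //; apply: pallC.
have aV : C a^-1 * C a = 1 by rewrite -rmorphM mulVf // rmorph1.
have -> : S ^+ r.+1 * P - C a^-1 * Q0 =
    C a^-1 * (S ^+ r * eliminate member sep v tau b P - Q0)
    + C a^-1 * S ^+ r * coef v (deg v P) P * dpX R v ^+ (deg v P).-1 *
      derm tau (member b).
  have -> : S ^+ r.+1 * P = C a^-1 * C a * (S ^+ r.+1 * P) by rewrite aV mul1r.
  by rewrite /eliminate /sep exprS -/a; ring.
by apply: satD; apply: satM => //; apply: sat_member.
Qed.

Lemma sat_prime P Q : sat (P * Q) -> sat P \/ sat Q.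
Proof.
have [r1 [P0 [fP hP]]] := sat_remainder P.
have [r2 [Q0 [fQ hQ]]] := sat_remainder Q.
move=> hPQ; have : sat (P0 * Q0).
  have -> : P0 * Q0 = S ^+ r1 * S ^+ r2 * (P * Q)
    - (Q0 * (S ^+ r1 * P - P0) + S ^+ r1 * P * (S ^+ r2 * Q - Q0)) by ring.
  by apply: satB; [apply: satM|apply: satD; apply: satM].
move/sat_nonprincipal0 => /(_ (pallM fP fQ))/mulf_eq0_dp[e|e]; [left|right].
  by apply: (@sat_expS r1); move: hP; rewrite e subr0.
by apply: (@sat_expS r2); move: hQ; rewrite e subr0.
Qed.

Lemma sat_neq1 : ~ sat 1.
Proof.
move/sat_nonprincipal0 => /(_ (@pall1 _ _ _ _ R _))/eqP.
by rewrite oner_eq0.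
Qed.

(** * Factors of the two polynomials that carry the leaders *)

Section Factors.
Variables (A B : bool -> R).
Hypothesis hAB : forall b, member b = A b * B b.
Hypothesis hAl : forall b, leader b \in vars (A b).

Local Notation sA b := (pd (leader b) (A b)).

Lemma factor_neq0 b : A b != 0 /\ B b != 0.
Proof.
have : A b * B b != 0.
  rewrite -hAB; apply: contraTneq (hlead b).1 => ->.
  by apply/negP => /(@pall0 _ _ _ _ _ (fun=> False)).
by move=> h; split; apply: contraNneq h => ->; rewrite ?mul0r ?mulr0.
Qed.

(** [member b] has degree 1 in its leader, and [A b] already uses it up. *)
Lemma factor_deg b : deg (leader b) (A b) = 1%N /\ deg (leader b) (B b) = 0%N.
Proof.
have [A0 B0] := factor_neq0 b.
have := degM (leader b) A0 B0; rewrite -hAB.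
rewrite (lin_deg1 hlt (member_lin b) (sep_neq0 b)).
have : deg (leader b) (A b) != 0%N by rewrite deg_eq0 negbK.
by case: (deg _ (A b)) => // -[|k] // _; case: (deg _ (B b)).
Qed.

Lemma factor_vars b : (vars (A b) `<=` vars (member b))%fset.
Proof.
by have [A0 B0] := factor_neq0 b; rewrite hAB varsM //; apply: fsubsetUl.
Qed.

Lemma factor_coef b : lin lt (A b) (leader b) (coef (leader b) 1 (A b)).
Proof.
have [dA _] := factor_deg b; have /coef_expand e : (deg (leader b) (A b) <= 1)%N.
  by rewrite dA.
rewrite big_ord_recr big_ord1 /= expr0 mulr1 expr1 in e.
have hb k : pall (fun w => lt w (leader b)) (coef (leader b) k (A b)).
  move=> w wc; have /(fsubsetP (factor_vars b)) : w \in vars (A b).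
    by apply: (fsubsetP (vars_coef _ _ _)) wc.
  case/(hlead b).2 => // e'; move: (coef_vars (leader b) k (A b)).
  by rewrite -{1}e' wc.
split; first exact: hb.
by rewrite {1}e addrK; apply: hb.
Qed.

Lemma factor_lin b : lin lt (A b) (leader b) (sA b).
Proof. by rewrite (lin_pd hlt (factor_coef b)); apply: factor_coef. Qed.

(** Comparison of the coefficients of the leader in [member b = A b * B b], where [B b] is free of
    it. *)
Lemma sep_factor b : sep b = sA b * B b.
Proof.
have [dA dB] := factor_deg b.
rewrite -(lin_coef hlt (member_lin b)) hAB -[1%N]addn0.
rewrite coefM_top ?dA ?dB // (lin_coef hlt (factor_lin b)) coef_free //.
by rewrite -deg_eq0 dB.
Qed.

Lemma factor_sep_neq0 b : sA b != 0 /\ B b != 0.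
Proof.
have := sep_neq0 b; rewrite sep_factor => h.
by split; apply: contraNneq h => ->; rewrite ?mul0r ?mulr0.
Qed.

Lemma factor_sep_nonprincipal b : nonprincipal (sA b) /\ nonprincipal (B b).
Proof.
have [s0 B0] := factor_sep_neq0 b.
have := @sep_nonprincipal b; rewrite sep_factor /pall varsM // => h.
by split=> w wP; apply: h; rewrite in_fsetU wP ?orbT.
Qed.

(** By primality [A b] or [B b] lies in the saturation; [B b] divides the separant, hence is nonzero
    and free of principal derivatives, which excludes it. *)
Lemma factor_sat b tau : sat (derm tau (A b)).
Proof.
have h : sat (A b).
  have : sat (A b * B b) by rewrite -hAB -[member b]derm0; apply: sat_member.
  case/sat_prime => // /sat_nonprincipal0/(_ (factor_sep_nonprincipal b).2) e.
  by have := (factor_sep_neq0 b).2; rewrite e eqxx.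
elim/dmon_ind: tau => [|i tau IH]; first by rewrite derm0.
by rewrite derm_gen //; apply: sat_der.
Qed.

Lemma gen_factor_sat bnd Q : gen A leader bnd Q -> sat Q.
Proof.
elim=> [|G tau b P _ _ IH]; first by apply: genT_sat; apply: Gen0.
by apply: satD => //; apply: satM; apply: factor_sat.
Qed.

(** From right to left, primality cancels the power of the separants. From left to right,
    pseudo-division by the [A b] gives a remainder that lies in the saturation and has no principal
    derivative, hence is 0. *)
Lemma factor_saturation Q :
  sat Q <-> exists r,
    gen A leader (fun=> True) ((sA false * sA true) ^+ r * Q).
Proof.
set SA := sA false * sA true.
have fSA : nonprincipal SA.
  by apply: pallM; apply: (factor_sep_nonprincipal _).1.
have SA0 : SA != 0 by apply: mulf_neq0_dp; apply: (factor_sep_neq0 _).1.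
split=> [hQ|[r /gen_factor_sat/sat_prime[|//]]]; last first.
  move/sat_nonprincipal0 => /(_ (@pallXn _ _ _ _ R _ _ r fSA)) e.
  by have := expf_neq0_dp r SA0; rewrite e eqxx.
have [r [Q0 [f0 g0]]] : exists r Q0, nonprincipal Q0 /\
    gen A leader (fun=> True) (SA ^+ r * Q - Q0).
  have fs b := (factor_sep_nonprincipal b).1.
  elim/(elimination_ind hcomm hlt factor_lin fs): Q {hQ} => [Q fQ|].
    by exists 0%N, Q; split=> //; rewrite mul1r subrr; apply: Gen0.
  move=> P v tau b _ _ _ [r [Q0 [fQ h]]].
  (* Eliminating with [A b] multiplies by [sA b] only; the other factor is supplied so that powers
     of the product [SA] accumulate. *)
  have eSA : SA = sA (~~ b) * sA b by rewrite /SA; case: b {h} => //=; rewrite mulrC.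
  exists r.+1, (sA (~~ b) * Q0); split; first by apply: pallM.
  have -> : SA ^+ r.+1 * P - sA (~~ b) * Q0 =
      sA (~~ b) * (SA ^+ r * eliminate A (fun b => sA b) v tau b P - Q0)
      + sA (~~ b) * SA ^+ r * coef v (deg v P) P * dpX R v ^+ (deg v P).-1 *
        derm tau (A b).
    by rewrite /eliminate exprS {1}eSA; ring.
  by apply: genD; [apply: genM|apply: gen_scaled].
exists r; suff e : Q0 = 0 by move: g0; rewrite e subr0.
apply: sat_nonprincipal0 f0.
have -> : Q0 = SA ^+ r * Q - (SA ^+ r * Q - Q0) by ring.
by apply: satB; [apply: satM|apply: gen_factor_sat g0].
Qed.

End Factors.

End Pair.

Section EliminateShape.
Variables (F : fieldType) (m n : nat) (d : 'I_m -> F -> F).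
Variable (R : diffpoly n d).
Variables (lt : rel (dvar m n)) (hlt : ranking lt).
Variables (A s : bool -> R) (u : bool -> dvar m n).
Hypothesis hA : forall b, lin lt (A b) (u b) (s b).
Hypothesis hs0 : forall b, s b != 0.

(** Together with [eliminate_ini], this matches the single formula [eliminate] with the two
    constructors of [pseudo_step]. *)
Lemma eliminate_sep v tau b P : eliminate A s v tau b P =
  pd (u b) (A b) * P
  - coef v (deg v P) P * dpX R v ^+ (deg v P).-1 * derm tau (A b).
Proof. by rewrite (lin_pd hlt (hA b)). Qed.

Lemma eliminate_ini b P : eliminate A s (u b) 0 b P =
  coef (u b) (deg (u b) (A b)) (A b) * P
  - coef (u b) (deg (u b) P) P *
    dpX R (u b) ^+ (deg (u b) P - deg (u b) (A b)) * A b.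
Proof.
by rewrite (lin_deg1 hlt (hA b) (hs0 b)) (lin_coef hlt (hA b)) subn1 /eliminate derm0.
Qed.

End EliminateShape.

(** * Pseudo-reduction and monomial reduction *)

Section PseudoReduction.
Variables (F : fieldType) (m n : nat) (d : 'I_m -> F -> F).
Hypothesis hd : forall i, derivation (d i).
Hypothesis hcomm : forall i j a, d i (d j a) = d j (d i a).
Variables (lt : rel (dvar m n)) (hlt : ranking lt).

Local Notation R := (dpoly_diffpoly n hd).

Variables (A s : bool -> R) (u : bool -> dvar m n).
Hypothesis hA : forall b, lin lt (A b) (u b) (s b).
Hypothesis hs0 : forall b, s b != 0.

Local Notation pair := ([:: A false; A true] : seq (dpoly F m n)).
Implicit Types (P Q : dpoly F m n) (v w : dvar m n) (tau : dmon m) (b : bool).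

Lemma mem_pair Q : Q \in pair -> exists b, Q = A b.
Proof.
rewrite in_cons mem_seq1 => /orP[/eqP ->|/eqP ->]; [by exists false|by exists true].
Qed.

Lemma in_pair b : (A b : dpoly F m n) \in pair.
Proof.
case: b; last exact: mem_head.
by rewrite in_cons; apply/orP; right; rewrite mem_seq1.
Qed.

Lemma pair_leader b : is_leader lt (A b : dpoly F m n) (u b).
Proof. exact: (lin_lead hlt (hA b) (hs0 b)). Qed.

Lemma is_leader_uniq Q v w : is_leader lt Q v -> is_leader lt Q w -> v = w.
Proof.
move=> [vQ hv] [wQ hw]; case: (hv _ wQ) => // wv; case: (hw _ vQ) => // vw.
by have := rlt_trans hlt wv vw; rewrite (rlt_irr hlt).
Qed.

Lemma pair_leaderP Q v : Q \in pair -> is_leader lt Q v ->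
  exists b, Q = A b /\ v = u b.
Proof.
move=> /mem_pair[b ->] h; exists b; split=> //.
exact: is_leader_uniq h (pair_leader b).
Qed.

Lemma pair_deg b : degv (u b) (A b : dpoly F m n) = 1%N.
Proof. exact: (lin_deg1 hlt (hA b) (hs0 b)). Qed.

Lemma reducible_principal Q v :
  reducible_at lt pair Q v -> v \in dvars Q /\ principal u v.
Proof.
move=> [vQ [B [w [BA lB h]]]]; split=> //; apply/principalP.
have [b [_ ew]] := pair_leaderP BA lB.
case: h => [[th _ ->]|[-> _]]; first by exists th, b; rewrite ew.
by exists 0, b; rewrite dact0.
Qed.

(** Each leader has degree 1 in its polynomial, so a single occurrence of a leader is already an
    obstruction. *)
Lemma principal_reducible Q v :
  v \in dvars Q -> principal u v -> reducible_at lt pair Q v.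
Proof.
move=> vQ /principalP[tau [b ev]]; split=> //; exists (A b), (u b).
split; [exact: in_pair|exact: pair_leader|].
case: (eqVneq tau 0) => [t0|t0]; last by left; exists tau.
right; rewrite ev t0 dact0; split=> //; rewrite pair_deg lt0n degv_eq0 negbK.
by rewrite -[u b]dact0 -t0 -ev.
Qed.

Lemma pair_top_reducible Q v : v \in dvars Q -> principal u v ->
  (forall w, w \in dvars Q -> principal u w -> rle lt w v) ->
  top_reducible_at lt pair Q v.
Proof.
move=> vQ pv hv; split; first exact: principal_reducible.
move=> w /reducible_principal[wQ pw].
by case/orP: (hv _ wQ pw) => [/eqP|]; [left|right].
Qed.

Lemma pseudo_step_eliminate Q v tau b : v = dact tau (u b) -> v \in dvars Q ->
  (forall w, w \in dvars Q -> principal u w -> rle lt w v) ->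
  pseudo_step lt d pair Q (eliminate A s v tau b (Q : R)).
Proof.
move=> ev vQ hv.
have top : top_reducible_at lt pair Q v.
  by apply: pair_top_reducible => //; apply/principalP; exists tau, b.
case: (eqVneq tau 0) => [t0|t0].
  have e : v = u b by rewrite ev t0 dact0.
  subst v tau; rewrite e in vQ top *; rewrite (eliminate_ini hlt hA hs0).
  apply: (PseudoStepIni d (in_pair b) (pair_leader b)) => //.
  by rewrite pair_deg lt0n degv_eq0 negbK.
rewrite (eliminate_sep hlt hA).
exact: (PseudoStepSep d (in_pair b) (pair_leader b) t0 ev top).
Qed.

Lemma nonprincipal_reduced Q : (forall v, v \in dvars Q -> ~~ principal u v) ->
  forall B, B \in pair -> reduced_wrt lt Q B.
Proof.
move=> hQ B /mem_pair[b ->]; exists (u b); split.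
- exact: pair_leader.
- move=> th _; apply/negP => /hQ /principalP; apply.
  by exists th, b.
rewrite pair_deg ltnS leqn0 degv_eq0; apply/negP => /hQ /principalP; apply.
by exists 0, b; rewrite dact0.
Qed.

Lemma pseudo_reduces_to0_0 : pseudo_reduces_to0 lt d pair 0.
Proof.
split; first exact: rt1n_refl.
by apply: nonprincipal_reduced => v /(@pall0 _ _ _ _ R (fun=> False)).
Qed.

Lemma pseudo_reduces_to0_eliminate Q v tau b :
  v = dact tau (u b) -> v \in dvars Q ->
  (forall w, w \in dvars Q -> principal u w -> rle lt w v) ->
  pseudo_reduces_to0 lt d pair (eliminate A s v tau b (Q : R)) ->
  pseudo_reduces_to0 lt d pair Q.
Proof.
move=> ev vQ hv [h1 h2]; split=> //.
exact: rt1n_trans (pseudo_step_eliminate ev vQ hv) h1.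
Qed.

End PseudoReduction.

Section DifferentialIdeals.
Variables (F : fieldType) (m n : nat) (d : 'I_m -> F -> F).
Hypothesis hd : forall i, derivation (d i).
Hypothesis hcomm : forall i j a, d i (d j a) = d j (d i a).

Local Notation R := (dpoly_diffpoly n hd).

Variables (A : bool -> R) (u : bool -> dvar m n).
Local Notation pair := ([:: A false; A true] : seq (dpoly F m n)).
Implicit Types (P Q : dpoly F m n).

(** The explicit combinations form one of the differential ideals intersected in [diff_gen], and
    every other one contains them. *)
Lemma diff_gen_gen Q : diff_gen d pair Q <-> gen A u (fun=> True) (Q : R).
Proof.
split=> [h|h J [[J0 JD JM] Jd] JA].
  apply: h; first split; first split.
  - exact: Gen0.
  - by move=> P P'; apply: genD.
  - by move=> P P'; apply: genM.
  - by move=> i P; apply: gen_der.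
  move=> P /mem_pair[b ->].
  have := @gen_scaled _ _ _ _ R A u (fun=> True) 1 0 b I.
  by rewrite mul1r derm0.
elim: h => [|G tau b P _ _ IH]; first exact: J0.
have Jt : J (derm tau (A b)).
  elim/dmon_ind: tau => [|i tau IHt]; first by rewrite derm0; apply/JA/in_pair.
  by rewrite derm_gen //; apply: Jd.
exact: (JD _ _ (JM G _ Jt) IH).
Qed.

End DifferentialIdeals.

(** * Leading monomials of derivatives under an admissible monomial order *)

Section MonomialOrders.
Variables (F : fieldType) (m n : nat) (d : 'I_m -> F -> F).
Hypothesis hd : forall i, derivation (d i).
Hypothesis hcomm : forall i j a, d i (d j a) = d j (d i a).
Hypothesis hchar : [pchar F] =i pred0.
Variables (lt : rel (dvar m n)) (hlt : ranking lt).
Variables (mlt : rel (dmonom m n)) (hmlt : admissible_monomial_order d mlt).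

Local Notation R := (dpoly_diffpoly n hd).
Local Notation LM := (is_leading_monomial mlt).
Implicit Types (P Q T : dpoly F m n) (v w : dvar m n) (th tau : dmon m).
Implicit Types (M N : dmonom m n) (i j : 'I_m).

Lemma mlt_irr M : mlt M M = false.
Proof. by have [[h _ _] _ _ _ _] := hmlt; apply: h. Qed.

Lemma mlt_trans N M M' : mlt M N -> mlt N M' -> mlt M M'.
Proof. by have [[_ h _] _ _ _ _] := hmlt; apply: h. Qed.

Lemma mlt_total M N : M != N -> mlt M N \/ mlt N M.
Proof. by have [[_ _ h] _ _ _ _] := hmlt; move/h/orP. Qed.

Lemma exists_mmax (X : eqType) (f : X -> dmonom m n) (s : seq X) :
  s != [::] ->
  exists2 x, x \in s & forall y, y \in s -> f y = f x \/ mlt (f y) (f x).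
Proof.
elim: s => // x s IH _; case: (eqVneq s [::]) => [->|/IH[y ys hy]].
  by exists x; rewrite ?mem_head // => y; rewrite mem_seq1 => /eqP ->; left.
case: (eqVneq (f x) (f y)) => [e|/mlt_total[h|h]].
- exists y; first by rewrite in_cons ys orbT.
  by move=> w; rewrite in_cons => /orP[/eqP ->|/hy //]; left.
- exists y; first by rewrite in_cons ys orbT.
  by move=> w; rewrite in_cons => /orP[/eqP ->|/hy //]; right.
exists x; rewrite ?mem_head // => w; rewrite in_cons => /orP[/eqP ->|/hy].
  by left.
by case=> [->|h']; right=> //; apply: mlt_trans h' h.
Qed.

Lemma exists_LM P : P != 0 -> exists M, LM P M.
Proof.
move=> P0; have : (msupp P : seq _) != [::].
  apply: contraNneq P0 => e; rewrite -msupp_eq0; apply/eqP/fsetP => M.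
  by rewrite in_fset0; have -> : (M \in msupp P) = (M \in (msupp P : seq _)) by []; rewrite e.
by case/(exists_mmax id) => M MP hM; exists M.
Qed.

Lemma mcoeff_above P M N : LM P M -> mlt M N -> P@_N = 0.
Proof.
move=> [_ h] MN; apply: mcoeff_outdom; apply/negP => /h[e|NM].
  by rewrite e mlt_irr in MN.
by have := mlt_trans MN NM; rewrite mlt_irr.
Qed.

(** The largest of pairwise distinct leading monomials cannot cancel. The last conclusion says that
    removing its term removes this monomial, as an elementary reduction demands. *)
Lemma LM_sum (X : eqType) (s : seq X) (f : X -> dpoly F m n)
    (lm : X -> dmonom m n) :
  (forall x, x \in s -> LM (f x) (lm x)) -> uniq (map lm s) -> s != [::] ->
  exists x, [/\ x \in s, LM (\sum_(y <- s) f y) (lm x)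
    & (\sum_(y <- rem x s) f y)@_(lm x) = 0].
Proof.
move=> hf us s0; have [x xs hx] := exists_mmax lm s0.
have xE : perm_eq s (x :: rem x s) by apply: perm_to_rem.
have us' : uniq (lm x :: map lm (rem x s)) by rewrite -(perm_uniq (perm_map lm xE)).
have below y : y \in rem x s -> mlt (lm y) (lm x).
  move=> ys; case: (hx _ (mem_rem ys)) => // e.
  by case/andP: us' => /mapP nx _; case: nx; exists y.
have r0 N : N = lm x \/ mlt (lm x) N -> (\sum_(y <- rem x s) f y)@_N = 0.
  move=> hN; rewrite (raddf_sum (mcoeff N)) big_seq; apply: big1 => y ys /=.
  apply: (mcoeff_above (hf _ (mem_rem ys))).
  by case: hN => [->|/(mlt_trans (below _ ys))]; [apply: below|].
exists x; split=> //; last by apply: r0; left.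
have E N : N = lm x \/ mlt (lm x) N -> (\sum_(y <- s) f y)@_N = (f x)@_N.
  by move=> hN; rewrite (perm_big _ xE) big_cons mcoeffD r0 // addr0.
have [lx hlx] := hf _ xs; split.
  by rewrite -mcoeff_neq0 E ?mcoeff_neq0 //; left.
move=> N; rewrite -mcoeff_neq0 => hN.
case: (eqVneq N (lm x)) => [|/mlt_total[|h]]; [by left|by right|].
by move: hN; rewrite E ?(mcoeff_above (hf _ xs)) ?eqxx //; right.
Qed.

Lemma LM_uniq P M N : LM P M -> LM P N -> M = N.
Proof.
move=> [MP hM] [NP hN]; case: (hM _ NP) => // h1; case: (hN _ MP) => // h2.
by have := mlt_trans h1 h2; rewrite mlt_irr.
Qed.

Lemma LM_scale c P M : c != 0 -> LM P M -> LM (c *: P) M.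
Proof.
move=> c0 [MP hM]; split; first by rewrite msuppZ (negPf c0).
by move=> N; rewrite msuppZ (negPf c0); apply: hM.
Qed.

(** Each elementary reduction deletes the term with the largest leading monomial, with multiplier
    monomial 1; the remaining sum has the same form. *)
Lemma reduces_terms (G : seq (dpoly F m n)) (X : eqType) (s : seq X)
    (c : X -> F) (tau : X -> dmon m) (g : X -> dpoly F m n)
    (lm : X -> dmonom m n) :
  (forall x, x \in s -> [/\ c x != 0, g x \in G
     & LM (dder_mon d (tau x) (g x)) (lm x)]) ->
  uniq (map lm s) ->
  reduces_to0 d mlt G (\sum_(x <- s) c x *: dder_mon d (tau x) (g x)).
Proof.
have [k] := ubnP (size s).
elim: k s => // k IH s; rewrite ltnS => hk hs us.
case: (eqVneq s [::]) => [->|s0]; first by rewrite big_nil; apply: rt1n_refl.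
pose f x := c x *: dder_mon d (tau x) (g x).
have hf x : x \in s -> LM (f x) (lm x).
  by move=> /hs[c0 _ l]; apply: LM_scale.
have [x [xs lx rx]] := LM_sum hf us s0.
have [cx gx lgx] := hs _ xs.
have xE : perm_eq s (x :: rem x s) by apply: perm_to_rem.
have us' : uniq (map lm (x :: rem x s)) by rewrite -(perm_uniq (perm_map lm xE)).
apply: (@rt1n_trans _ _ _ (\sum_(y <- rem x s) f y)); last first.
  apply: IH; first by rewrite size_rem // -ltnS prednK // lt0n size_eq0.
    by move=> y /mem_rem/hs.
  by case/andP: us'.
exists (g x), (tau x), mone, (lm x), (c x); split=> //.
- by rewrite mul1m; case: lx.
- apply/eqP; rewrite eq_sym subr_eq; apply/eqP.
  apply: etrans (perm_big _ xE) _; apply: etrans (big_cons _ _ _ _ _ _) _.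
  apply: etrans (addrC _ _) _; apply: (congr1 (fun y => _ + y)).
  apply: (congr1 (fun y => c x *: y)).
  exact: (esym (etrans (congr1 (fun y => y * _) (mpolyC1E _ _)) (mul1r _))).
by rewrite mul1m -mcoeff_eq0 rx.
Qed.

Lemma dder_malgU i c M :
  dder d i (<< c *g M >> : dpoly F m n) =
  << d i c *g M >> + c *: dder d i << M >>.
Proof.
have e a : << a *g M >> = a%:MP * << M >> :> dpoly F m n.
  by apply: esym; apply: etrans (malgMUU _ _ _ _) _; rewrite mulr1; apply: malgU_eq => v; rewrite mul1m.
apply: etrans (congr1 (dder d i) (e c)) _.
apply: etrans (@derM _ _ _ _ R i _ _) _.
apply: (congr2 +%R); last exact: mul_malgC.
apply: esym; apply: etrans (e _) _.
exact: (congr1 (fun y => y * << M >>) (esym (@derC _ _ _ _ R i c))).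
Qed.

Lemma mcoeff_dder i P N :
  (dder d i P)@_N = \sum_(M <- msupp P)
    (d i P@_M *+ (M == N) + P@_M * (dder d i << M >>)@_N).
Proof.
rewrite {1}[P]monalgE.
rewrite (big_morph (dder d i) (@derD _ _ _ _ R i) (@der0 _ _ _ _ R i)).
rewrite (raddf_sum (mcoeff N)); apply: eq_bigr => M _.
apply: etrans (congr1 (mcoeff N) (dder_malgU i _ M)) _.
by rewrite mcoeffD mcoeffU mcoeffZ.
Qed.

(** The derivative of the highest-ranking factor occurs linearly, with a nonzero separant as
    coefficient. *)
Lemma dder_monomial_neq0 i M : M != mone -> dder d i (<< M >> : dpoly F m n) != 0.
Proof.
move=> M1; pose U : R := << M >>.
have vE v : (v \in vars U) = (M v != 0%N).
  apply/dvarsP/idP => [[N /(fsubsetP msuppU_le)]|Mv].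
    by rewrite in_fset1 => /eqP ->.
  by exists M => //; rewrite msuppU oner_eq0 in_fset1.
have U0 : (vars U : seq _) != [::].
  apply: contraNneq M1 => e; apply/eqP/eqP/cmP => v; rewrite moneE.
  apply/eqP; apply: contraTT isT => Mv; move: (vE v); rewrite Mv.
  by have -> : (v \in vars U) = (v \in (vars U : seq _)) by []; rewrite e.
have [v vU hv] := exists_rmax hlt U0.
have hl := upto_der hlt i (hv : pall (fun w => rle lt w v) U).
have vD := lin_vars hlt hl (pd_neq0 hchar vU).
apply/negP => /eqP e; have {}e : der i U = 0 := e.
by move: vD; rewrite e => /(@pall0 _ _ _ _ R (fun=> False)).
Qed.

(** At and above [M'] only the monomial [M] contributes: the derivative of a smaller monomial has a
    smaller leading monomial, and differentiated coefficients stay on monomials at most [M], which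
    is below [M']. *)
Lemma LM_dder i P M : LM P M -> M != mone ->
  exists M', LM (dder d i << M >>) M' /\ LM (dder d i P) M'.
Proof.
move=> lP M1; have [MP hM] := lP.
have [M' lM'] := exists_LM (dder_monomial_neq0 i M1).
exists M'; split; first exact: lM'.
have [_ pos _ ax4 ax5] := hmlt.
have MM' : mlt M M' by apply: ax4 lM'.
have P0 : P@_M != 0 by rewrite mcoeff_neq0.
have E N : N = M' \/ mlt M' N -> (dder d i P)@_N = P@_M * (dder d i << M >>)@_N.
  move=> hN; have MN : mlt M N by case: hN => [-> //|]; apply: mlt_trans.
  apply: etrans (mcoeff_dder _ _ _) _.
  rewrite (big_fsetD1 M MP) /= big1_fset ?addr0.
    by case: eqP => [e|_]; [rewrite e mlt_irr in MN|rewrite add0r].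
  move=> N1; rewrite in_fsetD1 => /andP[N1M N1P] _.
  have N1lt : mlt N1 M by case: (hM _ N1P) => // e; rewrite e eqxx in N1M.
  have N1N : mlt N1 N by apply: mlt_trans N1lt MN.
  case: eqP => [e|_]; first by rewrite e mlt_irr in N1N.
  (* The monomial 1 has derivative 0, hence no leading monomial to compare. *)
  rewrite add0r; case: (eqVneq N1 mone) => [->|N10].
    have -> : dder d i (<< mone >> : dpoly F m n) = 0.
      apply: etrans (@derC _ _ _ _ R i 1) _.
      by rewrite (deriv1 hd) /= monalgU0.
    by rewrite mcoeff0 mulr0.
  have [M'' lM''] := exists_LM (dder_monomial_neq0 i N10).
  have M''M' : mlt M'' M' by apply: ax5 N1lt lM'' lM'.
  rewrite (mcoeff_above lM'') ?mulr0 //.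
  by case: hN => [-> //|]; apply: mlt_trans.
have [lM'1 lM'2] := lM'.
split.
  rewrite -mcoeff_neq0 E; last by left.
  by apply: mulf_neq0; [exact: P0|rewrite mcoeff_neq0; exact: lM'1].
move=> N; rewrite -mcoeff_neq0 => hN.
case: (eqVneq N M') => [|/mlt_total[|h]]; [by left|by right|].
move: hN; rewrite E; last by right.
by rewrite (mcoeff_above lM' h) mulr0 eqxx.
Qed.

(* The total order of a monomial in the derivation [j]; it is what tells the
   leading monomials of the various [theta z] apart. *)
Definition weight j M : nat :=
  (\sum_(v <- finsupp (cmonom_val M)) M v * v.1 j)%N.

Lemma weightE j M (D : {fset dvar m n}) :
  (finsupp (cmonom_val M) `<=` D)%fset ->
  weight j M = (\sum_(v <- D) M v * v.1 j)%N.
Proof.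
move=> h; apply: big_fset_incl => // v _ vM.
have -> : M v = 0%N by apply/eqP; rewrite cmE_eq0.
by rewrite mul0n.
Qed.

Lemma weightM j M N : weight j (mmul M N) = (weight j M + weight j N)%N.
Proof.
set D := (finsupp (cmonom_val M) `|` finsupp (cmonom_val N))%fset.
rewrite (weightE j (fsubsetUl _ _ : (_ `<=` D)%fset)).
rewrite (weightE j (fsubsetUr _ _ : (_ `<=` D)%fset)).
rewrite (weightE j (D := D)) -?big_split; last by rewrite mdomD.
by apply: eq_bigr => v _; rewrite mmulE mulnDl.
Qed.

Lemma weightU j v : weight j (ucm v) = v.1 j.
Proof. by rewrite /weight mdomU big_seq_fset1 ucmE eqxx mul1n. Qed.

(** Every monomial of the derivative arises by replacing one factor [v] with [dact (dgen i) v]. *)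
Lemma weight_dder i j M N : N \in msupp (dder d i (<< M >> : dpoly F m n)) ->
  weight j N = (weight j M + (j == i))%N.
Proof.
pose K (Q : dpoly F m n) :=
  forall N, N \in msupp Q -> weight j N = (weight j M + (j == i))%N.
have K0 : K 0 by move=> N'; rewrite msupp0.
have KD P Q : K P -> K Q -> K (P + Q).
  move=> h1 h2 N' /(fsubsetP (msuppD_le _ _)).
  by rewrite in_fsetU => /orP[/h1|/h2].
suff : K (dder d i << M >>) by apply.
rewrite /dder; apply: (KD).
  rewrite msuppU oner_eq0 big_seq_fset1 mcoeffUU (deriv1 hd) monalgU0.
  exact: K0.
apply: (big_ind K K0 KD) => v _ N'.
rewrite (_ : pderiv v _ * _ = << 1 *+ M v *g
    mmul (divcm M (ucm v)) (ucm (dact (dgen i) v)) >>); last first.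
  apply: etrans (congr1 (fun y => y * _) (pderivU v 1 M)) _.
  by apply: etrans (malgMUU _ _ _ _) _; rewrite mulr1.
rewrite msuppU; case: eqP => [_|Mv]; first by rewrite in_fset0.
rewrite in_fset1 => /eqP ->.
have eM : M = mmul (divcm M (ucm v)) (ucm v).
  apply/eqP/cmP => w; rewrite mmulE divcmE ucmE; case: (v =P w) => [<-|_].
    by rewrite subnK // lt0n; apply/eqP => e; rewrite e in Mv.
  by rewrite subn0 addn0.
rewrite [in RHS]eM !weightM !weightU /= dmonD dgenE.
by rewrite -addnA [(_ + v.1 j)%N]addnC.
Qed.

Lemma dder_mon0 P : dder_mon d 0 P = P.
Proof. exact: (@derm0 _ _ _ _ R). Qed.

Lemma dder_mon_gen i th P :
  dder_mon d (dgen i + th) P = dder d i (dder_mon d th P).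
Proof. exact: (@derm_gen _ _ _ _ R hcomm). Qed.

(** Two polynomials are followed at once because the leading monomial after [th] depends only on the
    one before; [LM_member] uses this to compare [member b] with a derivative of [z]. *)
Lemma LM_derm th P Q M : LM P M -> LM Q M -> M != mone ->
  exists M', [/\ LM (dder_mon d th P) M', LM (dder_mon d th Q) M', M' != mone
    & forall j, weight j M' = (weight j M + th j)%N].
Proof.
have [_ pos _ ax4 _] := hmlt.
move=> lP lQ M1; elim/dmon_ind: th => [|i th [M' [l1 l2 n1 w]]].
  exists M; rewrite !dder_mon0; split; [exact: lP|exact: lQ|exact: M1|].
  by move=> j; rewrite dmon0 addn0.
have [N [l l1']] := LM_dder i l1 n1; have [N' [l' l2']] := LM_dder i l2 n1.
have e := LM_uniq l l'; subst N'.
exists N; split.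
- by rewrite dder_mon_gen; exact: l1'.
- by rewrite dder_mon_gen; exact: l2'.
- have := ax4 _ _ _ n1 l; apply: contraTneq => ->; apply/negP => h.
  by have := mlt_trans h (pos _ n1); rewrite mlt_irr.
move=> j; have [lN _] := l.
by rewrite (weight_dder j lN) w dmonD dgenE -addnA [((j == i) + _)%N]addnC.
Qed.

End MonomialOrders.

(** * Polynomials of degree at most 1 *)

Section Affine.
Variables (F : fieldType) (m n : nat) (d : 'I_m -> F -> F).
Hypothesis hd : forall i, derivation (d i).
Hypothesis hcomm : forall i j a, d i (d j a) = d j (d i a).
Local Notation R := (dpoly_diffpoly n hd).
Implicit Types (P Q T : dpoly F m n) (v w : dvar m n) (t tau : dmon m).
Implicit Types (M N : dmonom m n) (i j : 'I_m) (b : bool).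

(** Degree at most 1, so that the class is closed under sums, scalars and derivations, which degree
    exactly 1 is not. *)
Definition affine P :=
  forall M, M \in msupp P -> M = mone \/ exists v, M = ucm v.

Lemma affine0 : affine 0.
Proof. by move=> M; rewrite msupp0. Qed.

Lemma affineD P Q : affine P -> affine Q -> affine (P + Q).
Proof.
move=> hP hQ M /(fsubsetP (msuppD_le _ _)).
by rewrite in_fsetU => /orP[/hP|/hQ].
Qed.

Lemma affineZ c P : affine P -> affine (c *: P).
Proof. by move=> hP M /(fsubsetP (msuppZ_le _ _))/hP. Qed.

Lemma affine_dder i P : affine P -> affine (dder d i P).
Proof.
move=> hP N; rewrite -mcoeff_neq0 (mcoeff_dder hd) => hN.
have [M MP] : exists2 M, M \in msupp P &
    (M == N) || ((dder d i << M >> : dpoly F m n)@_N != 0).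
  apply/hasP; apply: contraNT hN => /hasPn h; rewrite big_seq big1 // => M MP.
  have := h _ MP; rewrite negb_or negbK => /andP[/negPf -> /eqP ->].
  by rewrite mulr0 addr0.
case/orP => [/eqP <-|]; first exact: hP.
case: (hP _ MP) => [->|[v ->]].
  have -> : dder d i (<< mone >> : dpoly F m n) = 0.
    apply: etrans (@derC _ _ _ _ R i 1) _.
    by rewrite (deriv1 hd) /= monalgU0.
  by rewrite mcoeff0 eqxx.
have -> : dder d i (<< ucm v >> : dpoly F m n) = << ucm (dact (dgen i) v) >>.
  exact: (@derX _ _ _ _ R i v).
rewrite mcoeff_neq0 => /(fsubsetP msuppU_le); rewrite in_fset1 => /eqP ->.
by right; exists (dact (dgen i) v).
Qed.

Lemma affine_dder_mon tau P : affine P -> affine (dder_mon d tau P).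
Proof.
move=> hP; elim/dmon_ind: tau => [|i tau IH].
  by rewrite (dder_mon0 hd); exact: hP.
by rewrite (dder_mon_gen hd hcomm); apply: affine_dder.
Qed.

Lemma divcmK M v : M v != 0%N -> mmul (divcm M (ucm v)) (ucm v) = M.
Proof.
move=> Mv; apply/eqP/cmP => w; rewrite mmulE divcmE ucmE.
by case: (v =P w) => [<-|_]; [rewrite subnK // lt0n|rewrite subn0 addn0].
Qed.

Lemma linear_affine P : linear_dpoly P -> affine P.
Proof.
move=> hP M MP; have := msize_mdeg_lt MP; rewrite hP ltnS => hM.
case: (eqVneq M mone) => [->|M1]; first by left.
right; have [v Mv] : exists v, M v != 0%N.
  case: (fset_0Vmem (finsupp (cmonom_val M))) => [e|[v vM]]; last first.
    by exists v; rewrite cmE_neq0.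
  case/eqP: M1; apply/eqP/cmP => v; rewrite moneE; apply/eqP.
  by rewrite cmE_eq0 e in_fset0.
exists v; rewrite -(divcmK Mv); have -> : divcm M (ucm v) = mone.
  apply: mdeg_eq0I; move: hM; rewrite -{1}(divcmK Mv) mdegM mdegU.
  by rewrite addn1 ltnS leqn0 => /eqP.
exact: mul1m.
Qed.

Lemma affine_pderiv_vars v P : affine P -> dvars (pderiv v P) = fset0.
Proof.
move=> hP; apply: vall_fset0 => p; apply: vall_sum => M MP.
case: (posnP (M v)) => [->|Mv]; first by rewrite mulr0n monalgU0; apply: vall0.
apply: vallU => w; rewrite divcmE.
case: (hP _ MP) Mv => [->|[x ->]]; first by rewrite moneE.
by rewrite !ucmE; case: (x =P v) => // ->; rewrite subnn.
Qed.

Lemma mcoeff_mulU M N P : (<< M >> * P)@_(mmul M N) = P@_N.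
Proof.
apply: (@add_ext _ _ _ _ (fun P => (<< M >> * P)@_(mmul M N)) (mcoeff N)).
- move=> A B; exact: (etrans (congr1 (mcoeff _) (mulrDr _ _ _)) (mcoeffD _ _ _)).
- by move=> A B; rewrite mcoeffD.
move=> M' _; move: (P@_M') => c.
apply: etrans (congr1 (mcoeff _) (malgMUU _ _ _ _)) _.
rewrite mul1r !mcoeffU; congr (c *+ nat_of_bool _).
apply/eqP/eqP => [e|-> //]; apply/eqP/cmP => v.
have := congr1 (fun A : dmonom m n => A v) e.
by rewrite /= !mmulE => /addnI.
Qed.

End Affine.

(** * Monomial reduction by polynomials of degree at most 1 *)

Section LinearCase.
Variables (F : fieldType) (m n : nat) (d : 'I_m -> F -> F).
Hypothesis hd : forall i, derivation (d i).
Hypothesis hcomm : forall i j a, d i (d j a) = d j (d i a).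
Variables (lt : rel (dvar m n)) (hlt : ranking lt).
Variables (mlt : rel (dmonom m n)) (hmlt : admissible_monomial_order d mlt).
Hypothesis hcompat : compatible_with mlt lt.
Local Notation R := (dpoly_diffpoly n hd).
Implicit Types (P Q T : dpoly F m n) (v w : dvar m n) (t tau : dmon m).
Implicit Types (M N : dmonom m n) (i j : 'I_m) (b : bool).

Variables (A : bool -> R) (u : bool -> dvar m n) (s : bool -> R).
Hypothesis hA : forall b, lin lt (A b) (u b) (s b).
Hypothesis hs0 : forall b, s b != 0.
Hypothesis hAff : forall b, affine (A b : dpoly F m n).
Local Notation pair := ([:: A false; A true] : seq (dpoly F m n)).
Local Notation LM := (is_leading_monomial mlt).

Lemma affine_monomial T v M : affine T -> M \in msupp T -> M v != 0%N ->
  M = ucm v.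
Proof.
move=> hT MT; case: (hT _ MT) => [->|[w ->]]; first by rewrite moneE.
by rewrite ucmE; case: (w =P v) => [->|].
Qed.

(** Compatibility orders the monomials of degree 1 like the derivatives, and the constant monomial
    is below them all; so here leader and leading monomial agree. *)
Lemma affine_LM T v r : affine T -> lin lt (T : R) v r -> r != 0 ->
  LM T (ucm v).
Proof.
move=> hT lT r0; have [vT hv] := lin_lead hlt lT r0.
have [M MT Mv] := dvarsP _ _ vT.
have eM := affine_monomial hT MT Mv; subst M.
split; first exact: MT.
move=> N NT; case: (hT _ NT) => [->|[w e]].
  have [_ pos _ _ _] := hmlt; right; apply: pos.
  by apply/eqP => e; move: Mv; rewrite e moneE.
have wT : w \in dvars T.
  by apply/dvarsP; exists N; [exact: NT|rewrite e ucmE eqxx].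
rewrite e; case: (hv _ wT) => [->|wv]; [by left|right].
exact: hcompat.
Qed.

Definition monomial_step M v tau b Q : dpoly F m n :=
  Q - (Q@_M / (dder_mon d tau (A b))@_(ucm v)) *:
    (<< divcm M (ucm v) >> * dder_mon d tau (A b)).

Lemma member_affine_LM v tau b : v = dact tau (u b) ->
  affine (dder_mon d tau (A b)) /\ LM (dder_mon d tau (A b)) (ucm v).
Proof.
move=> ev; have aT := @affine_dder_mon _ _ _ _ hd hcomm tau _ (@hAff b).
split; first exact: aT.
apply: (affine_LM aT (r := s b)); last exact: hs0.
by rewrite ev; exact: (lin_derm hcomm hlt tau (hA b)).
Qed.

Lemma monomial_step_coef M v tau b Q : v = dact tau (u b) -> M v != 0%N ->
  (monomial_step M v tau b Q)@_M = 0.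
Proof.
move=> ev Mv; have [_ [lT _]] := member_affine_LM ev.
have e := mcoeff_mulU (divcm M (ucm v)) (ucm v) (dder_mon d tau (A b)).
rewrite (divcmK Mv) in e.
rewrite /monomial_step mcoeffB mcoeffZ e divfK ?subrr //.
by rewrite mcoeff_neq0; exact: lT.
Qed.

Lemma monomial_step_reduction M v tau b Q :
  v = dact tau (u b) -> M \in msupp Q -> M v != 0%N ->
  elementary_reduction d mlt pair Q (monomial_step M v tau b Q).
Proof.
move=> ev MQ Mv; have [_ lT] := member_affine_LM ev.
exists (A b), tau, (divcm M (ucm v)), (ucm v),
  (Q@_M / (dder_mon d tau (A b))@_(ucm v)); rewrite (divcmK Mv).
split; [exact: in_pair|exact: lT|exact: MQ|reflexivity|].
by rewrite -mcoeff_eq0 (monomial_step_coef Q ev Mv).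
Qed.

(** In a polynomial of degree at most 1, [v] occurs only in the monomial [v]. All other monomials,
    multiplied by [M] divided by [v], have exponent one less than [M] in [v]. *)
Lemma monomial_step_msupp M v tau b Q N : v = dact tau (u b) ->
  M v != 0%N -> N \in msupp (monomial_step M v tau b Q) ->
  (N v < M v)%N \/ (N \in msupp Q /\ N != M).
Proof.
move=> ev Mv NQ'; have [aT lT] := member_affine_LM ev.
have NM : N != M.
  by apply: contraTneq NQ' => ->; rewrite -mcoeff_eq0 (monomial_step_coef Q ev Mv).
move: NQ' => /(fsubsetP (msuppB_le _ _)); rewrite in_fsetU => /orP[h|h].
  by right; split.
left; move: h => /(fsubsetP (msuppZ_le _ _)) /msuppM_le[A0 [B0 [hA0 hB0 eN]]].
move: hA0 => /(fsubsetP msuppU_le); rewrite in_fset1 => /eqP eA0.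
have B0v : B0 v = 0%N.
  apply/eqP; apply: contraNT NM => hB; apply/eqP.
  by rewrite eN eA0 (affine_monomial aT hB0 hB) divcmK.
by rewrite eN mmulE B0v addn0 eA0 divcmE ucmE eqxx subn1 prednK // lt0n.
Qed.

Lemma monomial_step_upto M v tau b Q : v = dact tau (u b) -> M \in msupp Q ->
  vall (fun w => principal u w -> rle lt w v) Q ->
  vall (fun w => principal u w -> rle lt w v) (monomial_step M v tau b Q).
Proof.
move=> ev MQ hQ; apply: vallB; first exact: hQ.
apply: vallZ; apply: vallM.
  apply: vallU => w; rewrite divcmE => hw; apply: hQ; apply/dvarsP.
  exists M; first exact: MQ.
  by apply: contraNneq hw => ->.
have hl : lin lt (derm tau (A b)) v (s b) by rewrite ev; apply: lin_derm.
by move=> w wT _; exact: (lin_upto hl wT).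
Qed.

(** A monomial step need not lower the degree in [v], as it treats one monomial at a time. The
    induction is therefore on the highest principal derivative, the degree in it, and the number of
    monomials attaining this degree. *)
Lemma monomial_elimination_ind (K : dpoly F m n -> Prop) :
  (forall Q, (forall w, w \in dvars Q -> ~~ principal u w) -> K Q) ->
  (forall Q M v tau b, v = dact tau (u b) -> M \in msupp Q -> M v != 0%N ->
     K (monomial_step M v tau b Q) -> K Q) ->
  forall Q, K Q.
Proof.
move=> K0 KS.
have top Q : (forall w, w \in dvars Q -> ~~ principal u w) \/
    exists v, [/\ v \in dvars Q, principal u v &
      forall w, w \in dvars Q -> principal u w -> rle lt w v].
  case: (eqVneq [seq w <- dvars Q | principal u w] [::]) => [e|/(exists_rmax hlt)].
    left=> w wP; apply/negP => pw.
    have : w \in [seq w <- dvars Q | principal u w] by rewrite mem_filter pw.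
    by rewrite e.
  case=> v; rewrite mem_filter => /andP[pv vP] hv; right; exists v; split=> //.
  by move=> w wP pw; apply: hv; rewrite mem_filter pw.
(* By [monomial_step_msupp] a step deletes one of the counted monomials and creates none of the same
   exponent. *)
pose cnt v k Q := size [seq M <- msupp Q | (M : dmonom m n) v == k].
suff main v k c Q : vall (fun w => principal u w -> rle lt w v) Q ->
    (degv v Q <= k)%N -> (cnt v k Q <= c)%N -> K Q.
  move=> Q; case: (top Q) => [/K0 //|[v [vQ pv hv]]].
  exact: (main v (degv v Q) (cnt v (degv v Q) Q) Q hv (leqnn _) (leqnn _)).
elim/(well_founded_ind (ranking_wf hlt)): v k c Q => v IHv.
have low Q : vall (fun w => principal u w -> rle lt w v) Q ->
    v \notin dvars Q \/ ~~ principal u v -> K Q.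
  move=> hQ nv; case: (top Q) => [/K0 //|[w [wQ pw hw]]].
  have wv : lt w v.
    case/orP: (hQ _ wQ pw) => [/eqP e|//]; subst w.
    by case: nv => /negP.
  exact: (IHv w wv (degv w Q) (cnt w (degv w Q) Q) Q hw (leqnn _) (leqnn _)).
elim=> [|k IHk].
  move=> c Q hQ; rewrite leqn0 degv_eq0 => vQ _; apply: low hQ _; by left.
elim=> [|c IHc] Q hQ dQ cQ.
  apply: (IHk (cnt v k Q) Q hQ) (leqnn _); apply/degv_leP => M MQ.
  have := degv_leP _ _ _ dQ M MQ; rewrite leq_eqVlt => /orP[/eqP h|//].
  move: cQ; rewrite leqn0 size_eq0 => /eqP e.
  have : M \in [seq M <- msupp Q | (M : dmonom m n) v == k.+1].
    by rewrite mem_filter h eqxx.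
  by rewrite e.
case: (boolP (principal u v)) => [/principalP[tau [b ev]]|pv]; last first.
  by apply: low hQ _; right.
case: (boolP (has (fun M : dmonom m n => M v == k.+1) (msupp Q))) => [/hasP|/hasPn h].
  case=> M MQ /eqP Mv.
  have Mv0 : M v != 0%N by rewrite Mv.
  apply: (KS Q M v tau b ev MQ Mv0); apply: IHc.
  - exact: monomial_step_upto.
  - apply/degv_leP => N /(monomial_step_msupp ev Mv0)[|[NQ _]].
      by rewrite Mv => /ltnW.
    exact: (degv_leP _ _ _ dQ).
  rewrite -ltnS; apply: leq_trans cQ.
  have us : uniq (M :: [seq N <- msupp (monomial_step M v tau b Q) |
                         (N : dmonom m n) v == k.+1]).
    rewrite /= filter_uniq ?fset_uniq // andbT mem_filter negb_and.
    apply/orP; right; rewrite -mcoeff_eq0.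
    by rewrite (monomial_step_coef Q ev Mv0).
  apply: (uniq_leq_size us) => N; rewrite in_cons => /orP[/eqP ->|].
    by rewrite mem_filter Mv eqxx.
  rewrite !mem_filter => /andP[Nk /(monomial_step_msupp ev Mv0)].
  case=> [|[NQ _]]; first by rewrite Mv (eqP Nk) ltnn.
  by rewrite Nk.
apply: (IHk (cnt v k Q) Q hQ) (leqnn _); apply/degv_leP => M MQ.
have := degv_leP _ _ _ dQ M MQ; rewrite leq_eqVlt => /orP[h'|//].
by have := h _ MQ; rewrite h'.
Qed.

End LinearCase.

(** * Reduction, primality and characteristic sets for the pair *)

Section CommutingPair.
Variables (F : fieldType) (m n : nat) (d : 'I_m -> F -> F).
Hypothesis hd : forall i, derivation (d i).
Hypothesis hcomm : forall i j a, d i (d j a) = d j (d i a).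
Hypothesis hchar : [pchar F] =i pred0.
Variables (lt : rel (dvar m n)) (hlt : ranking lt).

Local Notation R := (dpoly_diffpoly n hd).
Implicit Types (P Q T : dpoly F m n) (v w : dvar m n) (t tau : dmon m).
Implicit Types (M N : dmonom m n) (i j : 'I_m) (b : bool).

Lemma dop_actE (T : dop F m) Q : dop_act d T Q = act T (Q : R).
Proof. by apply: eq_bigr => t _; apply: esym; apply: mul_malgC. Qed.

Variable Dl : bool -> {set 'I_m}.
Hypothesis hDl : forall b i, i \in Dl b -> i \notin Dl (~~ b).
Variables (z : dpoly F m n) (vz : dvar m n).
Hypothesis hvz : is_leader lt z vz.
Variable th : bool -> dmon m.
Hypothesis hth : forall b, dmon_on (Dl b) (th b).
Hypothesis hth0 : forall b, th b != 0.
Variable L : bool -> dop F m.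
Hypothesis hL : forall b t,
  t \in msupp (L b) -> const_field d (Dl (~~ b)) (L b)@_t.
Hypothesis hLL : act (L false) (act (L true) (z : R)) =
  act (L true) (act (L false) (z : R)).

Local Notation mem := (@member F m n d R z th L).
Local Notation satP12 := (@sat F m n d R z vz th L).
Local Notation sepz := (@sep F m n d R z vz th L).
Local Notation lead := (@leader m n vz th).
Local Notation pair := ([:: mem false; mem true] : seq (dpoly F m n)).
Local Notation SP := (@spol F m n d R z th L false).

Hypothesis hlead : forall b, is_leader lt (mem b : dpoly F m n) (lead b).

Let hvzR : vz \in vars (z : R) /\
  forall w, w \in vars (z : R) -> w = vz \/ lt w vz := hvz.
Let hleadR b : lead b \in vars (mem b) /\
  forall w, w \in vars (mem b) -> w = lead b \/ lt w (lead b) := hlead b.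

Let mlin := member_lin hchar hcomm hlt hvzR hth0 hleadR.
Let sep0 := sep_neq0 hchar hcomm hlt hvzR hth0 hleadR.

Lemma spol_pseudo_reduces : pseudo_reduces_to0 lt d pair (SP : dpoly F m n).
Proof.
apply: (spol_eliminate hchar hcomm hlt hDl hvzR hth hth0 hL hLL hleadR
  (K := fun Q : R => pseudo_reduces_to0 lt d pair (Q : dpoly F m n))).
  exact: pseudo_reduces_to0_0 mlin sep0.
move=> P v tau b ev vP hv.
exact: (pseudo_reduces_to0_eliminate hlt mlin sep0 ev vP hv).
Qed.

Lemma saturation_sat Q :
  saturation (diff_gen d pair) (separant vz z) Q <-> satP12 (Q : R).
Proof.
split=> -[r h]; exists r.
  exact: (diff_gen_gen hcomm _ lead _).1 h.
exact: (diff_gen_gen hcomm _ lead _).2 h.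
Qed.

Lemma saturation_prime :
  prime_diff_ideal d (saturation (diff_gen d pair) (separant vz z)).
Proof.
split.
- split; first split.
  + by apply/saturation_sat/genT_sat; apply: Gen0.
  + move=> P Q /saturation_sat hP /saturation_sat hQ; apply/saturation_sat.
    exact: satD hP hQ.
  + by move=> P Q /saturation_sat hQ; apply/saturation_sat; apply: satM hQ.
  + by move=> i P /saturation_sat hP; apply/saturation_sat; apply: sat_der hP.
- move/saturation_sat.
  exact: (sat_neq1 hchar hcomm hlt hDl hvzR hth hth0 hL hLL hleadR).
move=> P Q /saturation_sat.
case/(sat_prime hchar hcomm hlt hDl hvzR hth hth0 hL hLL hleadR) => h;
  [left|right]; exact/saturation_sat.
Qed.

Lemma sat_eliminate Q v tau b :
  satP12 (Q : R) ->
  satP12 (eliminate mem sepz v tau b (Q : R)).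
Proof.
move=> h; apply: satB; first exact: satM.
by apply: satM; apply: sat_member.
Qed.

(** Eliminations stay in the saturation, where a remainder without principal derivatives is 0. *)
Lemma saturation_pseudo_reduces Q :
  saturation (diff_gen d pair) (separant vz z) Q ->
  pseudo_reduces_to0 lt d pair Q.
Proof.
move/saturation_sat.
have fs b : pall (fun w => ~~ principal lead w) (sepz b) := @sep_nonprincipal _ _ _ _ R lt hlt z vz hvzR th hth0 L b.
elim/(elimination_ind hcomm hlt mlin fs): Q => [Q fQ hQ|].
  have e := sat_nonprincipal0 hchar hcomm hlt hDl hvzR hth hth0 hL hLL hleadR hQ fQ.
  by rewrite e; apply: pseudo_reduces_to0_0 mlin sep0.
move=> P v tau b ev vP hv IH hP.
apply: (pseudo_reduces_to0_eliminate hlt mlin sep0 ev vP hv).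
by apply: IH; apply: sat_eliminate.
Qed.

Lemma diff_gen_member Q : Q \in pair ->
  saturation (diff_gen d pair) (separant vz z) Q.
Proof. by move=> hQ; exists 0%N; rewrite mul1r => J _; apply. Qed.

Lemma upto_vz_reduced b Q : (forall w, w \in dvars Q -> rle lt w vz) ->
  reduced_wrt lt Q (mem b : dpoly F m n).
Proof.
move=> hQ; apply: (nonprincipal_reduced hlt mlin sep0); last first.
  exact: in_pair.
exact: (upto_nonprincipal hlt hth0 (hQ : pall _ (Q : R))).
Qed.

(** [th b] and [th (~~ b)] are nonzero with disjoint supports, so neither leader is a derivative of
    the other. *)
Lemma leader_reduced b : reduced_wrt lt (dX F (lead b)) (mem (~~ b) : dpoly F m n).
Proof.
have ne t : dact t (lead (~~ b)) <> lead b.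
  rewrite /leader -dactD => /dact_inj e.
  have /eqP := hth0 (~~ b); apply; apply/ffunP => i; rewrite dmon0.
  apply/eqP/negPn/negP => hi.
  have : th b i != 0%N.
    by rewrite -(congr1 (fun f : dmon m => f i) e) dmonD addn_eq0 negb_and hi orbT.
  by move/(hth (b := b))/hDl; rewrite (hth (b := ~~ b)).
exists (lead (~~ b)); split; first exact: hlead.
  by move=> t _; rewrite dvarsX in_fset1; apply/eqP.
rewrite (pair_deg hlt mlin sep0) ltnS leqn0 degv_eq0 dvarsX in_fset1.
by apply/eqP; rewrite -[lead (~~ b)]dact0; apply: ne.
Qed.

(** Initial and separant of [member b] coincide with [sep b], which involves only derivatives up to
    [vz], and these lie below both leaders. *)
Lemma pair_triangular : d_triangular lt pair.
Proof.
move=> P Q u /mem_pair[b ->] /mem_pair[b' ->] PQ hu.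
have {PQ} bb' : b != b' by apply/eqP => e; apply: PQ; rewrite e; reflexivity.
have eb' : b' = ~~ b by move: bb'; clear; case: b b' => -[].
subst b'; have -> : u = lead b.
  exact: (is_leader_uniq hlt hu (hlead b)).
have sE : separant (lead b) (mem b : dpoly F m n) = sepz b.
  exact: (lin_pd hlt (mlin b)).
have iE : initial (lead b) (mem b : dpoly F m n) = sepz b.
  apply: etrans (lin_coef hlt (mlin b)).
  exact: (congr1 (fun k => coefv (lead b) k (mem b)) (pair_deg hlt mlin sep0 b)).
have us : @pall F m n d R (fun w => rle lt w vz) (sepz b).
  by apply: pallM; [exact: pallC|exact: S_upto hvzR].
split; first exact: leader_reduced.
  by rewrite iE; apply: upto_vz_reduced us.
by rewrite sE; apply: upto_vz_reduced us.
Qed.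

Lemma pair_characteristic : triangular_characteristic_set lt d pair
  (saturation (diff_gen d pair) (separant vz z)).
Proof.
split; first exact: pair_triangular.
by split=> [P|P]; [apply: diff_gen_member|apply: saturation_pseudo_reduces].
Qed.

Lemma saturation_factors (A : bool -> dpoly F m n) :
  (forall b, divides (A b) (mem b : dpoly F m n)) ->
  (forall b, is_leader lt (A b) (lead b)) ->
  forall Q, saturation (diff_gen d pair) (separant vz z) Q <->
    saturation (diff_gen d [:: A false; A true])
      (separant (lead false) (A false) * separant (lead true) (A true)) Q.
Proof.
move=> hA hAl Q; have [B hB] := functional_choice _ hA.
have := @factor_saturation _ _ _ _ hchar hcomm R _ hlt _ hDl z _ hvzR _ hth hth0 _ hL hLL hleadR
  A B hB (fun b => (hAl b).1) Q.
move=> h; apply: (iff_trans (saturation_sat Q)); apply: (iff_trans h).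
split=> -[r g]; exists r.
  exact: (@diff_gen_gen F m n d hd hcomm A lead _).2 g.
exact: (@diff_gen_gen F m n d hd hcomm A lead _).1 g.
Qed.

Section LinearGenerator.
Hypothesis hz : linear_dpoly z.

Lemma member_affine b : affine (mem b : dpoly F m n).
Proof.
have -> : (mem b : dpoly F m n) = \sum_(t <- (th b |` msupp (L b))%fset)
    ((t == th b)%:R - (L b)@_t) *: dder_mon d t z.
  apply: etrans (@member_sum _ _ _ _ R z th L b) _.
  by apply: eq_bigr => t _; exact: mul_malgC.
apply: (big_ind _ (@affine0 F m n) (@affineD F m n)) => t _.
apply: affineZ; apply: (affine_dder_mon hd hcomm); exact: linear_affine.
Qed.

Lemma separant_const : exists2 e : F, e != 0 & pd vz (z : R) = dpC R e.
Proof.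
have [e ee] := vars0_const (affine_pderiv_vars vz (linear_affine hz) :
  vars (pd vz (z : R)) = fset0).
exists e; last exact: ee.
apply: contraNneq (S_neq0 hchar hvzR) => e0; apply/eqP.
by apply: etrans ee _; rewrite e0; exact: rmorph0.
Qed.

Lemma diff_gen_saturation Q :
  diff_gen d pair Q <-> saturation (diff_gen d pair) (separant vz z) Q.
Proof.
split=> [h|/saturation_sat[r]]; first by exists 0%N; rewrite mul1r.
have [e e0 ee] := separant_const => h.
by apply: (diff_gen_gen hcomm _ lead _).2; apply: (sat_const e0 ee); exists r.
Qed.

Lemma diff_gen_prime : prime_diff_ideal d (diff_gen d pair).
Proof.
have [[[s0 sD sM] sd] s1 sp] := saturation_prime.
split.
- split; first split.
  + exact/diff_gen_saturation.
  + by move=> P Q /diff_gen_saturation hP /diff_gen_saturation hQ;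
       apply/diff_gen_saturation; apply: sD.
  + by move=> P Q /diff_gen_saturation hQ; apply/diff_gen_saturation; apply: sM.
  + by move=> i P /diff_gen_saturation hP; apply/diff_gen_saturation; apply: sd.
- by move/diff_gen_saturation.
by move=> P Q /diff_gen_saturation/sp[] h; [left|right];
  exact/diff_gen_saturation.
Qed.

(** A monomial step only subtracts an element of the ideal, so membership persists down to a
    polynomial without principal derivatives, which is 0. *)
Lemma pair_standard_basis (mlt : rel (dmonom m n)) :
  admissible_monomial_order d mlt -> compatible_with mlt lt ->
  diff_standard_basis d mlt pair (diff_gen d pair).
Proof.
move=> hmlt hcompat; split=> [Q hQ J _ h|]; first exact: (h Q hQ).
suff main Q : satP12 (Q : R) -> reduces_to0 d mlt pair Q.
  by move=> Q /diff_gen_saturation/saturation_sat/main.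
apply: (monomial_elimination_ind hcomm hlt hmlt hcompat mlin sep0 member_affine
  (K := fun Q => satP12 (Q : R) -> reduces_to0 d mlt pair Q)) Q.
  move=> Q fQ hQ.
  have e := sat_nonprincipal0 hchar hcomm hlt hDl hvzR hth hth0 hL hLL hleadR hQ fQ.
  by rewrite e; apply: rt1n_refl.
move=> Q M v tau b ev MQ Mv IH hQ.
have st := monomial_step_reduction hcomm hlt hmlt hcompat mlin sep0 member_affine ev MQ Mv.
apply: rt1n_trans st _; apply: IH.
apply: satB; first exact: hQ.
rewrite -mul_malgC; apply: satM; apply: satM; exact: sat_member.
Qed.

End LinearGenerator.

(** * The S-polynomial under an arbitrary admissible monomial order *)

Section MonomialReduction.
Variables (mlt : rel (dmonom m n)) (hmlt : admissible_monomial_order d mlt).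
Local Notation LM := (is_leading_monomial mlt).

Lemma LM_z : exists M, LM z M /\ M != mone.
Proof.
have [vzz _] := hvz; have [N Nz Nv] := dvarsP _ _ vzz.
have z0 : z != 0 by apply: contraTneq Nz => ->; rewrite msupp0.
have [M lM] := exists_LM hmlt z0; exists M; split; first exact: lM.
have [_ hM] := lM; apply/negP => /eqP e.
have N1 : N != mone by apply: contraNneq Nv => ->; rewrite moneE.
have [_ pos _ _ _] := hmlt; case: (hM _ Nz) => h; first by rewrite h e eqxx in N1.
by move: (mlt_trans hmlt h (eq_ind_r (fun M => mlt M N) (pos _ N1) e));
   rewrite (mlt_irr hmlt).
Qed.

(** Injectivity comes from the weights: [weight j] of the leading monomial exceeds that of [z] by
    exactly [t j], for every [j]. *)
Lemma LM_derm_z : exists lm : dmon m -> dmonom m n,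
  [/\ forall t, LM (dder_mon d t z) (lm t), forall t, lm t != mone
    & injective lm].
Proof.
have [M [lM M1]] := LM_z.
have h t : exists M', [/\ LM (dder_mon d t z) M', M' != mone
    & forall j, weight j M' = (weight j M + t j)%N].
  have [M' [l _ n1 w]] := LM_derm hd hcomm hchar hlt hmlt t lM lM M1.
  by exists M'; split; [exact: l|exact: n1|exact: w].
have [lm hlm] := functional_choice _ h.
exists lm; split=> [t|t|t t' e].
- by have [l _ _] := hlm t; exact: l.
- by have [_ n1 _] := hlm t; exact: n1.
apply/ffunP => j; have [_ _ w] := hlm t; have [_ _ w'] := hlm t'.
by apply/eqP; rewrite -(eqn_add2l (weight j M)) -w -w' e.
Qed.

(** The terms of [th b - L b] applied to [z] have distinct leading monomials, so the largest one,
    from an operator [eta], survives; [LM_derm] shows that the same [eta] serves for every [tau]. *)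
Lemma LM_member (lm : dmon m -> dmonom m n) b :
  (forall t, LM (dder_mon d t z) (lm t)) -> (forall t, lm t != mone) ->
  injective lm ->
  exists eta, (eta = th b \/ eta \in lsupp th L b) /\
    forall tau, LM (dder_mon d tau (mem b : dpoly F m n)) (lm (tau + eta)).
Proof.
move=> hlm lm1 lmI.
pose k t := (t == th b)%:R - (L b)@_t.
pose s := [seq t <- (th b |` msupp (L b))%fset | k t != 0].
have eP : (mem b : dpoly F m n) = \sum_(t <- s) k t *: dder_mon d t z.
  apply: etrans (@member_sum _ _ _ _ R z th L b) _.
  rewrite /s big_filter [RHS]big_mkcond; apply: eq_bigr => t _.
  rewrite -/(k t); case: (eqVneq (k t) 0) => [->|_] /=; last exact: mul_malgC.
  by apply: etrans (mul_malgC _ _) _; rewrite scale0r.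
have hs t : t \in s -> LM (k t *: dder_mon d t z) (lm t).
  rewrite mem_filter => /andP[kt _]; apply: (LM_scale kt); exact: hlm.
have us : uniq (map lm s).
  rewrite (map_inj_uniq lmI) /s; apply: filter_uniq; exact: fset_uniq.
have s0 : s != [::].
  have := (member_lead hchar hcomm hlt hvzR hth0 hleadR b).1 => a0.
  have : th b \in s.
    by rewrite mem_filter in_fsetU in_fset1 eqxx /k eqxx andbT; exact: a0.
  by move=> hb; apply/negP => /eqP e; rewrite e in_nil in hb.
have [eta [etas lP _]] := LM_sum hmlt hs us s0.
exists eta; split.
  move: etas; rewrite mem_filter => /andP[_].
  rewrite in_fsetU in_fset1 => /orP[/eqP h|h]; first by left.
  case: (eqVneq eta (th b)) => [h'|ne]; first by left.
  by right; rewrite in_fsetD1 ne.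
move=> tau; rewrite -eP in lP.
have [M' [l1 l2 _ _]] := LM_derm hd hcomm hchar hlt hmlt tau lP (hlm eta) (lm1 eta).
have -> : lm (tau + eta) = M'.
  apply: (LM_uniq hmlt (hlm (tau + eta))).
  have -> : dder_mon d (tau + eta) z = dder_mon d tau (dder_mon d eta z).
    exact: (@dermA _ _ _ _ R hcomm).
  exact: l2.
exact: l1.
Qed.

(* A monomial order need not put the leading monomial of [theta P_i] on the
   theta_i z part: [eta b] records the operator of [th b - L b] that carries it.
   If the leading monomials of the two halves of the S-polynomial differ, each
   half is reduced to 0 by itself; otherwise [eta b = th b] for both [b]. *)
Lemma spol_reduces : reduces_to0 d mlt pair (SP : dpoly F m n).
Proof.
have [lm [hlm lm1 lmI]] := LM_derm_z.
have hm b := LM_member b hlm lm1 lmI.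
have [eta heta] := functional_choice _ hm.
pose X := (F * dmon m * bool)%type.
pose lmx (x : X) := lm (x.1.2 + eta x.2).
have main (s : seq X) : (forall x, x \in s -> x.1.1 != 0) ->
    uniq [seq x.1.2 + eta x.2 | x <- s] ->
    reduces_to0 d mlt pair
      (\sum_(x <- s) x.1.1 *: dder_mon d x.1.2 (mem x.2 : dpoly F m n)).
  move=> hs us; apply: (reduces_terms hmlt (c := fun x : X => x.1.1)
    (tau := fun x : X => x.1.2) (g := fun x : X => mem x.2) (lm := lmx)).
    move=> x xs; split; [exact: hs|exact: in_pair|].
    by have [_] := heta x.2; apply.
  rewrite /lmx; have -> : [seq lm (x.1.2 + eta x.2) | x <- s] =
      map lm [seq x.1.2 + eta x.2 | x <- s] by rewrite -map_comp.
  by rewrite (map_inj_uniq lmI).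
case: (eqVneq (th true + eta false) (th false + eta true)) => [e|ne]; last first.
  have := main [:: (1, th true, false); (-1, th false, true)].
  rewrite big_cons big_seq1 /= scale1r scaleN1r; apply.
    by move=> x; rewrite !inE => /orP[/eqP ->|/eqP ->];
       rewrite ?oppr_eq0 oner_eq0.
  by rewrite mem_seq1 andbT.
(* On the support of [th b], where [th (~~ b)] vanishes, the equality [e] makes [eta b] at least
   [th b]; no operator of [lsupp b] is a multiple of [th b]. *)
have eE b : eta b = th b.
  have [[//|hb] _] := heta b.
  case: (lsupp_not_above hchar hcomm hlt hvzR hth0 hleadR hb) => i.
  case: (posnP (th b i)) => [-> //|hi].
  have iD : i \in Dl b by apply: hth; rewrite -lt0n.
  have t0 : th (~~ b) i = 0%N.
    by apply/eqP/negPn/negP => /(hth (b := ~~ b)); rewrite (negPf (hDl iD)).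
  have : th (~~ b) + eta b = th b + eta (~~ b) by case: (b).
  move/(congr1 (fun f : dmon m => f i)); rewrite /= !dmonD t0 add0n => ->.
  exact: leq_addr.
have [s [s0 us es]] := spol_terms hchar hcomm hlt hDl hvzR hth hth0 hL hLL hleadR.
have -> : (SP : dpoly F m n) =
    \sum_(x <- s) x.1.1 *: dder_mon d x.1.2 (mem x.2 : dpoly F m n).
  apply: etrans es _; apply: eq_bigr => x _; exact: mul_malgC.
apply: main; first exact: s0.
have -> : [seq x.1.2 + eta x.2 | x <- s] = [seq leading_theta th x | x <- s].
  by apply: eq_map => x; rewrite /= eE.
exact: us.
Qed.

End MonomialReduction.

End CommutingPair.

Theorem mainTheorem1
  (F : fieldType) (m n : nat) (d : 'I_m -> F -> F) (hF : diff_field0 d)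
  (D1 D2 D3 : {set 'I_m})
  (h12 : [disjoint D1 & D2]) (h13 : [disjoint D1 & D3])
  (h23 : [disjoint D2 & D3])
  (lt : rel (dvar m n)) (hlt : ranking lt)
  (z P1 P2 : dpoly F m n) (hz : ~ in_base z)
  (vz : dvar m n) (hvz : is_leader lt z vz)
  (th1 th2 : dmon m)
  (hth1 : dmon_on D1 th1) (hth1n : th1 != 0)
  (hth2 : dmon_on D2 th2) (hth2n : th2 != 0)
  (hv1 : is_leader lt P1 (dact th1 vz))
  (hv2 : is_leader lt P2 (dact th2 vz))
  (L1 L2 : dop F m)
  (hL1 : dop_over d D2 (D1 :|: D3) L1)
  (hL2 : dop_over d D1 (D2 :|: D3) L2)
  (hL12 : forall Q : dpoly F m n,
     dop_act d L1 (dop_act d L2 Q) = dop_act d L2 (dop_act d L1 Q))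
  (hP1 : P1 = dder_mon d th1 z - dop_act d L1 z)
  (hP2 : P2 = dder_mon d th2 z - dop_act d L2 z) :
  let SPol := dder_mon d th2 P1 - dder_mon d th1 P2 in
  let Sz := separant vz z in
  let J := saturation (diff_gen d [:: P1; P2]) Sz in
  [/\ (* (i) *)
      forall mlt : rel (dmonom m n),
        admissible_monomial_order d mlt -> compatible_with mlt lt ->
        reduces_to0 d mlt [:: P1; P2] SPol,
      (* (ii) *)
      pseudo_reduces_to0 lt d [:: P1; P2] SPol,
      (* (iii) *)
      linear_dpoly z ->
        prime_diff_ideal d (diff_gen d [:: P1; P2]) /\
        forall mlt : rel (dmonom m n),
          admissible_monomial_order d mlt -> compatible_with mlt lt ->
          diff_standard_basis d mlt [:: P1; P2] (diff_gen d [:: P1; P2])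
    & (* (iv) *)
      [/\ prime_diff_ideal d J,
          triangular_characteristic_set lt d [:: P1; P2] J,
          autoreduced lt [:: P1; P2] -> characteristic_set lt d [:: P1; P2] J
        & forall A1 A2 : dpoly F m n,
            irreducible A1 -> divides A1 P1 -> is_leader lt A1 (dact th1 vz) ->
            irreducible A2 -> divides A2 P2 -> is_leader lt A2 (dact th2 vz) ->
            let SA := separant (dact th1 vz) A1 * separant (dact th2 vz) A2 in
            forall Q, J Q <-> saturation (diff_gen d [:: A1; A2]) SA Q]].
Proof.
have [hchar hd hcomm] := hF.
pose th b := if b then th2 else th1.
pose L b := if b then L2 else L1.
pose Dl b := if b then D2 else D1.
pose R := dpoly_diffpoly n hd.
have hDl b i : i \in Dl b -> i \notin Dl (~~ b).
  case: b => /= iD; last by rewrite (disjointFr h12 iD).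
  by apply/negP => iD1; have := disjointFr h12 iD1; rewrite iD.
have hth b : dmon_on (Dl b) (th b) by case: b; [exact: hth2|exact: hth1].
have hth0 b : th b != 0 by case: b; [exact: hth2n|exact: hth1n].
have hL b t : t \in msupp (L b) -> const_field d (Dl (~~ b)) (L b)@_t.
  by case: b => /= tL; [exact: (hL2 t tL).1|exact: (hL1 t tL).1].
have hLL : act (L false) (act (L true) (z : R)) =
    act (L true) (act (L false) (z : R)).
  have act2 T T' : dop_act d T (dop_act d T' z) = act T (act T' (z : R)).
    exact: etrans (dop_actE hd _ _) (congr1 (act (R := R) T) (dop_actE hd _ _)).
  exact: etrans (esym (act2 L1 L2)) (etrans (hL12 z) (act2 L2 L1)).
have e1 : P1 = member (R := R) z th L false.
  exact: etrans hP1 (congr1 (fun t => dder_mon d th1 z - t) (dop_actE hd _ _)).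
have e2 : P2 = member (R := R) z th L true.
  exact: etrans hP2 (congr1 (fun t => dder_mon d th2 z - t) (dop_actE hd _ _)).
clear hP1 hP2; subst P1 P2.
have hlead b : is_leader lt (member (R := R) z th L b : dpoly F m n)
    (leader vz th b) by case: b; [exact: hv2|exact: hv1].
move=> SPol Sz J; split.
- move=> mlt hmlt _.
  exact: (spol_reduces hcomm hchar hlt hDl hvz hth hth0 hL hLL hlead hmlt).
- exact: (spol_pseudo_reduces hcomm hchar hlt hDl hvz hth hth0 hL hLL hlead).
- move=> hlin; split.
    exact: (diff_gen_prime hcomm hchar hlt hDl hvz hth hth0 hL hLL hlead hlin).
  move=> mlt hmlt hcompat.
  exact: (pair_standard_basis hcomm hchar hlt hDl hvz hth hth0 hL hLL hlead
    hlin hmlt hcompat).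
have hJ := pair_characteristic hcomm hchar hlt hDl hvz hth hth0 hL hLL hlead.
split.
- exact: (saturation_prime hcomm hchar hlt hDl hvz hth hth0 hL hLL hlead).
- exact: hJ.
(* The reducing property is common to both notions of characteristic set; only the triangularity
   condition is replaced. *)
- by move=> hauto; split; [exact: hauto|exact: hJ.2].
move=> A1 A2 _ hA1 hl1 _ hA2 hl2 SA Q.
apply: (saturation_factors hcomm hchar hlt hDl hvz hth hth0 hL hLL hlead
  (A := fun b => if b then A2 else A1)).
  by case; [exact: hA2|exact: hA1].
by case; [exact: hl2|exact: hl1].
Qed.
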